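(* The weak solution $(Y(t):t\in[0,T])$ of the stochastic Cauchy problem $\mathrm dY(t)=AY(t)\,\mathrm dt+B\,\mathrm dL(t)$, $Y(0)=y_0$, is stochastically continuous, i.e. $Y(s)\to Y(t)$ in probability in $V$ as $s\to t$, for every $t\in[0,T]$.
   Context: Let $(\Omega,\mathcal F,P)$ be a probability space and $U,V$ separable real Hilbert spaces; $A$ generates a strongly continuous semigroup $(T(t))_{t\ge0}$ on $V$, $B\in\mathcal L(U,V)$, $y_0\in V$. A cylindrical Lévy process $L$ in $U$ is a family $(L(t))_{t\ge0}$ of linear continuous maps $U\to L^0_P(\Omega;\mathbb R)$ such that for all $u_1,\dots,u_n\in U$ the process $((L(t)u_1,\dots,L(t)u_n))_{t\ge0}$ is a Lévy process in $\mathbb R^n$. A $V$-valued process $Y$ is weakly Bochner regular if $t\mapsto\langle Y(t),g(t)\rangle$ is integrable on $[0,T]$ a.s. for each $g\in C([0,T];V)$ and $\int_0^T\langle Y(s),g_n(s)\rangle\,\mathrm ds\to0$ in probability whenever $g_n\in C([0,T];V)$, $\|g_n\|_\infty\to0$. A $V$-valued progressively measurable process $(Y(t))_{t\in[0,T]}$ is a weak solution if it is weakly Bochner regular and for every $v\in\mathcal D(A^* )$ and $t\in[0,T]$, a.s., $\langle Y(t),v\rangle=\langle y_0,v\rangle+\int_0^t\langle Y(s),A^*v\rangle\,\mathrm ds+L(t)(B^*v)$. *)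

(* Defs.v *)
From HB Require Import structures.
From mathcomp Require Import all_boot all_order all_algebra.
From mathcomp Require Import all_classical all_reals all_analysis.
Set Implicit Arguments. Unset Strict Implicit. Unset Printing Implicit Defensive.
Import Order.TTheory GRing.Theory Num.Theory.
Import numFieldNormedType.Exports.
Local Open Scope classical_set_scope.
Local Open Scope ring_scope.

Definition is_inner_product (R : realType) (V : normedModType R)
  (ip : V -> V -> R) : Prop :=
  [/\ (forall x y, ip x y = ip y x),
      (forall (a : R) x y z, ip (a *: x + y) z = a * ip x z + ip y z) &
      (forall x, ip x x = `|x| ^+ 2)].

Definition separable_hilbert (R : realType) (V : completeNormedModType R)
  (ip : V -> V -> R) : Prop :=
  is_inner_product ip /\ exists D : set V, countable D /\ dense D.

Definition C0_semigroup (R : realType) (V : normedModType R)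
  (S : R -> V -> V) : Prop :=
  [/\ (forall t, 0 <= t -> forall (a : R) x y, S t (a *: x + y) = a *: S t x + S t y),
      (forall t, 0 <= t -> continuous (S t)),
      (forall x, S 0 x = x),
      (forall s t, 0 <= s -> 0 <= t -> forall x, S (s + t) x = S s (S t x)) &
      (forall x, S h x @[h --> 0^'+] --> x)].

Definition generates (R : realType) (V : normedModType R)
  (DA : set V) (A : V -> V) (S : R -> V -> V) : Prop :=
  (forall x, DA x <-> exists l : V, h^-1 *: (S h x - x) @[h --> 0^'+] --> l) /\
  (forall x, DA x -> h^-1 *: (S h x - x) @[h --> 0^'+] --> A x).

Section Prob.
Context {d : measure_display} {Omega : measurableType d} {R : realType}.
Variable P : probability Omega R.

Definition borel_sets (W : topologicalType) : set (set W) :=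
  <<s [set G : set W | open G] >>.

Definition borelRn (n : nat) : set (set ('I_n -> R)) :=
  <<s [set S | exists (i : 'I_n) (A : set R), measurable A /\ S = [set x | A (x i)]] >>.

Definition rvRn (n : nat) (X : Omega -> 'I_n -> R) : Prop :=
  forall B, borelRn B -> measurable (X @^-1` B).

Definition supnorm (n : nat) (x : 'I_n -> R) : R := \big[Num.max/0]_(i < n) `|x i|.

Definition indep_vectors (n m : nat) (Z : 'I_m -> Omega -> 'I_n -> R) : Prop :=
  forall B : 'I_m -> set ('I_n -> R), (forall k, borelRn (B k)) ->
    P (\bigcap_(k in [set: 'I_m]) (Z k @^-1` B k)) =
    (\prod_(k < m) P (Z k @^-1` B k))%E.

Definition levy_process (n : nat) (X : R -> Omega -> 'I_n -> R) : Prop :=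
  [/\ (forall t, 0 <= t -> rvRn (X t)),
      {ae P, forall w, X 0 w = (fun _ => 0)},
      (forall (m : nat) (ts : nat -> R), 0 <= ts 0%N ->
          (forall k, ts k <= ts k.+1) ->
          indep_vectors (fun (k : 'I_m) w i => X (ts k.+1) w i - X (ts k) w i)),
      (forall s h, 0 <= s -> 0 <= h -> forall B, borelRn B ->
          P ((fun w i => X (s + h) w i - X s w i) @^-1` B) =
          P ((fun w i => X h w i - X 0 w i) @^-1` B)) &
      (forall t, 0 <= t -> forall e : R, 0 < e ->
          P [set w | e < supnorm (fun i => X s w i - X t w i)]
            @[s --> within [set s | 0 <= s] (nbhs t)] --> 0%E)].

Definition cvg_in_prob_seq (X : nat -> Omega -> R) (Y : Omega -> R) : Prop :=
  forall e : R, 0 < e -> P [set w | e < `|X k w - Y w|] @[k --> \oo] --> 0%E.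

(* cylindrical Levy process in U: each L t is a linear continuous map
   U -> L^0_P(Omega; R), and all finite-dimensional projections are Levy *)
Definition cylindrical_levy (U : normedModType R) (L : R -> U -> Omega -> R) : Prop :=
  [/\ (forall t u, measurable_fun setT (L t u)),
      (forall t (a : R) u1 u2,
          {ae P, forall w, L t (a *: u1 + u2) w = a * L t u1 w + L t u2 w}),
      (forall t (un : nat -> U) (u : U), un k @[k --> \oo] --> u ->
          cvg_in_prob_seq (fun k => L t (un k)) (L t u)) &
      (forall (n : nat) (u : 'I_n -> U),
          levy_process (fun t w i => L t (u i) w))].

Definition filtration (F : R -> set (set Omega)) : Prop :=
  [/\ (forall t, sigma_algebra setT (F t)),
      (forall t, F t `<=` measurable) &
      (forall s t, s <= t -> F s `<=` F t)].

Definition prog_measurable (V : topologicalType) (F : R -> set (set Omega))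
  (T : R) (Y : R -> Omega -> V) : Prop :=
  forall t, 0 <= t <= T -> forall G, borel_sets G ->
    <<s [set S | exists A : set R, exists B : set Omega,
                  [/\ measurable A, F t B & S = A `*` B]] >>
      [set p : R * Omega | 0 <= p.1 <= t /\ G (Y p.1 p.2)].

Definition weakly_bochner_regular (V : normedModType R) (ip : V -> V -> R)
  (T : R) (Y : R -> Omega -> V) : Prop :=
  (forall g : R -> V, {within `[0, T], continuous g} ->
     {ae P, forall w, (@lebesgue_measure R).-integrable `[0, T]
                        (fun s => (ip (Y s w) (g s))%:E)}) /\
  (forall gn : nat -> R -> V,
     (forall k, {within `[0, T], continuous (gn k)}) ->
     (forall e : R, 0 < e -> \forall k \near \oo,
         forall s, 0 <= s <= T -> `|gn k s| <= e) ->
     cvg_in_prob_seq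
       (fun k w => fine (\int[@lebesgue_measure R]_(s in `[0, T]) (ip (Y s w) (gn k s))%:E))
       (fun _ => 0)).

End Prob.

(* The adjoint A^* of (DA, A) is encoded literally: v is in D(A^* ) with
   A^* v = w  iff  <A u, v> = <u, w> for all u in D(A). B^* is the Hilbert
   adjoint Bs of B (see the theorem hypotheses). *)
Definition weak_solution {d : measure_display} {Omega : measurableType d}
  {R : realType} (P : probability Omega R) (F : R -> set (set Omega))
  {U V : normedModType R} (ipV : V -> V -> R)
  (DA : set V) (A : V -> V) (Bs : V -> U) (L : R -> U -> Omega -> R)
  (y0 : V) (T : R) (Y : R -> Omega -> V) : Prop :=
  [/\ prog_measurable F T Y,
      weakly_bochner_regular P ipV T Y &
      (forall v w : V, (forall u, DA u -> ipV (A u) v = ipV u w) ->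
       forall t, 0 <= t <= T ->
       {ae P, forall om,
          (ipV (Y t om) v)%:E =
          ((ipV y0 v)%:E
           + \int[@lebesgue_measure R]_(s in `[0%R, t]) (ipV (Y s om) w)%:E
           + (L t (Bs v) om)%:E)%E})].

(* Main.v *)
(* Set Z(a,h) = Y(a+h) - S(h) Y(a).  Without a stochastic convolution formula at hand, the
   weak equation is tested on a grid of [a, a+h] against the adjoint orbit S*(h-q) A*v:
   <Z(a,h), v> is then a linear functional of increments of L over [a, a+h], up to terms
   that vanish in probability as the grid is refined.  Two of these are controlled by weak
   Bochner regularity, the third is the error of a Riemann sum for a merely measurable path,
   which is small for a suitable shift of the grid.  Hence P(|Z(a,h)| > e) is bounded by
   P(|Z(a',h)| > C e) for all a, a' and a fixed C > 0, by stationarity and independence of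
   the increments of L and a countable norming family of vectors v.  Pathwise
   L^1-continuity of translations and Fubini give, for small h, at least one a' for which
   the right-hand side is small, so Z(a,h) tends to 0 in probability uniformly in a.
   Finally Y(t) - Y(s) = Z(a,t-a) - Z(a,s-a) + (S(t-a) - S(s-a)) Y(a) for a slightly
   smaller than t. *)
Require Import Defs.
From HB Require Import structures.
From mathcomp Require Import all_boot all_order all_algebra.
From mathcomp Require Import all_classical all_reals all_analysis.
From mathcomp Require Import measurable_realfun ring lra.
Import Order.TTheory GRing.Theory Num.Theory.
Import numFieldNormedType.Exports.
Local Open Scope classical_set_scope.
Local Open Scope ring_scope.

(** * Inner products and the Riesz representation theorem *)

(** The weak equation tested with a fixed [v] leaves a drift integral of [Y], which is not a
    functional of [L]; letting the test vector run along the adjoint orbit cancels it, as in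
    Duhamel's formula. Only finitely many deterministic times are used: the equation holds almost
    surely for each time separately, and only finite-dimensional laws of [L] are available. This
    forces a grid. [Y] has no path regularity and its norm need not be integrable in time, so scalar
    pairings are estimated through weak Bochner regularity, and Riemann sums are controlled only for
    most shifts. The term [S h (Y a)] is subtracted because the remainder then depends, up to
    vanishing errors, only on increments of [L] after [a]. The grid is refined with [a], [a'] and
    [h] fixed and only the limiting inequality is kept, so the approximation may be non-uniform in
    them. The transfer constant is the inverse of twice the bound on the norming vectors; the factor
    2 pays for the loss of level in the comparison of probabilities. *)

Section InnerProduct.
Context {R : realType} {V : normedModType R} (ip : V -> V -> R).
Hypothesis ipP : is_inner_product ip.

Lemma ipC x y : ip x y = ip y x. Proof. by case: ipP. Qed.

Lemma ipDZl a x y z : ip (a *: x + y) z = a * ip x z + ip y z.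
Proof. by case: ipP. Qed.

Lemma ipxx x : ip x x = `|x| ^+ 2. Proof. by case: ipP. Qed.

Lemma ip0l z : ip 0 z = 0.
Proof. by have := ipDZl (-1) 0 0 z; rewrite scaler0 addr0 mulN1r addNr. Qed.

Lemma ipDl x y z : ip (x + y) z = ip x z + ip y z.
Proof. by rewrite -[x]scale1r ipDZl mul1r scale1r. Qed.

Lemma ipZl a x z : ip (a *: x) z = a * ip x z.
Proof. by rewrite -[_ *: _]addr0 ipDZl ip0l addr0. Qed.

Lemma ipNl x z : ip (- x) z = - ip x z.
Proof. by rewrite -scaleN1r ipZl mulN1r. Qed.

Lemma ipBl x y z : ip (x - y) z = ip x z - ip y z.
Proof. by rewrite ipDl ipNl. Qed.

Lemma ip0r z : ip z 0 = 0. Proof. by rewrite ipC ip0l. Qed.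

Lemma ipDr x y z : ip z (x + y) = ip z x + ip z y.
Proof. by rewrite ipC ipDl !(ipC z). Qed.

Lemma ipZr a x z : ip z (a *: x) = a * ip z x.
Proof. by rewrite ipC ipZl (ipC z). Qed.

Lemma ipNr x z : ip z (- x) = - ip z x.
Proof. by rewrite ipC ipNl (ipC z). Qed.

Lemma ipBr x y z : ip z (x - y) = ip z x - ip z y.
Proof. by rewrite ipDr ipNr. Qed.

Lemma ip_sumr (I : Type) (s : seq I) (Q : pred I) (f : I -> V) z :
  ip z (\sum_(i <- s | Q i) f i) = \sum_(i <- s | Q i) ip z (f i).
Proof.
by elim/big_rec2: _ => [|i x y _ <-]; rewrite ?ip0r ?ipDr.
Qed.

Lemma normDZ_sqr a x y :
  `|a *: x + y| ^+ 2 = a ^+ 2 * `|x| ^+ 2 + 2 * a * ip x y + `|y| ^+ 2.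
Proof. by rewrite -!ipxx ipDl !ipDr !ipZl !ipZr (ipC y x); ring. Qed.

Lemma cauchy_schwarz x y : `|ip x y| <= `|x| * `|y|.
Proof.
have [->|x0] := eqVneq x 0; first by rewrite ip0l !normr0 mul0r.
have nx : 0 < `|x| by rewrite normr_gt0.
have := sqr_ge0 `|(- (ip x y / `|x| ^+ 2)) *: x + y|.
rewrite normDZ_sqr.
have -> : (- (ip x y / `|x| ^+ 2)) ^+ 2 * `|x| ^+ 2 + 2 * - (ip x y / `|x| ^+ 2) * ip x y +
  `|y| ^+ 2 = `|y| ^+ 2 - (ip x y / `|x|) ^+ 2 by field; rewrite normr_eq0.
rewrite subr_ge0 => h.
rewrite -ler_pdivrMl// mulrC -(ler_pXn2r (n := 2)) ?nnegrE ?divr_ge0//.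
by rewrite expr_div_n real_normK ?num_real// -expr_div_n.
Qed.

(** Take [u := x]. Adjoints and means are known only through their pairings, and their norm bounds
    are obtained this way. *)
Lemma ip_le_norm (x : V) (c : R) : 0 <= c -> (forall u, ip u x <= c * `|u|) -> `|x| <= c.
Proof.
move=> c0 /(_ x); rewrite ipxx expr2.
have [->|x0] := eqVneq x 0; first by rewrite normr0.
by rewrite ler_pM2r// normr_gt0.
Qed.

Lemma eq_ip (x y : V) : (forall u, ip u x = ip u y) -> x = y.
Proof.
move=> h; apply/eqP; rewrite -subr_eq0 -normr_le0; apply: ip_le_norm => // u.
by rewrite ipBr h subrr mul0r.
Qed.

Lemma continuous_ip : continuous (fun p : V * V => ip p.1 p.2).
Proof.
move=> -[x y]; apply/cvgrPdist_le => /= e e0.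
have h : (fun p : V * V => `|x - p.1| * `|p.2| + `|x| * `|y - p.2|) @ nbhs (x, y) --> (0:R).
  have c1 : (fun p : V * V => p.1) @ nbhs (x, y) --> x by exact: cvg_fst.
  have c2 : (fun p : V * V => p.2) @ nbhs (x, y) --> y by exact: cvg_snd.
  rewrite [X in _ --> X](_ : _ = `|x - x| * `|y| + `|x| * `|y - y|); last first.
    by rewrite !subrr normr0 mul0r mulr0 addr0.
  apply: cvgD; apply: cvgM.
  - by apply: cvg_norm; apply: cvgB => //; exact: cvg_cst.
  - exact: cvg_norm.
  - exact: cvg_cst.
  - by apply: cvg_norm; apply: cvgB => //; exact: cvg_cst.
move/cvgr0_norm_le : h => /(_ _ e0); apply: filterS => -[x' y'] /=.
rewrite ger0_norm ?addr_ge0// => /(le_trans _); apply.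
have -> : ip x y - ip x' y' = ip (x - x') y' + ip x (y - y').
  by rewrite ipBl ipBr; ring.
by rewrite (le_trans (ler_normD _ _))// lerD ?cauchy_schwarz.
Qed.

Lemma ip_cvg (I : Type) (F : set_system I) {FF : Filter F} (f g : I -> V) x y :
  f @ F --> x -> g @ F --> y -> ip (f t) (g t) @[t --> F] --> ip x y.
Proof.
move=> fx gy.
apply: (@cvg_comp _ _ _ (fun t => (f t, g t)) (fun p => ip p.1 p.2) F (nbhs (x, y))).
  exact: cvg_pair.
exact: (continuous_ip (x, y)).
Qed.

End InnerProduct.

Section Riesz.
Context {R : realType} {V : completeNormedModType R} (ip : V -> V -> R).
Hypothesis ipP : is_inner_product ip.

(** The functional [Psi] is minimised: minimising sequences are Cauchy by the parallelogram
    identity, and the minimiser [l] represents [phi] because [Psi] cannot decrease along any line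
    through [l]. *)
Theorem riesz_representation (phi : V -> R) (C : R) :
  (forall a x y, phi (a *: x + y) = a * phi x + phi y) ->
  (forall x, `|phi x| <= C * `|x|) ->
  exists w, forall u, phi u = ip u w.
Proof.
move=> lphi bphi.
pose Psi (w : V) := `|w| ^+ 2 - 2 * phi w.
have Psib w : - C ^+ 2 <= Psi w.
  have := bphi w; rewrite ler_norml => /andP[_ hw].
  rewrite /Psi; have := sqr_ge0 (`|w| - C); nra.
pose m := inf (range Psi).
have hinf : has_inf (range Psi).
  split; first by exists (Psi 0), 0.
  by exists (- C ^+ 2) => _ [w _ <-].
have lem w : m <= Psi w by apply: ge_inf; [case: hinf|exists w].
have seqE n : exists w, Psi w < m + n.+1%:R^-1.
  have n0 : 0 < n.+1%:R^-1 :> R by rewrite invr_gt0.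
  by have [_ [w _ <-] hw] := inf_adherent n0 hinf; exists w.
have [w hw] := choice seqE.
have phi0 : phi 0 = 0 by have := lphi (-1) 0 0; rewrite scaler0 addr0 mulN1r addNr.
have phiZ a x : phi (a *: x) = a * phi x by rewrite -[_ *: _]addr0 lphi phi0 addr0.
(* The parallelogram identity, with [Psi] at the midpoint bounded below by [m]: two almost optimal
   points are close. *)
have par x y : `|x - y| ^+ 2 <= 2 * Psi x + 2 * Psi y - 4 * m.
  have := lem (2^-1 *: (x + y)).
  rewrite /Psi phiZ -[x + y](scale1r (x + y)) scale1r -[in phi _](scale1r x) lphi.
  rewrite normrZ exprMn ger0_norm; last lra.
  have := normDZ_sqr _ ipP 1 x y; have := normDZ_sqr _ ipP (-1) y x.
  rewrite !scale1r scaleN1r (addrC (- y)) (ipC _ ipP y x) => -> ->; lra.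
have cw : cvgn w.
  apply/cauchy_cvgP/cauchy_ballP => e e0; rewrite near_simpl.
  have [N _ hN] : \forall n \near \oo, n.+1%:R^-1 < e ^+ 2 / 4 :> R.
    have h4 : 0 < e ^+ 2 / 4 by rewrite divr_gt0 ?exprn_gt0.
    exact: (near_infty_natSinv_lt (PosNum h4)).
  exists ([set n | (N <= n)%N], [set n | (N <= n)%N]); first by split; exists N.
  move=> [i j] /= [Ni Nj].
  rewrite -ball_normE /ball_/=.
  rewrite -(ltr_pXn2r (n := 2)) ?nnegrE ?(ltW e0)//.
  have := par (w i) (w j); have := hN _ Ni; have := hN _ Nj => /=.
  by have := hw i; have := hw j; set a := _^-1; set b := _^-1; lra.
pose l := limn w.
have cphi : continuous phi.
  move=> x; apply/cvgrPdist_le => e e0.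
  have C1 : 0 < `|C| + 1 by rewrite ltr_wpDl.
  near=> y.
  have -> : phi x - phi y = phi (x - y).
    by rewrite [in RHS]addrC -(scaleN1r y) lphi mulN1r addrC.
  rewrite (le_trans (bphi _))// (@le_trans _ _ ((`|C| + 1) * `|x - y|))//.
    by rewrite ler_wpM2r// (le_trans (ler_norm _))// lerDl.
  rewrite -ler_pdivlMl//.
  near: y; apply: cvgr_dist_le => //; by rewrite mulr_gt0 ?invr_gt0.
have Psil : Psi l <= m.
  have h1 : Psi (w n) @[n --> \oo] --> Psi l.
    apply: cvgB.
      by rewrite expr2; under eq_fun do rewrite expr2; apply: cvgM; apply: cvg_norm.
    apply: cvgM; first exact: cvg_cst.
    by apply: (@cvg_comp _ _ _ w phi); [exact: cw|exact: cphi].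
  have h2 : (m + n.+1%:R^-1) @[n --> \oo] --> m.
    rewrite -[X in _ --> X]addr0; apply: cvgD; first exact: cvg_cst.
    exact: (@cvg_harmonic R).
  rewrite -(cvg_lim _ h1)// -(cvg_lim _ h2)//.
  apply: ler_lim; [by apply/cvg_ex; exists (Psi l)|by apply/cvg_ex; exists m|].
  by apply: nearW => n; exact/ltW/hw.
exists l => u.
have key a : 0 <= a ^+ 2 * `|u| ^+ 2 + 2 * a * (ip u l - phi u).
  have := le_trans Psil (lem (a *: u + l)).
  rewrite /Psi (normDZ_sqr _ ipP) lphi; lra.
apply/eqP; rewrite eq_sym -subr_eq0; apply/eqP.
set k := ip u l - phi u in key *.
(* A near-optimal step for the quadratic in [a]; the added 1 keeps the denominator positive when
   [u = 0]. *)
have := key (- k / (`|u| ^+ 2 + 1)).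
have u1 : 0 < `|u| ^+ 2 + 1 by rewrite ltr_wpDl// sqr_ge0.
set n := `|u| ^+ 2 in u1 *.
have n0 : 0 <= n by rewrite sqr_ge0.
have -> : (- k / (n + 1)) ^+ 2 * n + 2 * (- k / (n + 1)) * k =
  - (k ^+ 2 * (n + 2) / (n + 1) ^+ 2) by field; rewrite gt_eqF.
rewrite oppr_ge0 pmulr_lle0 ?invr_gt0 ?exprn_gt0// pmulr_lle0; last by lra.
by move=> h; apply/eqP; rewrite -sqrf_eq0 eq_le h sqr_ge0.
Unshelve. all: by end_near. Qed.

End Riesz.

(** * Affine substitutions and strongly continuous semigroups *)

Section AffineChange.
Context {R : realType}.
Notation mu := (@lebesgue_measure R).
Local Open Scope ereal_scope.

Lemma preimage_affine_ocitv (c d x y : R) : (0 < c)%R ->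
  (fun z : R => c * z + d)%R @^-1` `]x, y]%classic =
  `]((x - d) / c)%R, ((y - d) / c)%R]%classic.
Proof.
move=> c0; apply/seteqP; split => z /=; rewrite !in_itv/=.
  by move=> /andP[h1 h2]; rewrite ltr_pdivrMr// ler_pdivlMr// mulrC ltrBlDr lerBrDr h1.
by move=> /andP[]; rewrite ltr_pdivrMr// ler_pdivlMr// mulrC ltrBlDr lerBrDr => -> ->.
Qed.

Lemma measurable_affine (c d : R) :
  measurable_fun setT (fun z : R => c * z + d : measurableTypeR R)%R.
Proof. by apply: measurable_funD => //; apply: measurable_funM. Qed.

(** By uniqueness of Lebesgue measure, [mu] is [c] times its pushforward under the affine map, since
    both agree on the intervals []x, y]]. *)
Lemma ge0_integral_affine (c d : R) (f : R -> \bar R) (D : set R) :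
  (0 < c)%R -> measurable D -> measurable_fun D f -> (forall x, D x -> 0 <= f x) ->
  \int[mu]_(x in D) f x =
    c%:E * \int[mu]_(x in (fun z => c * z + d)%R @^-1` D) f (c * x + d)%R.
Proof.
move=> c0 mD mf f0.
pose g := fun z : R => (c * z + d)%R : measurableTypeR R.
have mg : measurable_fun setT g by exact: measurable_affine.
pose nu : {measure set (measurableTypeR R) -> \bar R} :=
  measure_function_pushforward__canonical__measure_function_Measure mu mg.
pose k : {nonneg R} := NngNum (ltW c0).
have muE A : measurable A -> mu A = mscale k nu A.
  apply: lebesgue_measure_unique => _ [[x y]] _ <-.
  rewrite [RHS](_ : _ = c%:E * mu ((fun z : R => c * z + d)%R @^-1` `]x, y]%classic))//.
  rewrite preimage_affine_ocitv// !lebesgue_measure_itv/=.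
  rewrite !lte_fin ltr_pM2r ?invr_gt0// ltrD2r; case: ifPn => _; last by rewrite mule0.
  by rewrite -!EFinD -EFinM; congr EFin; field; rewrite gt_eqF.
rewrite (eq_measure_integral (mscale k nu)); last by move=> A mA _; exact: muE.
rewrite ge0_integral_mscale//; congr (_ * _).
by rewrite ge0_integral_pushforward// => x /set_mem; exact: f0.
Qed.

Lemma integral_shift (d : R) (f : R -> \bar R) (D : set R) :
  measurable D -> measurable_fun D f ->
  \int[mu]_(x in D) f x =
    \int[mu]_(x in (fun z => z + d)%R @^-1` D) f (x + d)%R.
Proof.
move=> mD mf.
have e1 : (fun z => 1 * z + d)%R = (fun z : R => z + d)%R.
  by apply/funext => z; rewrite mul1r.
rewrite [LHS]integralE [RHS]integralE.
rewrite (@ge0_integral_affine 1 d _ D)//; last exact/measurable_funepos.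
rewrite (@ge0_integral_affine 1 d f^\- D)//; last exact/measurable_funeneg.
rewrite !mul1e e1; congr (_ - _); apply: eq_integral => x _.
  by rewrite !funeposE mul1r.
by rewrite !funenegE mul1r.
Qed.

End AffineChange.

Section ContinuousIntegral.
Context {R : realType}.
Notation mu := (@lebesgue_measure R).

Lemma continuous_integrable (f : R -> R) (a b : R) :
  continuous f -> mu.-integrable `[a, b] (EFin \o f).
Proof.
move=> cf; apply: continuous_compact_integrable; first exact: segment_compact.
exact: continuous_subspaceT.
Qed.

Lemma Rintegral_shift (f : R -> R) (d e : R) : continuous f -> 0 <= d -> 0 <= e ->
  \int[mu]_(q in `[0, e]) f (q + d) =
  \int[mu]_(q in `[0, e + d]) f q - \int[mu]_(q in `[0, d]) f q.
Proof.
move=> cf d0 e0.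
have -> : \int[mu]_(q in `[0, e]) f (q + d) = \int[mu]_(q in `[d, e + d]) f q.
  rewrite /Rintegral [in RHS](@integral_shift _ d)//=; last first.
    by apply/measurable_EFinP/measurable_funTS; exact: continuous_measurable_fun.
  congr fine; congr (integral _ _ _); apply/seteqP; split => z /=; rewrite !in_itv/=.
    by move=> /andP[? ?]; rewrite lerDr lerD2r; apply/andP.
  by rewrite lerDr lerD2r.
rewrite (@Rintegral_itvB _ f (BLeft 0) (BRight (e + d)))//.
- rewrite Rintegral_itv_obnd_cbnd//.
  apply: (@integrableS _ _ _ mu `[d, e + d]) => //; last exact: continuous_integrable.
  exact: subset_itv_oc_cc.
- exact: continuous_integrable.
- by rewrite bnd_simp lerDr.
Qed.

Lemma Rintegral_dist_le (f : R -> R) (c K e : R) : continuous f -> 0 <= e ->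
  (forall q, 0 <= q <= e -> `|f q - c| <= K) ->
  `|\int[mu]_(q in `[0, e]) f q - e * c| <= K * e.
Proof.
move=> cf e0 fK.
have mue : fine (mu `[0, e]) = e.
  rewrite lebesgue_measure_itv/= lte_fin; case: ltgtP e0 => //= _ _.
  by rewrite oppr0 addr0.
have cf' : continuous (fun q => f q - c).
  by move=> q; apply: cvgB; [exact: cf|exact: cvg_cst].
have -> : e * c = \int[mu]_(q in `[0, e]) c.
  by rewrite Rintegral_cst// mue mulrC.
have ci (k : R) : mu.-integrable `[0, e] (EFin \o (fun=> k)).
  by apply: continuous_integrable => q; exact: cvg_cst.
rewrite -RintegralB//; last exact: continuous_integrable.
apply: (le_trans (le_normr_Rintegral _ _)) => //; first exact: continuous_integrable.
rewrite -[X in _ <= _ * X]mue -Rintegral_cst//; apply: le_Rintegral => //.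
- apply: (@continuous_integrable (fun q => `|f q - c|)) => q.
  by apply: cvg_norm; exact: cf'.
Qed.

End ContinuousIntegral.

Section Semigroup.
Context {R : realType} {V : completeNormedModType R} (ip : V -> V -> R)
  (S : R -> V -> V).
Hypothesis ipP : is_inner_product ip.
Hypothesis SP : C0_semigroup S.
Notation mu := (@lebesgue_measure R).

Lemma sgroup_linear t : 0 <= t -> linear (S t).
Proof. by case: SP => h _ _ _ _ t0 a x y; exact: h. Qed.

Lemma sgroupB t x y : 0 <= t -> S t (x - y) = S t x - S t y.
Proof.
move=> t0; case: SP => h _ _ _ _.
by rewrite addrC -(scaleN1r y) h// scaleN1r addrC.
Qed.

Lemma sgroup0 x : S 0 x = x. Proof. by case: SP. Qed.

Lemma sgroupD s t x : 0 <= s -> 0 <= t -> S (s + t) x = S s (S t x).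
Proof. by case: SP => _ _ _ h _ s0 t0; exact: h. Qed.

Lemma sgroup_op_bounded t : 0 <= t -> exists2 r, 0 <= r & forall x, `|S t x| <= r * `|x|.
Proof.
move=> t0; case: SP => _ /(_ _ t0) ct _ _ _.
pose f : {linear V -> V} := HB.pack (S t) (GRing.isLinear.Build _ _ _ _ _ (sgroup_linear _ t0)).
have /linear_boundedP : bounded_near f (nbhs (0:V)) by apply: continuous_linear_bounded; exact: ct.
move=> h; near +oo_R => r; exists r => //.
by near: r.
Unshelve. all: by end_near. Qed.

Lemma sgroup_modulus x e : 0 < e ->
  exists2 dl, 0 < dl & forall h, 0 <= h <= dl -> `|S h x - x| <= e.
Proof.
case: SP => _ _ _ _ /(_ x)/cvgrPdist_le c e0.
have [d /= d0 hd] := c _ e0.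
exists (d / 2); first by rewrite divr_gt0.
move=> h /andP[h0 hd2]; have [->|hn0] := eqVneq h 0.
  by rewrite sgroup0 subrr normr0 ltW.
rewrite distrC; apply: hd; last by rewrite lt_neqAle eq_sym hn0.
by rewrite /= sub0r normrN ger0_norm// (le_lt_trans hd2)// ltr_pdivrMr// ltr_pMr// ltr1n.
Qed.

(** Near 0 the bound comes from Banach-Steinhaus: otherwise times [q_n <= 1/(n+1)] with operator
    norms exceeding [n] would form a pointwise bounded family. The semigroup law then carries it
    from [[0, dl]] to [[0, t]], with one factor [K] for each step of length [dl]. *)
Lemma sgroup_bounded t : exists2 M, 1 <= M &
  forall q x, 0 <= q <= t -> `|S q x| <= M * `|x|.
Proof.
have [dl dl0 [M0 hM0]] : exists2 dl, 0 < dl & exists M, forall q x, 0 <= q <= dl ->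
    `|S q x| <= M * `|x|.
  apply: contrapT => H.
  have seqE n : exists qx : R * V, 0 <= qx.1 <= n.+1%:R^-1 /\ n%:R * `|qx.2| < `|S qx.1 qx.2|.
    apply: contrapT => H'; apply: H; exists n.+1%:R^-1; first by rewrite invr_gt0.
    exists n%:R => q x qn; rewrite leNgt; apply/negP => h.
    by apply: H'; exists (q, x).
  have [qx hqx] := choice seqE.
  pose F := [set f : V -> V | exists n, f = S (qx n).1].
  have F1 f : F f -> bounded_fun_norm f /\ linear f.
    move=> [n ->]; have q0 : 0 <= (qx n).1 by case: (hqx n) => /andP[].
    split; last exact: sgroup_linear.
    have [r r0 hr] := sgroup_op_bounded _ q0.
    move=> k; exists (r * k) => x xk; apply: (le_trans (hr x)).
    by rewrite ler_wpM2l.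
  have F2 : pointwise_bounded F.
    move=> x; have [dl dl0 hdl] := sgroup_modulus x _ ltr01.
    have [N _ hN] := near_infty_natSinv_lt (PosNum dl0).
    exists (`|x| + 1 + \sum_(i < N) `|S (qx i).1 x|) => _ [n ->].
    have [nN|Nn] := ltnP n N.
      rewrite (bigD1 (Ordinal nN))//= addrCA lerDl addr_ge0//.
      exact: sumr_ge0.
    rewrite ler_wpDr//; first exact: sumr_ge0.
    have -> : S (qx n).1 x = x + (S (qx n).1 x - x) by rewrite addrC subrK.
    rewrite (le_trans (ler_normD _ _))// lerD2l.
    apply: hdl; case: (hqx n) => /andP[-> /= h] _; rewrite (le_trans h)//.
    exact/ltW/hN.
  have [M hM] := Banach_Steinhauss F1 F2 1.
  have M0 : 0 <= M.
    by rewrite (le_trans (normr_ge0 (S (qx 0%N).1 0)))// hM ?normr0//; exists 0%N.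
  have [n Mn] : exists n : nat, M < n%:R.
    by exists (Num.truncn M).+1; rewrite Num.Theory.truncnS_gt.
  have [_] := hqx n; rewrite ltNge => /negP; apply.
  set q := (qx n).1; set x := (qx n).2.
  have q0 : 0 <= q by case: (hqx n) => /andP[].
  have [->|x0] := eqVneq x 0.
    have [r r0 /(_ 0)] := sgroup_op_bounded _ q0.
    by rewrite normr0 !mulr0.
  have nx : 0 < `|x| by rewrite normr_gt0.
  have := hM (S q) (ex_intro _ n erefl) (`|x|^-1 *: x).
  rewrite normrZ normfV normr_id mulVf ?normr_eq0// => /(_ (lexx _)).
  have := sgroup_linear _ q0 (`|x|^-1) x 0; rewrite addr0 => ->.
  have -> : S q 0 = 0.
    by have := sgroupB q x x q0; rewrite !subrr.
  rewrite addr0 normrZ normfV normr_id ler_pdivrMl// mulrC => h.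
  by rewrite (le_trans h)// ler_wpM2r// ltW.
pose K := Num.max M0 1.
have K1 : 1 <= K by rewrite le_max lexx orbT.
have hK q x : 0 <= q <= dl -> `|S q x| <= K * `|x|.
  by move=> /hM0 h; rewrite (le_trans (h x))// ler_wpM2r// le_max lexx.
have hn n : forall q x, 0 <= q <= n%:R * dl -> `|S q x| <= K ^+ n.+1 * `|x|.
  elim: n => [|n IH] q x /andP[q0 qn].
    rewrite expr1; apply: hK; rewrite q0 (le_trans qn)// mul0r; exact: ltW.
  have [qd|dq] := leP q dl.
    have := hK q x; rewrite q0 qd => /(_ isT)/le_trans; apply.
    by rewrite ler_wpM2r// ler_eXnr.
  have -> : q = dl + (q - dl) by rewrite addrC subrK.
  rewrite sgroupD ?subr_ge0 ?(ltW dl0) ?(ltW dq)//.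
  apply: (le_trans (hK _ _ _)); first by rewrite lexx ltW.
  rewrite exprS -mulrA ler_wpM2l ?(le_trans _ K1)//.
  apply: IH; rewrite subr_ge0 (ltW dq) lerBlDr.
  by move: qn; rewrite -natr1 mulrDl mul1r.
have [n tn] : exists n : nat, t <= n%:R * dl.
  by exists (Num.truncn (t / dl)).+1; rewrite -ler_pdivrMr// ltW// Num.Theory.truncnS_gt.
exists (K ^+ n.+1); first by rewrite exprn_ege1.
by move=> q x /andP[q0 qt]; apply: hn; rewrite q0 (le_trans qt).
Qed.

(** The clamp [Num.max 0 q] extends the orbit to a continuous function on all of [R], hence
    integrable on segments when paired. Continuity from the left uses the local norm bound, through
    [S b x - S a x = S a (S (b - a) x - x)]. *)
Lemma sgroup_continuous x : continuous (fun q : R => S (Num.max 0 q) x).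
Proof.
move=> q0; apply/cvgrPdist_le => e e0.
have [M M1 hM] := sgroup_bounded (`|q0| + 1).
have M0 : 0 < M by rewrite (lt_le_trans ltr01).
have [dl dl0 hdl] := sgroup_modulus x (e / M) (divr_gt0 e0 M0).
have key a b : 0 <= a <= b -> b <= `|q0| + 1 -> b - a <= dl -> `|S b x - S a x| <= e.
  move=> /andP[a0 ab] bq bad.
  have -> : b = a + (b - a) by rewrite addrC subrK.
  rewrite sgroupD ?subr_ge0// -sgroupB// (le_trans (hM _ _ _))//.
    by rewrite a0 (le_trans ab).
  by rewrite -ler_pdivlMl// mulrC; apply: hdl; rewrite subr_ge0 ab bad.
near=> q.
have q1 : `|q0 - q| <= 1 by near: q; apply: cvgr_dist_le.
have qd : `|q0 - q| <= dl by near: q; apply: cvgr_dist_le.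
have mq (a : R) : a <= `|q0| + 1 -> Num.max 0 a <= `|q0| + 1.
  by move=> h; rewrite ge_max h addr_ge0.
have hq0 : q0 <= `|q0| + 1 by rewrite ler_wpDr// ler_norm.
have hq : q <= `|q0| + 1.
  rewrite -lerBlDl (le_trans _ q1)// distrC (le_trans _ (ler_norm _))// lerD2l lerN2.
  exact: ler_norm.
have md (a b : R) : a <= b -> Num.max 0 b - Num.max 0 a <= `|a - b|.
  move=> ab; rewrite distrC ger0_norm ?subr_ge0//.
  by have [] := leP 0 a; have [] := leP 0 b; lra.
have [qq|/ltW qq] := leP q q0.
  apply: key; [|exact: mq|].
    by rewrite le_max lexx/= ge_max !le_max lexx qq orbT.
  by rewrite (le_trans (md _ _ qq))// distrC.
rewrite distrC; apply: key; [|exact: mq|].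
  by rewrite le_max lexx/= ge_max !le_max lexx qq orbT.
by rewrite (le_trans (md _ _ qq)).
Unshelve. all: by end_near. Qed.

End Semigroup.

(** * The adjoint semigroup and a norming family in the domain of its generator *)

Section AdjointSemigroup.
Context {R : realType} {V : completeNormedModType R} (ip : V -> V -> R)
  (S : R -> V -> V).
Hypothesis ipP : is_inner_product ip.
Hypothesis SP : C0_semigroup S.
Notation mu := (@lebesgue_measure R).

(** The Hilbert adjoint of [S t]; Riesz provides it for [0 <= t], and the default 0 is taken only at
    times where no adjoint exists. *)
Definition adj_sgroup (t : R) (v : V) : V :=
  xget 0 [set w | forall u, ip (S t u) v = ip u w].

Lemma adj_sgroupE t u v : 0 <= t -> ip (S t u) v = ip u (adj_sgroup t v).
Proof.
move=> t0; have [r r0 hr] := sgroup_op_bounded _ SP _ t0.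
have [w hw] : exists w, forall x, ip (S t x) v = ip x w.
  apply: (riesz_representation _ ipP _ (r * `|v|)).
    by move=> a x y; rewrite (sgroup_linear _ SP)// (ipDZl _ ipP).
  move=> x; rewrite (le_trans (cauchy_schwarz _ ipP _ _))// mulrAC.
  by rewrite ler_wpM2r.
have := @xgetPex _ 0 [set w | forall u, ip (S t u) v = ip u w].
by apply; exists w.
Qed.

Lemma adj_sgroup_norm M t v : (forall x, `|S t x| <= M * `|x|) -> 0 <= M -> 0 <= t ->
  `|adj_sgroup t v| <= M * `|v|.
Proof.
move=> hM M0 t0; apply: (ip_le_norm _ ipP); first by rewrite mulr_ge0.
move=> u; rewrite -adj_sgroupE// (le_trans (ler_norm _))//.
rewrite (le_trans (cauchy_schwarz _ ipP _ _))// mulrAC.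
by rewrite ler_wpM2r.
Qed.

Lemma orbit_continuous u v : continuous (fun q : R => ip (S (Num.max 0 q) u) v).
Proof.
move=> q; apply: (ip_cvg _ ipP).
- exact: (sgroup_continuous _ SP).
- exact: cvg_cst.
Qed.

(* The pairs (v, w) with v in D(A^* ) and w = A^* v, in integrated form. *)
Definition adj_gen (v w : V) : Prop := forall u r, 0 <= r ->
  ip (S r u) v - ip u v = \int[mu]_(q in `[0, r]) ip (S (Num.max 0 q) u) w.

(** The integrated relation is applied to [S a u] over [[0, b - a]]. The constant [c] is free so
    that one estimate yields the Lipschitz bound ([c = 0]), the Taylor bound ([c] the pairing at an
    intermediate point) and the derivative at 0 ([c = ip u w]). *)
Lemma adj_gen_increment v w a b c K u : adj_gen v w -> 0 <= a -> a <= b ->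
  (forall q, a <= q <= b -> `|ip (S q u) w - c| <= K) ->
  `|ip u (adj_sgroup b v) - ip u (adj_sgroup a v) - (b - a) * c| <= K * (b - a).
Proof.
move=> vw a0 ab h; rewrite -!adj_sgroupE ?(le_trans a0)//.
have ba : 0 <= b - a by rewrite subr_ge0.
have -> : S b u = S (b - a) (S a u) by rewrite -(sgroupD _ SP) ?subrK.
rewrite vw//; apply: Rintegral_dist_le => //; first exact: orbit_continuous.
move=> q /andP[q0 qb]; rewrite max_r// -(sgroupD _ SP)//; apply: h.
by rewrite lerDr q0 -lerBrDr.
Qed.

Lemma adj_gen_lipschitz t M v w a b :
  (forall q x, 0 <= q <= t -> `|S q x| <= M * `|x|) -> 0 <= M ->
  adj_gen v w -> 0 <= a <= t -> 0 <= b <= t ->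
  `|adj_sgroup b v - adj_sgroup a v| <= M * `|w| * `|b - a|.
Proof.
move=> hM M0 vw; wlog ab : a b / a <= b.
  move=> H ta tb; have [ab|/ltW ab] := leP a b; first exact: H.
  by rewrite distrC (distrC b); exact: H.
move=> /andP[a0 at_] /andP[b0 bt].
rewrite (ger0_norm (_ : 0 <= b - a)) ?subr_ge0//.
apply: (ip_le_norm _ ipP); first by rewrite !mulr_ge0// subr_ge0.
move=> u; rewrite (ipBr _ ipP) (le_trans (ler_norm _))//.
have := @adj_gen_increment v w a b 0 (M * `|u| * `|w|) u vw a0 ab.
rewrite mulr0 subr0 => h.
have -> : M * `|w| * (b - a) * `|u| = M * `|u| * `|w| * (b - a) by ring.
apply: h => q /andP[aq qb].
rewrite subr0 (le_trans (cauchy_schwarz _ ipP _ _))// ler_wpM2r// hM//.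
by rewrite (le_trans a0)//= (le_trans qb).
Qed.

(** The orbit of [w] is the derivative of the orbit of [v] and is itself Lipschitz because of [w2],
    so freezing it at any [q] in [[a, b]] costs second order. The freedom in [q] permits shifted
    nodes. *)
Lemma adj_gen_taylor t M v w w2 a b q :
  (forall q x, 0 <= q <= t -> `|S q x| <= M * `|x|) -> 0 <= M ->
  adj_gen v w -> adj_gen w w2 -> 0 <= a -> a <= q <= b -> b <= t ->
  `|adj_sgroup b v - adj_sgroup a v - (b - a) *: adj_sgroup q w|
    <= M * `|w2| * (b - a) ^+ 2.
Proof.
move=> hM M0 vw ww2 a0 /andP[aq qb] bt.
have ab : a <= b := le_trans aq qb.
have ba : 0 <= b - a by rewrite subr_ge0.
apply: (ip_le_norm _ ipP); first by rewrite !mulr_ge0// exprn_ge0.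
move=> u; rewrite !(ipBr _ ipP) (ipZr _ ipP) (le_trans (ler_norm _))//.
have -> : M * `|w2| * (b - a) ^+ 2 * `|u| = M * `|w2| * (b - a) * `|u| * (b - a) by ring.
apply: (@adj_gen_increment v w a b) => // r /andP[ar rb].
have r0 : 0 <= r by rewrite (le_trans a0).
have q0 : 0 <= q by rewrite (le_trans a0).
rewrite adj_sgroupE// -(ipBr _ ipP) (le_trans (cauchy_schwarz _ ipP _ _))//.
rewrite mulrC ler_wpM2r//.
rewrite (le_trans (adj_gen_lipschitz t M w w2 q r hM M0 ww2 _ _)) ?q0 ?r0 ?(le_trans qb) ?(le_trans rb)//.
by rewrite ler_wpM2l ?mulr_ge0// ler_distl; apply/andP; split; lra.
Qed.

(** Connects the integrated relation with the encoding of the adjoint in [weak_solution]: both sides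
    are limits of the pairing of [v] with the difference quotient of [S] at [u]. *)
Lemma adj_gen_adjoint (DA : set V) (A : V -> V) v w : generates DA A S ->
  adj_gen v w -> forall u, DA u -> ip (A u) v = ip u w.
Proof.
move=> [_ gA] vw u /gA cA.
have c1 : ip (h^-1 *: (S h u - u)) v @[h --> 0^'+] --> ip (A u) v.
  apply: (ip_cvg _ ipP).
  - exact: cA.
  - exact: cvg_cst.
have c2 : ip (h^-1 *: (S h u - u)) v @[h --> 0^'+] --> ip u w.
  apply/cvgrPdist_le => e e0.
  have w1 : 0 < `|w| + 1 by rewrite ltr_wpDl.
  have [dl dl0 hdl] := sgroup_modulus _ SP u (e / (`|w| + 1)) (divr_gt0 e0 w1).
  near=> h.
  have h0 : 0 < h by near: h; exact: nbhs_right_gt.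
  have hd : h <= dl by near: h; exact: nbhs_right_le.
  have := @adj_gen_increment v w 0 h (ip u w) e u vw (lexx _) (ltW h0).
  rewrite -!adj_sgroupE// ?(ltW h0)// (sgroup0 _ SP) subr0 => H.
  rewrite (ipZl _ ipP) (ipBl _ ipP) distrC.
  have -> : h^-1 * (ip (S h u) v - ip u v) - ip u w =
    h^-1 * (ip (S h u) v - ip u v - h * ip u w) by field; rewrite gt_eqF.
  rewrite normrM gtr0_norm ?invr_gt0// ler_pdivrMl// [h * e]mulrC; apply: H.
  move=> q /andP[q0 qh]; rewrite -(ipBl _ ipP) (le_trans (cauchy_schwarz _ ipP _ _))//.
  rewrite (@le_trans _ _ (e / (`|w| + 1) * `|w|))//.
    by rewrite ler_wpM2r// hdl// q0 (le_trans qh).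
  by rewrite mulrAC ler_pdivrMr// ler_wpM2l// ?(ltW e0)// lerDl.
by rewrite -(cvg_lim _ c1)// (cvg_lim _ c2).
Unshelve. all: by end_near. Qed.

Lemma adj_gen_adj_sgroup t v w : 0 <= t ->
  adj_gen v w -> adj_gen (adj_sgroup t v) (adj_sgroup t w).
Proof.
move=> t0 vw u r r0.
have comm q : 0 <= q -> S t (S q u) = S q (S t u).
  by move=> q0; rewrite -(sgroupD _ SP t q)// (addrC t) (sgroupD _ SP).
rewrite -!adj_sgroupE// comm// vw//.
by apply: eq_Rintegral => q _; rewrite -adj_sgroupE// comm// le_max lexx.
Qed.

Lemma adj_genZ k v w : adj_gen v w -> adj_gen (k *: v) (k *: w).
Proof.
move=> vw u r r0; rewrite !(ipZr _ ipP) -mulrBr vw//.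
rewrite -RintegralZl//; last by apply: continuous_integrable; exact: orbit_continuous.
by apply: eq_Rintegral => q _; rewrite (ipZr _ ipP).
Qed.

Lemma adj_genB v w v' w' : adj_gen v w -> adj_gen v' w' -> adj_gen (v - v') (w - w').
Proof.
move=> vw vw' u r r0; rewrite !(ipBr _ ipP).
have -> : ip (S r u) v - ip (S r u) v' - (ip u v - ip u v') =
  (ip (S r u) v - ip u v) - (ip (S r u) v' - ip u v') by ring.
rewrite vw// vw'// -RintegralB//; last 2 first.
- by apply: continuous_integrable; exact: orbit_continuous.
- by apply: continuous_integrable; exact: orbit_continuous.
by apply: eq_Rintegral => q _; rewrite (ipBr _ ipP).
Qed.

(* The Riesz representative of e^-1 \int_0^e S*(q) v dq, which replaces a Bochner integral. *)
Definition orbit_mean (e : R) (v : V) : V := xget 0 [set w | forall u,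
  ip u w = e^-1 * \int[mu]_(q in `[0, e]) ip (S (Num.max 0 q) u) v].

Lemma orbit_meanE e v u : 0 < e ->
  ip u (orbit_mean e v) = e^-1 * \int[mu]_(q in `[0, e]) ip (S (Num.max 0 q) u) v.
Proof.
move=> e0; have [M M1 hM] := sgroup_bounded _ SP e.
have max0 q : 0 <= Num.max 0 q :> R by rewrite le_max lexx.
have [w hw] : exists w, forall u,
    e^-1 * \int[mu]_(q in `[0, e]) ip (S (Num.max 0 q) u) v = ip u w.
  apply: (riesz_representation _ ipP _ (M * `|v|)).
    move=> a x y; rewrite mulrCA -mulrDr; congr (_ * _).
    rewrite -RintegralZl//; last by apply: continuous_integrable; exact: orbit_continuous.
    rewrite -RintegralD//; last 2 first.
    - apply: continuous_integrable => q; apply: cvgM; first exact: cvg_cst.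
      exact: orbit_continuous.
    - by apply: continuous_integrable; exact: orbit_continuous.
    by apply: eq_Rintegral => q _; rewrite (sgroup_linear _ SP)// (ipDZl _ ipP).
  move=> x; rewrite normrM gtr0_norm ?invr_gt0// ler_pdivrMl// mulrC.
  have := @Rintegral_dist_le _ (fun q => ip (S (Num.max 0 q) x) v) 0 (M * `|v| * `|x|) e.
  rewrite mulr0 subr0; apply; [exact: orbit_continuous|exact: ltW|].
  move=> q /andP[q0 qe]; rewrite subr0 (le_trans (cauchy_schwarz _ ipP _ _))// mulrAC.
  by rewrite ler_wpM2r// max_r// hM// q0.
have := @xgetPex _ 0 [set w | forall u, ip u w =
  e^-1 * \int[mu]_(q in `[0, e]) ip (S (Num.max 0 q) u) v].
by apply; exists w => x; rewrite hw.
Qed.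

(** Writing F(t) for the integral of the scalar orbit over [[0, t]], both sides equal [e^-1] times
    F(e+r) - F(e) - F(r), which is symmetric in [e] and [r]. *)
Lemma adj_gen_orbit_mean e v : 0 < e ->
  adj_gen (orbit_mean e v) (e^-1 *: (adj_sgroup e v - v)).
Proof.
move=> e0 u r r0; rewrite !orbit_meanE// -mulrBr.
pose f q := ip (S (Num.max 0 q) u) v.
have cf : continuous f by exact: orbit_continuous.
have shiftE (d e' : R) : 0 <= d -> \int[mu]_(q in `[0, e']) ip (S (Num.max 0 q) (S d u)) v =
    \int[mu]_(q in `[0, e']) f (q + d).
  move=> d0; apply: eq_Rintegral => q; rewrite inE/= in_itv/= => /andP[q0 _].
  by rewrite /f -(sgroupD _ SP) ?le_max ?lexx// !max_r// addr_ge0.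
rewrite shiftE// Rintegral_shift// ?(ltW e0)//.
have -> : \int[mu]_(q in `[0, r]) ip (S (Num.max 0 q) u) (e^-1 *: (adj_sgroup e v - v)) =
    e^-1 * (\int[mu]_(q in `[0, r]) f (q + e) - \int[mu]_(q in `[0, r]) f q).
  rewrite -RintegralB//; last 2 first.
  - apply: continuous_integrable => q.
    by apply: continuous_comp; [apply: cvgD; [exact: cvg_id|exact: cvg_cst]|exact: cf].
  - exact: continuous_integrable.
  rewrite -RintegralZl//; last first.
    apply: (@continuous_integrable _ (fun q => f (q + e) - f q)) => q.
    apply: cvgB; last exact: cf.
    by apply: continuous_comp; [apply: cvgD; [exact: cvg_id|exact: cvg_cst]|exact: cf].
  apply: eq_Rintegral => q; rewrite inE/= in_itv/= => /andP[q0 _].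
  rewrite (ipZr _ ipP) (ipBr _ ipP) -adj_sgroupE ?(ltW e0)// -(sgroupD _ SP) ?(ltW e0)//; last first.
    by rewrite le_max lexx.
  rewrite /f addrC [in RHS]addrC max_r// [Num.max 0 (q + e)]max_r ?addr_ge0 ?(ltW e0)//.
  by rewrite (addrC q).
rewrite (Rintegral_shift f e r)// ?(ltW e0)// (addrC r); congr (_ * _).
by rewrite -!addrA; congr (_ + _); rewrite addrC.
Qed.

Lemma orbit_mean_norm M e v : (forall q x, 0 <= q <= e -> `|S q x| <= M * `|x|) -> 0 <= M ->
  0 < e -> `|orbit_mean e v| <= M * `|v|.
Proof.
move=> hM M0 e0; apply: (ip_le_norm _ ipP); first by rewrite mulr_ge0.
move=> u; rewrite orbit_meanE// ler_pdivrMl// mulrC (le_trans (ler_norm _))//.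
have := @Rintegral_dist_le _ (fun q => ip (S (Num.max 0 q) u) v) 0 (M * `|v| * `|u|) e.
rewrite mulr0 subr0; apply; [exact: orbit_continuous|exact: ltW|].
move=> q /andP[q0 qe]; rewrite subr0 (le_trans (cauchy_schwarz _ ipP _ _))// mulrAC.
by rewrite ler_wpM2r// max_r// hM// q0.
Qed.

(** The error involves the modulus of continuity of [S] at [u], not of the adjoint at [v], hence is
    uniform over [v] of bounded norm; iterated means can thus be compared against one fixed
    vector. *)
Lemma orbit_mean_approx e eta u v : 0 < e ->
  (forall q, 0 <= q <= e -> `|S q u - u| <= eta) ->
  `|ip u (orbit_mean e v) - ip u v| <= eta * `|v|.
Proof.
move=> e0 h; rewrite orbit_meanE//.
have := @Rintegral_dist_le _ (fun q => ip (S (Num.max 0 q) u) v) (ip u v) (eta * `|v|) e.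
move=> /(_ (orbit_continuous _ _) (ltW e0)) H.
rewrite -(ler_pM2r e0) -[X in _ * X](gtr0_norm e0) -normrM mulrC mulrBr mulrA.
rewrite mulfV ?gt_eqF// mul1r; apply: H => q /andP[q0 qe].
rewrite max_r// -(ipBl _ ipP) (le_trans (cauchy_schwarz _ ipP _ _))//.
by rewrite ler_wpM2r// h// q0.
Qed.

(** Three levels are used: [w1] is tested at the nodes, [w2] is the drift this creates, and [w3]
    controls the second-order remainder for the orbit of [w1]. *)
Definition adj_gen3 (v w1 w2 w3 : V) := [/\ adj_gen v w1, adj_gen w1 w2 & adj_gen w2 w3].

(** Each mean gains one application of the generator, and the quotient [T] maps generator pairs to
    generator pairs because the adjoint semigroup does. *)
Lemma adj_gen3_orbit_mean e v : 0 < e ->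
  exists w1 w2 w3, adj_gen3 (orbit_mean e (orbit_mean e (orbit_mean e v))) w1 w2 w3.
Proof.
move=> e0; pose T v := e^-1 *: (adj_sgroup e v - v).
have TP x y : adj_gen x y -> adj_gen (T x) (T y).
  move=> xy; apply: adj_genZ; apply: adj_genB => //.
  by apply: adj_gen_adj_sgroup => //; exact: ltW.
exists (T (orbit_mean e (orbit_mean e v))), (T (T (orbit_mean e v))), (T (T (T v))); split.
- exact: adj_gen_orbit_mean.
- by apply: TP; exact: adj_gen_orbit_mean.
- by apply/TP/TP; exact: adj_gen_orbit_mean.
Qed.

(** The vectors are the points of [D], divided by their norms and averaged three times over windows
    of length [1/(k+1)], for all [k]. The three means cost the factor [M ^+ 3]. Weak closeness of
    the means is enough, since for a given [z] only the pairing with [z] has to stay above [e]. *)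
Theorem norming_family (D : set V) : countable D -> dense D ->
  exists (v : nat -> V) (C : R), [/\ 0 < C,
    (forall n, exists w1 w2 w3, adj_gen3 (v n) w1 w2 w3),
    (forall n z, `|ip z (v n)| <= C * `|z|) &
    (forall z e, 0 <= e -> e < `|z| -> exists n, e < ip z (v n))].
Proof.
move=> /countable_injP[f finj] dD.
have [M M1 hM] := sgroup_bounded _ SP 1.
have M0 : 0 < M by rewrite (lt_le_trans ltr01).
pose d i := xget 0 [set x | D x /\ f x = i].
have dE x : D x -> d (f x) = x.
  move=> Dx; have := @xgetPex _ 0 [set y | D y /\ f y = f x] (ex_intro _ x (conj Dx erefl)).
  by move=> [Dy fy]; apply: finj; rewrite ?inE.
pose sm k x := orbit_mean k.+1%:R^-1 x.
have k0 k : 0 < k.+1%:R^-1 :> R by rewrite invr_gt0.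
have k1 (k : nat) : k.+1%:R^-1 <= 1 :> R by rewrite invf_le1// ler1n.
have smN k x : `|sm k x| <= M * `|x|.
  apply: orbit_mean_norm => //; last exact: ltW.
  by move=> q y /andP[q0 qk]; apply: hM; rewrite q0 (le_trans qk).
pose g (p : nat * nat) := `|d p.1|^-1 *: sm p.2 (sm p.2 (sm p.2 (d p.1))).
pose v n := g (odflt (0%N, 0%N) (unpickle n)).
exists v, (M ^+ 3); split.
- by rewrite exprn_gt0.
- move=> n; rewrite /v; set p := odflt _ _.
  have [w1 [w2 [w3 [h1 h2 h3]]]] := adj_gen3_orbit_mean _ (d p.1) (k0 p.2).
  exists (`|d p.1|^-1 *: w1), (`|d p.1|^-1 *: w2), (`|d p.1|^-1 *: w3).
  by split; exact: adj_genZ.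
- move=> n z; rewrite /v; set p := odflt _ _; rewrite /g.
  rewrite (le_trans (cauchy_schwarz _ ipP _ _))// mulrC ler_wpM2r//.
  rewrite normrZ normfV normr_id.
  have [->|dp0] := eqVneq (d p.1) 0.
    by rewrite normr0 invr0 mul0r exprn_ge0// ltW.
  rewrite ler_pdivrMl ?normr_gt0//.
  have -> : `|d p.1| * M ^+ 3 = M * (M * (M * `|d p.1|)) by ring.
  rewrite (le_trans (smN _ _))// ler_pM2l// (le_trans (smN _ _))// ler_pM2l//.
- move=> z e e0 ez.
  (* The homogeneous condition lets a point of [D] be found before normalising; [z] itself lies in
     [O]. *)
  pose O := [set x : V | 0 < ip z x - e * `|x|].
  have oO : open O.
    rewrite (_ : O = (fun x => ip z x - e * `|x|) @^-1` [set y | 0 < y])//.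
    apply: open_comp; last exact: open_gt.
    move=> x _; apply: cvgB; last by apply: cvgM; [exact: cvg_cst|exact: cvg_norm].
    apply: (ip_cvg _ ipP).
    - exact: cvg_cst.
    - exact: cvg_id.
  have z0 : 0 < `|z| by exact: le_lt_trans ez.
  have Oz : O z by rewrite /O/= (ipxx _ ipP) subr_gt0 expr2 ltr_pM2r.
  have [x [Ox Dx]] := dD O (ex_intro _ z Oz) oO.
  have nx : 0 < `|x|.
    rewrite normr_gt0; apply/negP => /eqP x0; move: Ox.
    by rewrite /O/= x0 (ip0r _ ipP) normr0 mulr0 subrr ltxx.
  (* The three averaging errors add up to at most [eta] times (M^2 + M + 1)|x|; the extra 1 in [K]
     leaves a margin [eta], which gives the strict inequality. *)
  pose K := (M ^+ 2 + M + 1) * `|x| + 1.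
  have K0 : 0 < K by rewrite ltr_wpDl// mulr_ge0// !addr_ge0 ?exprn_ge0// ltW.
  pose eta := (ip z x - e * `|x|) / K.
  have eta0 : 0 < eta by rewrite divr_gt0.
  have [dl dl0 hdl] := sgroup_modulus _ SP z _ eta0.
  have [k _ hk] := near_infty_natSinv_lt (PosNum dl0).
  have {}hk : k.+1%:R^-1 < dl by exact: (hk k (leqnn k)).
  have ap y : `|ip z (sm k y) - ip z y| <= eta * `|y|.
    apply: orbit_mean_approx => // q /andP[q0 qk]; apply: hdl.
    by rewrite q0 (le_trans qk)// ltW.
  exists (pickle (f x, k)); rewrite /v pickleK /= /g/= dE//.
  rewrite (ipZr _ ipP) mulrC ltr_pdivlMr//.
  have h1 := ap x; have h2 := ap (sm k x); have h3 := ap (sm k (sm k x)).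
  have n1 : `|sm k x| <= M * `|x| := smN k x.
  have n2 : `|sm k (sm k x)| <= M ^+ 2 * `|x|.
    by rewrite (le_trans (smN _ _))// expr2 -mulrA ler_pM2l.
  have e2 : eta * `|sm k x| <= eta * (M * `|x|) by rewrite ler_pM2l.
  have e3 : eta * `|sm k (sm k x)| <= eta * (M ^+ 2 * `|x|) by rewrite ler_pM2l.
  have etaK : eta * (M ^+ 2 * `|x|) + eta * (M * `|x|) + eta * `|x| + eta =
      ip z x - e * `|x|.
    rewrite -[RHS](@divfK _ K) ?gt_eqF// -/eta /K; ring.
  move: h1 h2 h3; rewrite !ler_distl => /andP[h1 _] /andP[h2 _] /andP[h3 _].
  clear -eta0 e2 e3 etaK h1 h2 h3; clearbody eta sm; clear -eta0 e2 e3 etaK h1 h2 h3.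
  move: e2 e3 etaK h1 h2 h3.
  move: (eta * `|sm k x|) (eta * `|sm k (sm k x)|) (eta * (M * `|x|))
    (eta * (M ^+ 2 * `|x|)) (eta * `|x|) (e * `|x|) => a1 a2 a3 a4 a5 a6.
  move: (ip z (sm k (sm k (sm k x)))) (ip z (sm k (sm k x))) (ip z (sm k x)) (ip z x).
  by move=> b1 b2 b3 b4; lra.
Qed.

End AdjointSemigroup.

(** * Riemann sums over shifted grids and translations of measurable paths *)

Section MeasureConvergence.
Context {d : measure_display} {T : measurableType d} {R : realType}.
Local Open Scope ereal_scope.

(** Dominated convergence for the indicators of [A n], the constant 1 being integrable on [D]. *)
Lemma measure_setI_cvg0 (mu : {measure set T -> \bar R}) (D : set T) (A : nat -> set T) :
  measurable D -> mu D < +oo -> (forall n, measurable (A n)) ->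
  {ae mu, forall x, D x -> \forall n \near \oo, ~ A n x} ->
  mu (D `&` A n) @[n --> \oo] --> 0.
Proof.
move=> mD Dfin mA h.
have cst_int : mu.-integrable D (cst 1).
  apply/integrableP; split => //.
  by under eq_integral do rewrite /= normr1; rewrite integral_cst// mul1e.
have [_ _] : [/\ mu.-integrable D (cst 0),
    [sequence \int[mu]_(x in D) `|(\1_(A n) x)%:E - cst 0 x|]_n @ \oo --> 0 &
    [sequence \int[mu]_(x in D) (\1_(A n) x)%:E]_n @ \oo --> \int[mu]_(x in D) (cst 0 x)].
  apply: (@dominated_convergence _ _ _ mu D mD (fun n x => (\1_(A n) x)%:E) (cst 0) (cst 1)) => //.
  - by move=> n; apply/measurable_EFinP; exact: measurable_indic.
  - apply: filterS h => x h Dx; apply: cvg_near_cst.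
    by have := h Dx; apply: filterS => n nA; rewrite indicE memNset.
  - apply: aeW => x n Dx; rewrite indicE; rewrite abse_EFin lee_fin.
    by case: (_ \in _); rewrite ?normr1 ?normr0.
rewrite integral0; apply: cvg_trans; apply: near_eq_cvg.
by apply: nearW => n /=; rewrite integral_indic// setIC.
Qed.

End MeasureConvergence.

Section RealLine.
Context {R : realType}.
Notation mu := (@lebesgue_measure R).

Lemma unif_continuous_segment (g : R -> R) (h e : R) : continuous g -> 0 < e ->
  exists2 dl, 0 < dl & forall x y, 0 <= x <= h -> `|x - y| <= dl -> `|g x - g y| <= e.
Proof.
move=> cg e0.
pose P (dl x : R) := forall y, `|x - y| <= dl -> `|g x - g y| <= e.
have [|dl /= dl0 hdl] := (compact_near_coveringP `[0, h]).1 (@segment_compact _ 0 h) R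
    (at_right 0) P _ _.
  move=> x _.
  have e2 : 0 < e / 2 by rewrite divr_gt0.
  have /cvgrPdist_le/(_ _ e2)[r /= r0 hr] := cg x.
  exists (ball x (r / 2), [set dl | dl < r / 2]); first split => /=.
  - by apply/nbhs_ballP; exists (r / 2) => //=; rewrite divr_gt0.
  - by apply: nbhs_right_lt; rewrite divr_gt0.
  move=> [x' dl] /= [xx' dlr] y x'y.
  have h1 : `|g x - g x'| <= e / 2.
    by apply: hr => /=; rewrite (lt_trans xx')// ltr_pdivrMr// ltr_pMr// ltr1n.
  have h2 : `|g x - g y| <= e / 2.
    apply: hr => /=; rewrite (le_lt_trans (ler_distD x' _ _))// [ltRHS](splitr r).
    by rewrite ltrD// (le_lt_trans x'y).
  by rewrite (le_trans (ler_distD (g x) _ _))// [leRHS](splitr e) lerD// distrC.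
exists (dl / 2); first by rewrite divr_gt0.
have hh := hdl (dl / 2).
move=> x y xh; apply: hh => //=; last by rewrite divr_gt0.
by rewrite sub0r normrN gtr0_norm ?divr_gt0// ltr_pdivrMr// ltr_pMr// ltr1n.
Qed.

Lemma L1_continuous_approx (D : set R) (f : R -> R) (e : R) : measurable D ->
  (mu D < +oo)%E -> mu.-integrable D (EFin \o f) -> 0 < e ->
  exists2 g : R -> R, continuous g &
    (\int[mu]_(z in D) `|(f z - g z)%:E| <= e%:E)%E.
Proof.
move=> mD Dfin intf e0.
have [g [cg ig]] := approximation_continuous_integrable mD Dfin intf.
move=> /fine_cvgP[fg /cvgr0_norm_le/(_ _ e0)] hn.
near \oo => n.
have fn : (\int[mu]_(z in D) `|(f z - g n z)%:E|)%E \is a fin_num by near: n.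
have le : `|fine (\int[mu]_(z in D) `|(f z - g n z)%:E|)%E| <= e by near: n.
exists (g n); first exact: cg.
by rewrite -[leLHS]fineK// lee_fin (le_trans (ler_norm _)).
Unshelve. all: by end_near. Qed.

Lemma lebesgue_measure_shift (d : R) (A : set R) : measurable A ->
  mu ((fun z => z + d) @^-1` A) = mu A.
Proof.
move=> mA; have e1 : (fun z => 1 * z + d) = (fun z : R => z + d).
  by apply/funext => z; rewrite mul1r.
have := @ge0_integral_affine R 1 d (cst 1%E) A ltr01 mA (measurable_cst _) (fun _ _ => lee01).
rewrite mul1e e1 !integral_cst ?mul1e//.
by rewrite -[X in measurable X]setTI -e1; exact: measurable_affine.
Qed.

Lemma Riemann_sum_continuous (g : R -> R) (dl e theta : R) (k : nat) : continuous g ->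
  0 <= dl -> 0 <= theta <= 1 ->
  (forall x y, 0 <= x <= k%:R * dl -> `|x - y| <= dl -> `|g x - g y| <= e) ->
  `|\int[mu]_(q in `[0, k%:R * dl]) g q - dl * \sum_(j < k) g (dl * (j%:R + theta))|
    <= e * (k%:R * dl).
Proof.
move=> cg dl0 /andP[th0 th1]; elim: k => [|k IH] h.
  by rewrite mul0r set_itv1 Rintegral_set1 big_ord0 !mulr0 subrr normr0.
have kd : 0 <= k%:R * dl by rewrite mulr_ge0.
have kE : k.+1%:R * dl = dl + k%:R * dl by rewrite -natr1 mulrDl mul1r addrC.
have := Rintegral_shift g (k%:R * dl) dl cg kd dl0.
move/eqP; rewrite -subr_eq opprK => /eqP; rewrite -kE => <-.
rewrite big_ord_recr/= mulrDr.
set I := \int[mu]_(x in _) _; set J := \int[mu]_(x in _) _.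
set s := dl * _; set t := dl * _.
have -> : I + J - (s + t) = (J - s) + (I - t) by ring.
rewrite (le_trans (ler_normD _ _))// kE mulrDr [leRHS]addrC lerD//.
  by apply: IH => x y /andP[x0 xk]; apply: h; rewrite x0 (le_trans xk)// kE lerDr.
apply: Rintegral_dist_le => //.
  by move=> q; apply: continuous_comp; [apply: cvgD; [exact: cvg_id|exact: cvg_cst]|exact: cg].
move=> q /andP[q0 qd]; apply: h.
  by rewrite addr_ge0//= kE lerD2r.
have -> : q + k%:R * dl - dl * (k%:R + theta) = q - dl * theta by ring.
have t1 : dl * theta <= dl by rewrite ler_piMr.
have t0 : 0 <= dl * theta by rewrite mulr_ge0.
by rewrite ler_norml; apply/andP; split; lra.
Qed.

(** The map sending theta to dl (j + theta) carries [[0, 1[] onto cell [j], so averaging a Riemann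
    sum over its shift reproduces the integral exactly, however irregular the measurable [phi]
    is. *)
Lemma ge0_integral_shifted_sum (phi : R -> \bar R) (dl : R) (k : nat) : 0 < dl ->
  measurable_fun setT phi -> (forall x, 0 <= phi x)%E ->
  (\int[mu]_(theta in `[0%R, 1%R[) (\sum_(j < k) (dl%:E * phi (dl * (j%:R + theta))%R))%E =
   \int[mu]_(x in `[0%R, (k%:R * dl)%R[) phi x)%E.
Proof.
move=> dl0 mphi phi0.
have mshift (j : nat) : measurable_fun setT (fun theta : R => phi (dl * (j%:R + theta))%R).
  apply: (measurableT_comp mphi); apply: measurable_funM => //.
  by apply: measurable_funD.
elim: k => [|k IH].
  rewrite mul0r set_itvco0 integral_set0.
  by under eq_integral do rewrite big_ord0; rewrite integral0.
under eq_integral do rewrite big_ord_recr/=.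
rewrite ge0_integralD//=; last 4 first.
- by move=> x _; apply: sume_ge0 => j _; rewrite mule_ge0// lee_fin ltW.
- by apply: measurable_funTS; apply: emeasurable_sum => j; apply: measurable_funeM; exact: mshift.
- by move=> x _; rewrite mule_ge0// lee_fin ltW.
- by apply: measurable_funTS; apply: measurable_funeM; exact: mshift.
rewrite IH ge0_integralZl//; last 2 first.
- by apply: measurable_funTS; exact: mshift.
- by rewrite lee_fin ltW.
have kd : (0 <= k%:R * dl)%R by rewrite mulr_ge0// ltW.
have kd1 : (k%:R * dl <= k.+1%:R * dl)%R by rewrite ler_pM2r// ler_nat.
have -> : `[0%R, (k.+1%:R * dl)%R[%classic =
    `[0%R, (k%:R * dl)%R[%classic `|` `[(k%:R * dl)%R, (k.+1%:R * dl)%R[%classic :> set R.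
  by rewrite -itv_bndbnd_setU ?bnd_simp.
rewrite ge0_integral_setU//=; last 2 first.
- exact: measurable_funTS.
- apply/disj_setPS => x /= [].
  by rewrite !in_itv/= => /andP[_ h1] /andP[h2 _]; have := le_lt_trans h2 h1; rewrite ltxx.
congr (_ + _)%E; rewrite [RHS](@ge0_integral_affine _ dl (dl * k%:R))//; last exact: measurable_funTS.
congr (_ * _)%E.
have -> : (fun z : R => dl * z + dl * k%:R) @^-1` `[(k%:R * dl), (k.+1%:R * dl)[ = `[0, 1[%classic.
  apply/seteqP; split => z /=; rewrite !in_itv/= -natr1 -mulrDr [(k%:R * dl)%R]mulrC.
    by rewrite [((k%:R + 1) * dl)%R]mulrC ler_pM2l// ltr_pM2l// lerDr addrC ltrD2l.
  by rewrite [((k%:R + 1) * dl)%R]mulrC ler_pM2l// ltr_pM2l// lerDr addrC ltrD2l.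
by apply: eq_integral => z _; rewrite -mulrDr (addrC z).
Qed.

End RealLine.

Lemma cvge0_le {R : realType} {I : Type} (F : set_system I) {FF : Filter F}
  (u : I -> \bar R) : (forall t, 0 <= u t)%E ->
  (forall c : R, 0 < c -> \forall t \near F, (u t <= c%:E)%E) -> u t @[t --> F] --> 0%E.
Proof.
move=> u0 h; apply/fine_cvgP; split.
  apply: filterS (h 1 ltr01) => t ut; rewrite ge0_fin_numE//.
  exact: le_lt_trans ut (ltry _).
apply/cvgr0Pnorm_le => e e0; apply: filterS (h e e0) => t ut.
rewrite ger0_norm ?fine_ge0//= -lee_fin fineK//.
by rewrite ge0_fin_numE//; exact: le_lt_trans ut (ltry _).
Qed.

Lemma cvge0_near_le {R : realType} {I : Type} (F : set_system I) {FF : Filter F}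
  (u : I -> \bar R) : (forall t, 0 <= u t)%E -> u t @[t --> F] --> 0%E ->
  forall c : R, 0 < c -> \forall t \near F, (u t <= c%:E)%E.
Proof.
move=> u0 /fine_cvgP[ufin /cvgr0Pnorm_le h] c c0.
apply: filterS2 ufin (h c c0) => t ut /=.
by rewrite ger0_norm ?fine_ge0// -lee_fin fineK.
Qed.

Section RiemannSums.
Context {R : realType}.
Notation mu := (@lebesgue_measure R).

Definition Riemann_sum (f : R -> R) (h : R) (n : nat) (theta : R) : R :=
  h / n.+1%:R * \sum_(j < n.+1) f (h / n.+1%:R * (j%:R + theta)).

Lemma measurable_grid (c a : R) : measurable_fun setT (fun theta : R => c * (a + theta)).
Proof. by apply: measurable_funM => //; exact: measurable_funD. Qed.

Lemma measurable_Riemann_sum (f : R -> R) h n : measurable_fun setT f ->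
  measurable_fun setT (Riemann_sum f h n).
Proof.
move=> mf; apply: measurable_funM => //; apply: measurable_sum => j.
by apply: (measurableT_comp mf); exact: measurable_grid.
Qed.

(** For a fixed shift the sums of a merely integrable function may fail to converge. A continuous
    [g] close to [f] in L^1 has sums converging uniformly in the shift, and averaging over the shift
    turns the sums of |f - g| into an L^1 distance; Markov's inequality concludes. *)
Lemma Riemann_sum_cvg (f : R -> R) (h e : R) : measurable_fun setT f -> 0 < h -> 0 < e ->
  mu.-integrable `[0, h] (EFin \o f) ->
  mu (`[0, 1[ `&` [set theta |
      e < `|\int[mu]_(x in `[0, h]) f x - Riemann_sum f h n theta|]) @[n --> \oo] --> 0%E.
Proof.
move=> mf h0 e0 intf; apply: cvge0_le => // c c0.
(* The error [e] is split into [e / 4] for the two integrals, [e / 4] for the sums of [g] and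
   [e / 2] for the sums of |f - g|; Markov at level [e / 2] with total mass [e * c / 2] leaves
   measure [c]. *)
pose eta := Num.min (e / 4) (e * c / 2).
have eta0 : 0 < eta by rewrite lt_min !divr_gt0 ?mulr_gt0.
have fin_h : (mu `[0%R, h] < +oo)%E by rewrite lebesgue_measure_itv/=; case: ifP; rewrite ltry.
have [|g cg hg] := L1_continuous_approx `[0, h] f eta _ fin_h intf eta0; first by [].
have mg : measurable_fun setT g by exact: continuous_measurable_fun.
have e4h : 0 < e / (4 * h) by rewrite divr_gt0// mulr_gt0.
have [dl dl0 hdl] := unif_continuous_segment g h _ cg e4h.
have intg : mu.-integrable `[0, h] (EFin \o g) by exact: continuous_integrable.
have fg : `|\int[mu]_(x in `[0, h]) f x - \int[mu]_(x in `[0, h]) g x| <= e / 4.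
  rewrite -RintegralB// (@le_trans _ _ eta)//; last by rewrite ge_min lexx.
  have i1 : mu.-integrable `[0, h] (EFin \o (fun x => f x - g x)).
    have := integrableB _ intf intg; exact.
  rewrite (le_trans (le_normr_Rintegral _ _))//.
  rewrite -lee_fin /Rintegral fineK//.
  rewrite ge0_fin_numE ?integral_ge0//.
  exact: (le_lt_trans hg (ltry _)).
pose phi x := `|(f x - g x)%:E|%E.
have mphi : measurable_fun setT phi.
  by apply: measurableT_comp => //; apply/measurable_EFinP; exact: measurable_funB.
have [N _ hN] : \forall n \near \oo, h / n.+1%:R <= dl.
  have dh : 0 < dl / h by rewrite divr_gt0.
  have := near_infty_natSinv_lt (PosNum dh); apply: filterS => n /= /ltW.
  by rewrite ler_pdivlMr// mulrC.
exists N => // n /= Nn.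
have dn0 : 0 < h / n.+1%:R by rewrite divr_gt0.
have ndn : n.+1%:R * (h / n.+1%:R) = h by rewrite mulrC divfK.
pose G theta := (\sum_(j < n.+1) ((h / n.+1%:R)%:E * phi (h / n.+1%:R * (j%:R + theta))%R))%E.
have G0 theta : (0 <= G theta)%E.
  by apply: sume_ge0 => j _; rewrite mule_ge0 ?abse_ge0// lee_fin ltW.
have mG : measurable_fun setT G.
  apply: emeasurable_sum => j; apply: measurable_funeM; apply: (measurableT_comp mphi).
  exact: measurable_grid.
have GE theta : G theta = (h / n.+1%:R * \sum_(j < n.+1)
   `|f (h / n.+1%:R * (j%:R + theta)) - g (h / n.+1%:R * (j%:R + theta))|)%:E.
  by rewrite mulr_sumr -sumEFin; apply: eq_bigr => j _; rewrite EFinM /phi abse_EFin.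
have e2 : 0 < e / 2 by rewrite divr_gt0.
have sub : `[0, 1[ `&` [set theta |
      e < `|\int[mu]_(x in `[0, h]) f x - Riemann_sum f h n theta|] `<=`
    `[0, 1[ `&` [set theta | ((e / 2)%:E <= `|G theta|)%E].
  move=> theta /= [th H]; split => //; rewrite gee0_abs// GE lee_fin.
  have Rg : `|\int[mu]_(x in `[0, h]) g x - Riemann_sum g h n theta| <= e / 4.
    have := Riemann_sum_continuous g (h / n.+1%:R) (e / (4 * h)) theta n.+1 cg (ltW dn0).
    rewrite ndn; move: th; rewrite in_itv/= => /andP[-> /ltW ->] /(_ isT).
    have -> : e / (4 * h) * h = e / 4 by field; rewrite gt_eqF.
    apply; move=> x y xh xy; apply: hdl => //; rewrite (le_trans xy)//.
    exact: hN.
  have Rfg : `|Riemann_sum f h n theta - Riemann_sum g h n theta| <=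
      h / n.+1%:R * \sum_(j < n.+1)
      `|f (h / n.+1%:R * (j%:R + theta)) - g (h / n.+1%:R * (j%:R + theta))|.
    rewrite /Riemann_sum -mulrBr normrM gtr0_norm// ler_pM2l// -sumrB.
    exact: ler_norm_sum.
  move: H Rg Rfg fg; set a := \int[mu]_(x in _) f x; set b := \int[mu]_(x in _) g x.
  set r := Riemann_sum f h n theta; set s := Riemann_sum g h n theta; set q := h / _ * _.
  clearbody a b r s q.
  move=> H Rg Rfg fg.
  have : `|a - r| <= `|a - b| + `|b - s| + `|r - s|.
    rewrite (_ : a - r = (a - b) + (b - s) - (r - s)); last by ring.
    by rewrite (le_trans (ler_normB _ _))// lerD// ler_normD.
  lra.
have mR : measurable_fun setT (fun theta => \int[mu]_(x in `[0, h]) f x - Riemann_sum f h n theta).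
  by apply: measurable_funB => //; exact: measurable_Riemann_sum.
have mG1 : measurable (`[0, 1[ `&` [set theta | ((e / 2)%:E <= `|G theta|)%E]).
  apply: emeasurable_fun_c_infty => //; apply: measurableT_comp => //.
  exact: measurable_funTS.
rewrite (@le_trans _ _ (mu (`[0, 1[ `&` [set theta | ((e / 2)%:E <= `|G theta|)%E])))//.
  rewrite le_measure ?inE//; apply: measurableI => //.
  rewrite -[X in measurable X]setTI.
  by apply: measurable_fun_ltr => //; exact: measurableT_comp.
rewrite -(@lee_pmul2l _ (e / 2)%:E)//.
rewrite (le_trans (@le_integral_abse _ _ _ mu _ _ G (e / 2) _ e2))//.
  exact: measurable_funTS.
under eq_integral do rewrite gee0_abs//.
have phi0 x : (0 <= phi x)%E by exact: abse_ge0.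
have := ge0_integral_shifted_sum phi _ n.+1 dn0 mphi phi0; rewrite ndn => ->.
rewrite (@le_trans _ _ (\int[mu]_(x in `[0%R, h]) phi x)%E)//.
  apply: ge0_subset_integral => //; first exact: measurable_funTS.
  exact: subset_itv_co_cc.
rewrite (le_trans hg)// -EFinM lee_fin ge_min; apply/orP; right.
by rewrite mulrAC.
Qed.

(** Replacing [f] by a continuous [g] fails only where they differ by [e / 3] at [s] or at
    [s + hk n]; translation invariance of Lebesgue measure treats the two alike, and [hk n <= T / 2]
    keeps [s + hk n] in [[0, T]]. *)
Lemma translation_cvg (f : R -> R) (T e : R) (hk : nat -> R) :
  measurable_fun setT f -> 0 < e -> mu.-integrable `[0, T] (EFin \o f) ->
  (forall n, 0 <= hk n <= T / 2) -> hk n @[n --> \oo] --> 0 ->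
  mu (`[0, T / 2] `&` [set s | e < `|f (s + hk n) - f s|]) @[n --> \oo] --> 0%E.
Proof.
move=> mf e0 intf hkT hk0; apply: cvge0_le => // c c0.
have fin_h (a : R) : (mu `[0%R, a] < +oo)%E.
  by rewrite lebesgue_measure_itv/=; case: ifP; rewrite ltry.
have eta0 : 0 < e / 3 * (c / 3) by rewrite !mulr_gt0.
have [|g cg hg] := L1_continuous_approx `[0, T] f _ _ (fin_h T) intf eta0; first by [].
have mg : measurable_fun setT g by exact: continuous_measurable_fun.
pose B := `[0, T] `&` [set s | ((e / 3)%:E <= `|(f s - g s)%:E|)%E].
have mfg : measurable_fun `[0, T] (fun s => (f s - g s)%:E).
  by apply/measurable_EFinP; apply: measurable_funB; exact: measurable_funTS.
have mB : measurable B by apply: emeasurable_fun_c_infty => //; exact: measurableT_comp.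
have e3 : 0 < e / 3 by rewrite divr_gt0.
have c3 : 0 < c / 3 by rewrite divr_gt0.
have muB : (mu B <= (c / 3)%:E)%E.
  rewrite -(@lee_pmul2l _ (e / 3)%:E)//.
  by rewrite (le_trans (@le_integral_abse _ _ _ mu _ _ _ (e / 3) mfg e3)).
pose Cn n := [set s | e / 3 < `|g (s + hk n) - g s|].
have mshift (k : R -> R) n : measurable_fun setT k ->
    measurable_fun setT (fun s : R => k (s + hk n)).
  by move=> mk; apply: (measurableT_comp mk); exact: measurable_funD.
have mlt (k : R -> R) a : measurable_fun setT k -> measurable [set s : R | a < `|k s|].
  move=> mk; rewrite -[X in measurable X]setTI.
  by apply: measurable_fun_ltr => //; exact: measurableT_comp.
have mC n : measurable (Cn n).
  by apply: mlt; apply: measurable_funB => //; exact: mshift.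
have Ccvg := measure_setI_cvg0 mu `[0, T / 2] Cn (measurable_itv _) (fin_h _) mC.
have {}Ccvg := Ccvg (aeW _ _).
have : mu (`[0, T / 2] `&` Cn n) @[n --> \oo] --> 0%E.
  apply: Ccvg => s _.
  have : g (s + hk n) @[n --> \oo] --> g s.
    apply: (@cvg_comp _ _ _ (fun n => s + hk n) g); last exact: cg.
    have h1 : (fun n => (s : R) + hk n) @ \oo --> (s : R) + 0.
      by apply: cvgD => //; exact: cvg_cst.
    by rewrite addr0 in h1.
  move/cvgrPdist_le/(_ _ e3); apply: filterS => n h.
  by apply/negP; rewrite -leNgt distrC.
move/cvge0_near_le => /(_ (fun=> measure_ge0 _ _) _ c3); apply: filterS => n hn.
have sub : `[0, T / 2] `&` [set s | e < `|f (s + hk n) - f s|] `<=`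
   ((fun s => s + hk n) @^-1` B `|` B) `|` (`[0, T / 2] `&` Cn n).
  move=> s /= [sT es].
  have /andP[h0 hT] := hkT n.
  have [s0 s2] : 0 <= s /\ s <= T / 2 by move: sT; rewrite in_itv/= => /andP[].
  have [h1|h1] := leP (e / 3) `|f (s + hk n) - g (s + hk n)|.
    left; left; split; last by rewrite /= lee_fin.
    by rewrite /= in_itv/=; apply/andP; split; lra.
  have [h2|h2] := leP (e / 3) `|f s - g s|.
    left; right; split; last by rewrite /= lee_fin.
    by rewrite /= in_itv/=; apply/andP; split; lra.
  right; split => //=.
  have : `|f (s + hk n) - f s| <= `|f (s + hk n) - g (s + hk n)| + `|f s - g s|
      + `|g (s + hk n) - g s|.
    rewrite (_ : f (s + hk n) - f s = (f (s + hk n) - g (s + hk n)) - (f s - g s) +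
      (g (s + hk n) - g s)); last by ring.
    by rewrite (le_trans (ler_normD _ _))// lerD// ler_normB.
  rewrite /Cn/=; lra.
have mBs : measurable ((fun s => s + hk n) @^-1` B).
  rewrite -[X in measurable X]setTI.
  by have := measurable_affine 1 (hk n) measurableT B mB; under eq_fun do rewrite mul1r.
pose B' := (fun s => s + hk n) @^-1` B; pose C' := `[0, T / 2] `&` Cn n.
have mC' : measurable C' by exact: measurableI.
apply: (@le_trans _ _ (mu B' + mu B + mu C')%E).
  apply: (@le_trans _ _ (mu ((B' `|` B) `|` C'))).
    rewrite le_measure ?inE//.
    - apply: measurableI => //; apply: mlt; apply: measurable_funB => //; exact: mshift.
    - by apply: measurableU => //; exact: measurableU.
  rewrite (le_trans (measureU2 _ _ _))//; first exact: measurableU.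
  by rewrite leeD2r// measureU2.
rewrite lebesgue_measure_shift//.
have -> : c = c / 3 + c / 3 + c / 3 by field.
by rewrite !EFinD; apply: leeD => //; exact: leeD.
Qed.

End RiemannSums.

(** * Selection by Fubini and measurability in separable spaces *)

Section Sections.
Context {d : measure_display} {Omega : measurableType d} {R : realType}.
Variable P : probability Omega R.
Notation mu := (@lebesgue_measure R).

(** If every section over [D] had probability above [c], Fubini would bound the expected time
    measure of [A n] below by [c] times the measure of [D], whereas dominated convergence sends it
    to 0. The selected [s] may depend on [n]. *)
Lemma exists_small_section (D : set R) (A : nat -> set (R * Omega)) (c : R) :
  measurable D -> (0 < mu D)%E -> (mu D < +oo)%E -> (forall n, measurable (A n)) ->
  {ae P, forall om, mu (D `&` ysection (A n) om) @[n --> \oo] --> 0%E} -> 0 < c ->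
  \forall n \near \oo, exists2 s, D s & (P (xsection (A n) s) <= c%:E)%E.
Proof.
move=> mD D0 Dfin mA h c0.
have Dfin_num : mu D \is a fin_num by rewrite ge0_fin_numE.
pose B n := (D `*` setT) `&` A n.
have mB n : measurable (B n) by apply: measurableI => //; exact: measurableX.
have Bx n s : xsection (B n) s = if s \in D then xsection (A n) s else set0.
  apply/seteqP; split => om; case: ifPn => Ds; rewrite /xsection/= ?inE.
  - by case.
  - by move=> [[/mem_set]]; rewrite (negbTE Ds).
  - by move: Ds; rewrite inE.
  - by [].
have By n om : ysection (B n) om = D `&` ysection (A n) om.
  by apply/seteqP; split => s; rewrite /ysection/= !inE /B/=; [case=> -[]|case].
have mys n : measurable_fun setT (fun om => mu (ysection (B n) om)).
  exact: (measurable_fun_ysection mu (mB n)).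
have mxs n : measurable_fun setT (fun s => P (xsection (B n) s)).
  exact: (measurable_fun_xsection P (mB n)).
have fub n : (\int[mu]_s P (xsection (B n) s) = \int[P]_om mu (ysection (B n) om))%E.
  transitivity (\int[mu]_s fubini_F P (EFin \o \1_(B n)) s)%E.
    apply: eq_integral => s _.
    exact: (esym (congr1 (fun f => f s) (indic_fubini_tonelli_FE P (mB n)))).
  rewrite (indic_fubini_tonelli mu P (mB n)); apply: eq_integral => om _.
  exact: (congr1 (fun f => f om) (indic_fubini_tonelli_GE mu (mB n))).
have [_ _ H] : [/\ P.-integrable setT (cst 0%E),
    [sequence (\int[P]_(om in setT) `|mu (ysection (B n) om) - cst 0 om|)%E]_n @ \oo --> 0%E &
    [sequence (\int[P]_(om in setT) mu (ysection (B n) om))%E]_n @ \oo --> (\int[P]_(om in setT) (cst 0 om))%E].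
  apply: (@dominated_convergence _ _ _ P setT measurableT (fun n om => mu (ysection (B n) om))
    (cst 0%E) (cst (mu D))) => //.
  - by apply: filterS h => om h _; under eq_fun do rewrite By.
  - by rewrite -(fineK Dfin_num); exact: finite_measure_integrable_cst.
  - apply: aeW => om n _; rewrite gee0_abs// By le_measure ?inE//.
    by apply: measurableI => //; exact: (measurable_ysection om (mA n)).
move: H; rewrite integral0.
have cD : 0 < c * fine (mu D) / 2.
  by rewrite divr_gt0// mulr_gt0// -lte_fin fineK.
move=> /cvge0_near_le => /(_ _ _ cD).
have ge0 n : (0 <= [sequence (\int[P]_(om in setT) mu (ysection (B n) om))%E]_n n)%E.
  by apply: integral_ge0.
move=> /(_ ge0); apply: filterS => n /= hn; apply: contrapT => H.
have lt s : D s -> (c%:E <= P (xsection (A n) s))%E.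
  by move=> Ds; rewrite leNgt; apply/negP => /ltW Hs; apply: H; exists s.
move: hn; rewrite -fub leNgt => /negP; apply.
apply: (@lt_le_trans _ _ (\int[mu]_(s in D) c%:E)%E).
  rewrite integral_cst// -[X in (_ < _ * X)%E](fineK Dfin_num) -EFinM lte_fin.
  rewrite ltr_pdivrMr// ltr_pMr ?ltr1n// mulr_gt0// -lte_fin fineK//.
rewrite [leLHS]integral_mkcond; apply: ge0_le_integral => //.
- by move=> s _; rewrite patchE; case: ifP => // _; rewrite lee_fin ltW.
- by apply/(measurable_restrictT _ _).1.
- exact: mxs.
- move=> s _; rewrite patchE Bx; case: ifPn => [/set_mem/lt//|_].
  by rewrite measure0.
Qed.

End Sections.

Lemma dense_sequence {W : ptopologicalType} (D : set W) : countable D -> dense D ->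
  exists x : nat -> W, forall O : set W, open O -> O !=set0 -> exists i, O (x i).
Proof.
move=> /countable_injP[f finj] dD.
exists (fun i => xget point [set y | D y /\ f y = i]) => O oO O0.
have [y [Oy Dy]] := dD O O0 oO.
exists (f y); have := @xgetPex _ point [set z | D z /\ f z = f y] (ex_intro _ y (conj Dy erefl)).
by move=> [Dz fz]; rewrite (_ : xget _ _ = y)//; apply: finj; rewrite ?inE.
Qed.

Lemma measure_bigsetU_le {d : measure_display} {T : measurableType d} {R : realType}
  (mu : {measure set T -> \bar R}) (A : nat -> set T) (a : R) (k : nat) :
  (forall i, measurable (A i)) -> (forall i, (i < k)%N -> (mu (A i) <= a%:E)%E) ->
  (mu (\big[setU/set0]_(i < k) A i) <= (k%:R * a)%:E)%E.
Proof.
move=> mA; elim: k => [|k IH] h; first by rewrite big_ord0 measure0 mul0r.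
rewrite big_ord_recr/= (le_trans (measureU2 _ _ _))//.
  exact: bigsetU_measurable.
rewrite -natr1 mulrDl mul1r EFinD leeD ?h// IH// => i ik.
by rewrite h// ltnW.
Qed.

Section HilbertMeasurable.
Context {d : measure_display} {T : measurableType d} {R : realType} {V : normedModType R}.

Definition borel_measurable (f : T -> V) : Prop :=
  forall G : set V, open G -> measurable (f @^-1` G).

(** With a countable dense set, the preimage of an open set of pairs is a countable union of
    preimages of products of balls, so joint measurability follows from that of [f] and [g]. *)
Lemma borel_measurable_pair (f g : T -> V) (h : V * V -> R) (D : set V) :
  countable D -> dense D -> borel_measurable f -> borel_measurable g -> continuous h ->
  measurable_fun setT (fun t => h (f t, g t)).
Proof.
move=> cD dD mf mg ch; apply: (measurability _ (RGenOInfty.measurableE R)) => //.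
move=> /= _ [_ [a ->] <-]; rewrite setTI.
have [x hx] := dense_sequence D cD dD.
pose O := h @^-1` `]a, +oo[%classic.
have oO : open O.
  by apply: open_comp => // p _; exact: ch.
pose Bl i n := ball (x i) n.+1%:R^-1.
rewrite [X in measurable X](_ : _ = \bigcup_i \bigcup_j
   \bigcup_(n in [set n | Bl i n `*` Bl j n `<=` O]) (f @^-1` Bl i n `&` g @^-1` Bl j n)).
  apply: bigcupT_measurable => i; apply: bigcupT_measurable => j.
  apply: bigcup_measurable => n _.
  by apply: measurableI; [apply: mf|apply: mg]; exact: ball_open.
apply/seteqP; split => t /=; last first.
  by move=> [i _ [j _ [n /= sub [ft gt]]]]; exact: (sub (f t, g t)).
move=> ht; have /nbhs_ballP[e /= e0 he] : nbhs (f t, g t) O by exact: open_nbhs_nbhs.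
have e2 : 0 < e / 2 by rewrite divr_gt0.
have [n _ hn] := near_infty_natSinv_lt (PosNum e2).
have {}hn : n.+1%:R^-1 < e / 2 by exact: (hn n (leqnn n)).
have n0 : 0 < n.+1%:R^-1 :> R by rewrite invr_gt0.
have near_x (y : V) : exists i, ball (x i) n.+1%:R^-1 y.
  have [||i hi] := hx (ball y n.+1%:R^-1); first exact: ball_open.
    by exists y; exact: ballxx.
  by exists i; exact: ball_sym.
have [i hi] := near_x (f t); have [j hj] := near_x (g t).
exists i => //; exists j => //; exists n => //= -[y z] [/= hy hz].
apply: he; split => /=.
  apply: (@le_ball _ _ _ (n.+1%:R^-1 + n.+1%:R^-1)).
    by rewrite (splitr e) lerD// ltW.
  by apply: ball_triangle hy; exact: ball_sym.
apply: (@le_ball _ _ _ (n.+1%:R^-1 + n.+1%:R^-1)).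
  by rewrite (splitr e) lerD// ltW.
by apply: ball_triangle hz; exact: ball_sym.
Qed.

End HilbertMeasurable.

Lemma near_all_lt {I : Type} (F : set_system I) {FF : Filter F} (Q : I -> nat -> Prop) k :
  (forall i, \forall t \near F, Q t i) ->
  \forall t \near F, forall i, (i < k)%N -> Q t i.
Proof.
move=> h; elim: k => [|k IH]; first exact: nearW.
apply: filterS2 IH (h k) => t IH Qk i; rewrite ltnS leq_eqVlt => /orP[/eqP->//|].
exact: IH.
Qed.

(** * Translations of vector-valued paths *)

Section PathwiseTranslation.
Context {R : realType} {V : completeNormedModType R} (S : R -> V -> V).
Hypothesis SP : C0_semigroup S.
Notation mu := (@lebesgue_measure R).

(** The norm of the path need not be integrable, so the argument goes through the real functions
    [f i]. Off a set of small measure, [y s] is within [r] of one of finitely many points [x i];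
    there [S (hk n)] moves [y s] little, and a large jump of the path forces a jump of [f i]. *)
Lemma path_translation_cvg (y : R -> V) (D : set V) (T e : R) (hk : nat -> R) :
  countable D -> dense D -> (forall x, measurable_fun setT (fun s => `|y s - x|)) ->
  0 < T -> 0 < e -> (forall n, 0 <= hk n <= T / 2) -> hk n @[n --> \oo] --> 0 ->
  (forall n, measurable [set s | e < `|y (s + hk n) - S (hk n) (y s)|]) ->
  mu (`[0, T / 2] `&` [set s | e < `|y (s + hk n) - S (hk n) (y s)|]) @[n --> \oo] --> 0%E.
Proof.
move=> cD dD my T0 e0 hkT hk0 mA; apply: cvge0_le => // c c0.
have [x hx] := dense_sequence D cD dD.
have [M M1 hM] := sgroup_bounded _ SP (T / 2).
have M0 : 0 < M by rewrite (lt_le_trans ltr01).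
(* With [M * r = e / 4], the distances from [S (hk n) (y s)] to [S (hk n) (x i)] and from there to
   [x i] are each at most [e / 4]. *)
pose r := e / (4 * M).
have r0 : 0 < r by rewrite divr_gt0// mulr_gt0.
have rM : M * r = e / 4 by rewrite /r; field; rewrite gt_eqF.
have re : r <= e / 4 by rewrite -rM ler_peMl// ltW.
pose E i := [set s | `|y s - x i| < r].
have mE i : measurable (E i).
  rewrite -[X in measurable X]setTI; apply: measurable_fun_ltr => //; exact: my.
pose I : set R := `[0, T / 2]%classic.
have mI : measurable I by exact: measurable_itv.
have Ifin : (mu I < +oo)%E by rewrite lebesgue_measure_itv/=; case: ifP; rewrite ltry.
pose F k := ~` (\bigcup_(i < k) E i).
have mF k : measurable (F k) by apply/measurableC/bigcup_measurable => i _.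
have c2 : 0 < c / 2 by rewrite divr_gt0.
have : mu (I `&` F k) @[k --> \oo] --> 0%E.
  apply: (measure_setI_cvg0 mu I F mI Ifin mF (aeW _ _)) => s _.
  have [||i hi] := hx (ball (y s) r); first exact: ball_open.
    by exists (y s); exact: ballxx.
  exists i.+1 => // k /= ik; apply; exists i => //.
  by move: hi; rewrite -ball_normE.
move/cvge0_near_le => /(_ (fun=> measure_ge0 _ _) _ c2) [k _ /(_ k (leqnn k)) hk1].
(* Truncation at [e] makes [f i] integrable while it still detects distances above [e / 2]. *)
pose f i s := Num.min (`|y s - x i|) e.
have mf i : measurable_fun setT (f i) by exact: measurable_minr.
have fint i : mu.-integrable `[0, T] (EFin \o f i).
  apply: (@le_integrable _ _ _ mu `[0, T] _ _ (EFin \o cst e)) => //.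
  - by apply/measurable_EFinP; apply: measurable_funTS; exact: mf.
  - move=> s _ /=; have f0 : 0 <= f i s by rewrite le_min normr_ge0 ltW.
    by rewrite lee_fin (ger0_norm f0) (ger0_norm (ltW e0)) ge_min lexx orbT.
  - by apply: continuous_integrable => q; exact: cvg_cst.
pose G n i := [set s | e / 4 < `|f i (s + hk n) - f i s|].
have mshift n i : measurable_fun setT (fun s : R => f i (s + hk n)).
  by apply: (measurableT_comp (mf i)); exact: measurable_funD.
have mG n i : measurable (G n i).
  rewrite -[X in measurable X]setTI; apply: measurable_fun_ltr => //.
  by apply: measurableT_comp => //; exact: measurable_funB.
have e4 : 0 < e / 4 by rewrite divr_gt0.
have c2k : 0 < c / 2 / k.+1%:R by rewrite divr_gt0.
have Gn i : \forall n \near \oo, (mu (I `&` G n i) <= (c / 2 / k.+1%:R)%:E)%E.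
  have := translation_cvg (f i) T (e / 4) hk (mf i) e4 (fint i) hkT hk0.
  by move/cvge0_near_le => /(_ (fun=> measure_ge0 _ _) _ c2k).
have Gall : \forall n \near \oo, forall i, (i < k)%N ->
    (mu (I `&` G n i) <= (c / 2 / k.+1%:R)%:E)%E.
  exact: near_all_lt.
have Sall : \forall n \near \oo, forall i, (i < k)%N -> `|S (hk n) (x i) - x i| <= r.
  apply: near_all_lt => i.
  have [dl dl0 hdl] := sgroup_modulus _ SP (x i) _ r0.
  have hk_dl : \forall n \near \oo, hk n <= dl.
    by move/cvgr0_norm_le : hk0 => /(_ _ dl0); apply: filterS => n; exact/le_trans/ler_norm.
  apply: filterS hk_dl => n hn.
  by apply: hdl; rewrite hn andbT; case/andP: (hkT n).
apply: filterS2 Gall Sall => n Gn' Sn.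
pose U := \big[setU/set0]_(i < k) (I `&` G n i).
have sub : I `&` [set s | e < `|y (s + hk n) - S (hk n) (y s)|] `<=` (I `&` F k) `|` U.
  move=> s [Is es]; have [Fs|/contrapT[i /= ik Eis]] := pselect (F k s); first by left.
  right; rewrite /U -(bigcup_mkord k (fun i => I `&` G n i)); exists i => //; split => //.
  rewrite /G/= /f.
  have /andP[h0 hT] := hkT n.
  have n1 : `|y (s + hk n) - S (hk n) (y s)| <= `|y (s + hk n) - x i| +
     `|S (hk n) (y s - x i)| + `|S (hk n) (x i) - x i|.
    rewrite (sgroupB _ SP)//.
    rewrite (le_trans (ler_distD (x i) _ _))// -addrA lerD2l.
    rewrite (le_trans (ler_distD (S (hk n) (x i)) _ _))// addrC.
    by rewrite lerD// distrC.
  have n2 : `|S (hk n) (y s - x i)| <= e / 4.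
    rewrite (le_trans (hM _ _ _)) ?h0// -rM ler_pM2l//; exact: ltW.
  have n3 := Sn i ik.
  have n4 : e / 2 < `|y (s + hk n) - x i|.
    have es' : e < `|y (s + hk n) - S (hk n) (y s)| := es.
    lra.
  rewrite (min_l (_ : `|y s - x i| <= e)); last first.
    by rewrite (le_trans (ltW Eis))// (le_trans re)// ler_pdivrMr// ler_peMr ?(ltW e0)// ler1n.
  apply: lt_le_trans (ler_norm _).
  have : e / 2 < Num.min `|y (s + hk n) - x i| e by rewrite lt_min n4/=; lra.
  have Eis' : `|y s - x i| < r := Eis.
  lra.
have mU : measurable U by apply: bigsetU_measurable => i _; exact: measurableI.
have mIF : measurable (I `&` F k) by exact: measurableI.
have muU : (mu U <= (c / 2)%:E)%E.
  have := measure_bigsetU_le mu (fun i => I `&` G n i) _ k (fun i => measurableI _ _ mI (mG n i)) Gn'.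
  move=> /le_trans; apply; rewrite lee_fin mulrA ler_pdivrMr// mulrC ler_pM2l//.
  by rewrite ler_nat.
rewrite (@le_trans _ _ (mu (I `&` F k) + mu U)%E)//.
  rewrite (le_trans _ (measureU2 _ _ _))// le_measure ?inE//; last exact: measurableU.
  by apply: measurableI => //; exact: mA.
by rewrite [c in leRHS]splitr EFinD leeD.
Qed.

End PathwiseTranslation.

(** * Laws of increments of Levy processes *)

Section ParamIntegral.
Context {d : measure_display} {Omega : measurableType d} {R : realType}.
Notation mu := (@lebesgue_measure R).

Lemma measurable_Rintegral_param (f : R * Omega -> R) (D : set R) :
  measurable D -> measurable_fun setT f ->
  measurable_fun setT (fun om => \int[mu]_(s in D) f (s, om)).
Proof.
move=> mD mf.
have ge0 (g : R * Omega -> \bar R) : measurable_fun setT g -> (forall p, 0 <= g p)%E ->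
    measurable_fun setT (fun om => \int[mu]_(s in D) g (s, om))%E.
  move=> mg g0.
  have mgD : measurable_fun setT (g \_ (D `*` setT)).
    by apply/(measurable_restrictT _ _).1; [exact: measurableX|exact: measurable_funTS].
  have gD0 p : (0 <= (g \_ (D `*` setT)) p)%E by rewrite patchE; case: ifP.
  have := @measurable_fun_fubini_tonelli_G _ _ _ _ _ mu _ mgD gD0.
  apply: eq_measurable_fun => om _; rewrite /fubini_G [RHS]integral_mkcond.
  apply: eq_integral => s _; rewrite !patchE.
  by have [Ds|Ds] := boolP (s \in D); [rewrite mem_set// => /=; split => //; exact: set_mem|
    rewrite memNset// => -[/mem_set]; rewrite (negbTE Ds)].
rewrite /Rintegral; apply: (measurableT_comp (fine_measurable measurableT)).
under eq_fun do rewrite integralE.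
apply: emeasurable_funB.
- under eq_fun do under eq_integral do rewrite funeposE.
  apply: (ge0 (fun p => maxe (f p)%:E 0)%E).
    by apply: measurable_maxe => //; exact/measurable_EFinP.
  by move=> p; rewrite le_max lexx orbT.
- under eq_fun do under eq_integral do rewrite funenegE.
  apply: (ge0 (fun p => maxe (- (f p)%:E) 0)%E).
    apply: measurable_maxe => //; apply/measurable_EFinP.
    exact: measurable_funN.
  by move=> p; rewrite le_max lexx orbT.
Qed.

End ParamIntegral.

Section IncrementLaw.
Context {d : measure_display} {Omega : measurableType d} {R : realType}.
Variable P : probability Omega R.

Definition cylinders (m n : nat) : set (set ('I_m -> 'I_n -> R)) :=
  [set C | exists2 B : 'I_m -> set ('I_n -> R), (forall k, borelRn (B k)) &
                                                C = [set z | forall k, B k (z k)]].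

Lemma borelRn_setT n : @borelRn R n setT.
Proof. exact: (@measurableT _ (g_sigma_algebraType _)). Qed.

Lemma borelRn_preimage_measurable n (X : Omega -> 'I_n -> R) (B : set ('I_n -> R)) :
  (forall i, measurable_fun setT (fun w => X w i)) -> borelRn B -> measurable (X @^-1` B).
Proof.
move=> mX; suff sub : @borelRn R n `<=` [set C | measurable (X @^-1` C)] by exact: sub.
apply: smallest_sub.
  split => /=.
  - by rewrite preimage_set0.
  - by move=> A mA; rewrite setTD preimage_setC; exact: measurableC.
  - by move=> F mF; rewrite preimage_bigcup; exact: bigcupT_measurable.
move=> _ [i [A [mA ->]]] /=; rewrite -[X in measurable X]setTI.
exact: (mX i).
Qed.

Lemma cylinders_setI m n : setI_closed (@cylinders m n).
Proof.
move=> _ _ [A mA ->] [B mB ->]; exists (fun k => A k `&` B k).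
  by move=> k; exact: (@measurableI _ (g_sigma_algebraType _) _ _ (mA k) (mB k)).
by apply/seteqP; split => z /=; [move=> [h1 h2] k|move=> h; split => k; case: (h k)].
Qed.

(** Dynkin's pi-lambda argument: independence and equality of the marginal laws give agreement on
    [cylinders], which is stable under intersection. *)
Lemma indep_law_eq m n (Z Z' : 'I_m -> Omega -> 'I_n -> R) :
  (forall k i, measurable_fun setT (fun w => Z k w i)) ->
  (forall k i, measurable_fun setT (fun w => Z' k w i)) ->
  indep_vectors P Z -> indep_vectors P Z' ->
  (forall k B, borelRn B -> P (Z k @^-1` B) = P (Z' k @^-1` B)) ->
  forall C, <<s @cylinders m n >> C ->
    P [set w | C (fun k => Z k w)] = P [set w | C (fun k => Z' k w)].
Proof.
move=> mZ mZ' iZ iZ' ZZ'.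
pose H := [set C : set ('I_m -> 'I_n -> R) | [/\ measurable [set w | C (fun k => Z k w)],
  measurable [set w | C (fun k => Z' k w)] &
  P [set w | C (fun k => Z k w)] = P [set w | C (fun k => Z' k w)]]].
suff : <<s @cylinders m n >> `<=` H by move=> sub C /sub[].
rewrite -setI_closed_g_dynkin_g_sigma_algebra; last exact: cylinders_setI.
apply: smallest_sub.
  split.
  - by split => //=; exact: measurableT.
  - move=> C [m1 m2 e12]; split.
    + exact: measurableC.
    + exact: measurableC.
    + have -> : [set w | (~` C) (fun k => Z k w)] = ~` [set w | C (fun k => Z k w)] by [].
      have -> : [set w | (~` C) (fun k => Z' k w)] = ~` [set w | C (fun k => Z' k w)] by [].
      by rewrite !probability_setC// e12.
  - move=> F tF hF; split.
    + rewrite (_ : [set w | _] = \bigcup_n [set w | F n (fun k => Z k w)])//.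
      by apply: bigcupT_measurable => k; case: (hF k).
    + rewrite (_ : [set w | _] = \bigcup_n [set w | F n (fun k => Z' k w)])//.
      by apply: bigcupT_measurable => k; case: (hF k).
    + have -> : [set w | (\bigcup_k F k) (fun k => Z k w)] = \bigcup_n [set w | F n (fun k => Z k w)] by [].
      have -> : [set w | (\bigcup_k F k) (fun k => Z' k w)] = \bigcup_n [set w | F n (fun k => Z' k w)] by [].
      rewrite !measure_bigcup//.
      * by apply: eq_eseriesr => k _; case: (hF k).
      * by move=> k _; case: (hF k).
      * apply/trivIsetP => i j _ _ ij; apply/seteqP; split => // w [/= h1 h2].
        move/trivIsetP : tF => /(_ i j Logic.I Logic.I ij) E.
        by have h12 : (F i `&` F j) _ := conj h1 h2; rewrite E in h12.
      * by move=> k _; case: (hF k).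
      * apply/trivIsetP => i j _ _ ij; apply/seteqP; split => // w [/= h1 h2].
        move/trivIsetP : tF => /(_ i j Logic.I Logic.I ij) E.
        by have h12 : (F i `&` F j) _ := conj h1 h2; rewrite E in h12.
move=> _ [B mB ->].
have cap (W : 'I_m -> Omega -> 'I_n -> R) :
    [set w | forall k, B k (W k w)] = \bigcap_(k in [set: 'I_m]) (W k @^-1` B k).
  by apply/seteqP; split => w /= h k; [move=> _; exact: h|exact: h].
have fcap (W : 'I_m -> Omega -> 'I_n -> R) : (forall k i, measurable_fun setT (fun w => W k w i)) ->
    measurable (\bigcap_(k in [set: 'I_m]) (W k @^-1` B k)).
  move=> mW; apply: fin_bigcap_measurable; first exact: finite_finset.
  by move=> k _; exact: borelRn_preimage_measurable.
split => /=; rewrite ?cap.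
- exact: fcap.
- exact: fcap.
- by rewrite iZ// iZ'//; apply: eq_bigr => k _; exact: ZZ'.
Qed.

(** Over either shifted grid the increments are independent, and stationarity identifies each
    marginal law with that of an increment starting at 0. *)
Lemma levy_increments_law n (X : R -> Omega -> 'I_n -> R) (m : nat) (o : nat -> R) (s s' : R) :
  levy_process P X -> (forall t i, measurable_fun setT (fun w => X t w i)) ->
  0 <= o 0%N -> (forall k, o k <= o k.+1) -> 0 <= s -> 0 <= s' ->
  forall C, <<s @cylinders m n >> C ->
    P [set w | C (fun k i => X (s + o k.+1) w i - X (s + o k) w i)] =
    P [set w | C (fun k i => X (s' + o k.+1) w i - X (s' + o k) w i)].
Proof.
move=> [_ _ indX statX _] mX o0 olt s0 s'0.
have oge k : 0 <= o k by elim: k => // k; move/le_trans; apply.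
apply: (@indep_law_eq m n (fun k w i => X (s + o k.+1) w i - X (s + o k) w i)
  (fun k w i => X (s' + o k.+1) w i - X (s' + o k) w i)).
- by move=> k i; exact: measurable_funB.
- by move=> k i; exact: measurable_funB.
- apply: (indX m (fun k => s + o k)); first by rewrite addr_ge0.
  by move=> k; rewrite lerD2l.
- apply: (indX m (fun k => s' + o k)); first by rewrite addr_ge0.
  by move=> k; rewrite lerD2l.
- move=> k B mB; have hk : 0 <= o k.+1 - o k by rewrite subr_ge0.
  have st r : 0 <= r ->
      P ((fun w i => X (r + o k.+1) w i - X (r + o k) w i) @^-1` B) =
      P ((fun w i => X (o k.+1 - o k) w i - X 0 w i) @^-1` B).
    move=> r0; have -> : r + o k.+1 = r + o k + (o k.+1 - o k) by ring.
    by apply: statX => //; exact: addr_ge0.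
  by rewrite (st s)// (st s').
Qed.

Lemma cylinders_coord m n (k : 'I_m) (i : 'I_n) :
  @measurable_fun _ _ (g_sigma_algebraType (@cylinders m n)) R setT (fun z => z k i).
Proof.
move=> _ A mA; rewrite setTI; apply: sub_sigma_algebra.
exists (fun j => if j == k then [set x | A (x i)] else setT).
  move=> j; case: eqP => _; last exact: borelRn_setT.
  by apply: sub_sigma_algebra; exists i, A.
apply/seteqP; split => z /=; last by move=> /(_ k); rewrite eqxx.
by move=> Az j; case: eqP => // ->.
Qed.

End IncrementLaw.

(** * Deterministic grid estimates *)

Section GridEstimates.
Context {R : realType} {V : completeNormedModType R} (ip : V -> V -> R)
  (S : R -> V -> V).
Hypothesis ipP : is_inner_product ip.
Hypothesis SP : C0_semigroup S.
Notation adjS := (adj_sgroup ip S).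
Variables (h M : R) (N : nat) (theta : R).
Hypothesis h0 : 0 < h.
Hypothesis M0 : 0 <= M.
Hypothesis hM : forall q x, 0 <= q <= h -> `|S q x| <= M * `|x|.
Hypothesis th : 0 <= theta < 1.
Let dl := h / N.+1%:R.
Let node (j : nat) : R := dl * (j%:R + theta).

Let dl0 : 0 < dl. Proof. by rewrite divr_gt0. Qed.
Let Ndl : N.+1%:R * dl = h. Proof. by rewrite mulrC divfK. Qed.

Let node_lb (j : nat) : dl * j%:R <= node j.
Proof. by rewrite ler_pM2l// lerDl; case/andP: th. Qed.

Let node_ub (j : nat) : node j < dl * j.+1%:R.
Proof. by rewrite ltr_pM2l// -natr1 ltrD2l; case/andP: th. Qed.

Let cell_ub (j : nat) : (j < N.+1)%N -> dl * j.+1%:R <= h.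
Proof. by move=> jN; rewrite -Ndl mulrC ler_pM2r// ler_nat. Qed.

Let cell_lb (j : nat) : 0 <= dl * j%:R.
Proof. by rewrite mulr_ge0// ltW. Qed.

Let cellS (j : nat) : dl * j.+1%:R = dl * j%:R + dl.
Proof. by rewrite -natr1 mulrDr mulr1. Qed.

Lemma telescope_ord (f : nat -> V) n : \sum_(j < n) (f j - f j.+1) = f 0%N - f n.
Proof.
elim: n => [|n IH]; first by rewrite big_ord0 subrr.
by rewrite big_ord_recr/= IH addrA subrK.
Qed.

(** The fundamental theorem of calculus along the adjoint orbit, with a Riemann sum for the
    integral: each of the [N.+1] cells has a Taylor remainder of order [dl ^+ 2], and
    [N.+1%:R * dl = h]. *)
Lemma adj_grid_endpoint v w1 w2 : adj_gen ip S v w1 -> adj_gen ip S w1 w2 ->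
  `|v - adjS h v + \sum_(j < N.+1) dl *: adjS (h - node j) w1|
    <= M * `|w2| * h * dl.
Proof.
move=> vw w12.
have -> : v - adjS h v + \sum_(j < N.+1) dl *: adjS (h - node j) w1 =
    - \sum_(j < N.+1) (adjS (h - dl * j%:R) v - adjS (h - dl * j.+1%:R) v
                       - dl *: adjS (h - node j) w1).
  rewrite sumrB (telescope_ord (fun j => adjS (h - dl * j%:R) v)).
  rewrite mulr0 subr0 [dl * _]mulrC Ndl subrr.
  have -> : adjS 0 v = v.
    by apply: (eq_ip _ ipP) => u; rewrite -(adj_sgroupE _ _ ipP SP)// (sgroup0 _ SP).
  by rewrite opprB opprB addrC.
rewrite normrN (le_trans (ler_norm_sum _ _ _))//.
have -> : M * `|w2| * h * dl = \sum_(j < N.+1) M * `|w2| * dl ^+ 2.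
  rewrite sumr_const card_ord -mulr_natl -[in LHS]Ndl; ring.
apply: ler_sum => j _.
have jh := cell_ub j (ltn_ord j).
have := adj_gen_taylor _ _ ipP SP h M v w1 w2 (h - dl * j.+1%:R) (h - dl * j%:R) (h - node j)
  hM M0 vw w12.
have -> : h - dl * j%:R - (h - dl * j.+1%:R) = dl by rewrite cellS; ring.
apply; first by rewrite subr_ge0.
- by rewrite !lerD2l !lerN2 node_lb ltW.
- by rewrite lerBlDr lerDl.
Qed.

(** At most one open cell contains [r]. Bounding by the indicator of [r < dl * n%:R], rather than by
    1, makes the induction on [n] work. *)
Lemma cell_count (r : R) n :
  \sum_(j < n) ((dl * j%:R < r)%R && (r < dl * j.+1%:R)%R)%:R <= (r < dl * n%:R)%R%:R :> R.
Proof.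
elim: n => [|n IH]; first by rewrite big_ord0.
rewrite big_ord_recr/=; have [rn|nr] := ltP r (dl * n%:R).
  rewrite (lt_trans rn); last by rewrite cellS ltrDl.
  by rewrite ltNge (ltW rn)/= addr0 (le_trans IH)// rn.
move: IH; rewrite ltNge nr/= => IH.
by rewrite (le_trans (lerD IH (lexx _)))// add0r; case: (_ < r); rewrite ?andbF//= ler0n.
Qed.

(** The same expansion over [[r, h]]. Only the cell cut by [r] escapes the Taylor bound; it is
    estimated crudely and occurs at most once, hence the term with [w1]. *)
Lemma adj_grid_step v w1 w2 r : adj_gen ip S v w1 -> adj_gen ip S w1 w2 -> 0 <= r <= h ->
  `|v + \sum_(j < N.+1) dl *: (if r <= node j then adjS (h - node j) w1 else 0)
    - adjS (h - r) v| <= (M * `|w2| * h + 2 * M * `|w1|) * dl.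
Proof.
move=> vw w12 /andP[r0 rh].
have adj0 : adjS 0 v = v.
  by apply: (eq_ip _ ipP) => u; rewrite -(adj_sgroupE _ _ ipP SP)// (sgroup0 _ SP).
(* Clamping the grid points at [r] makes the cells to the left of [r] contribute 0 to the
   telescoping sum. *)
pose f (j : nat) := adjS (h - Num.max r (dl * j%:R)) v.
have -> : v + \sum_(j < N.+1) dl *: (if r <= node j then adjS (h - node j) w1 else 0)
    - adjS (h - r) v =
  \sum_(j < N.+1) (dl *: (if r <= node j then adjS (h - node j) w1 else 0) - (f j - f j.+1)).
  rewrite [RHS]sumrB telescope_ord /f mulr0 max_l// [dl * _]mulrC Ndl max_r// subrr adj0.
  by rewrite opprB addrA [v + _]addrC.
rewrite (le_trans (ler_norm_sum _ _ _))//.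
have -> : (M * `|w2| * h + 2 * M * `|w1|) * dl =
    N.+1%:R * (M * `|w2| * dl ^+ 2) + 2 * M * `|w1| * dl * 1.
  rewrite -[in LHS]Ndl; ring.
have mono : \sum_(j < N.+1) (M * `|w2| * dl ^+ 2 + 2 * M * `|w1| * dl *
    ((dl * j%:R < r)%R && (r < dl * j.+1%:R)%R)%:R) <=
    N.+1%:R * (M * `|w2| * dl ^+ 2) + 2 * M * `|w1| * dl * 1.
  have sumK (K : R) : \sum_(j < N.+1) K = N.+1%:R * K.
    by rewrite sumr_const card_ord mulr_natl.
  rewrite big_split/= sumK lerD2l -mulr_sumr.
  apply: ler_wpM2l; first by rewrite !mulr_ge0// ltW.
  by rewrite (le_trans (cell_count _ _))//; case: (_ < _); rewrite ?ler01.
apply: le_trans mono; apply: ler_sum => j _.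
have jh := cell_ub j (ltn_ord j).
have c1 := cellS j.
have c0 := cell_lb j.
have n1 := node_lb j; have n2 := node_ub j.
have Kge0 : 0 <= M * `|w2| * dl ^+ 2 by rewrite mulr_ge0 ?sqr_ge0// mulr_ge0.
have [rj|jr] := leP r (dl * j%:R).
  rewrite /= mulr0 addr0 (le_trans rj n1) /f !max_r//; last first.
    by rewrite (le_trans rj)// c1 lerDl ltW.
  have := adj_gen_taylor _ _ ipP SP h M v w1 w2 (h - dl * j.+1%:R) (h - dl * j%:R)
    (h - node j) hM M0 vw w12.
  rewrite distrC; have -> : h - dl * j%:R - (h - dl * j.+1%:R) = dl by rewrite c1; ring.
  apply; first by rewrite subr_ge0.
  - by rewrite !lerD2l !lerN2 n1 ltW.
  - by rewrite lerBlDr lerDl.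
have [rj1|j1r] := ltP r (dl * j.+1%:R); last first.
  have -> : (r <= node j) = false by apply/negbTE; rewrite -ltNge (lt_le_trans n2).
  rewrite /= mulr0 addr0 scaler0 /f !max_l ?(ltW jr)//.
  by rewrite subrr subr0 normr0.
rewrite /= mulr1 (le_trans _ (_ : 2 * M * `|w1| * dl <= _))//; last by rewrite lerDr.
have -> : 2 * M * `|w1| * dl = dl * (M * `|w1|) + M * `|w1| * dl by ring.
rewrite (le_trans (ler_normB _ _))// lerD//.
  rewrite normrZ gtr0_norm// ler_pM2l//.
  case: ifP => _; last by rewrite normr0 mulr_ge0.
  have hn : 0 <= h - node j by rewrite subr_ge0 (le_trans (ltW n2)).
  apply: (adj_sgroup_norm _ _ ipP SP) => // x; apply: hM; rewrite hn/=.
  by rewrite lerBlDr lerDl (le_trans c0).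
rewrite /f (max_l (ltW jr)) (max_r (ltW rj1)).
rewrite (le_trans (adj_gen_lipschitz _ _ ipP SP h M v w1 _ _ hM M0 vw _ _))//.
- by rewrite subr_ge0 jh/= lerBlDr lerDl (le_trans c0)// c1 lerDl ltW.
- by rewrite subr_ge0 rh/= lerBlDr lerDl.
- rewrite ler_wpM2l ?mulr_ge0// ger0_norm; lra.
Qed.

End GridEstimates.

(** * Weak Bochner regularity for piecewise continuous paths *)

Section Cutoff.
Context {R : realType}.

(* Vanishes on J and equals 1 away from J for large k: it turns a path with jumps in J
   into a continuous one. *)
Definition cutoff (J : seq R) (k : nat) (s : R) : R :=
  \prod_(j <- J) Num.min 1 (k%:R * `|s - j|).

Lemma cutoff_cons a J k s : cutoff (a :: J) k s = Num.min 1 (k%:R * `|s - a|) * cutoff J k s.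
Proof. by rewrite /cutoff big_cons. Qed.

Lemma cutoff_bounds J k s : 0 <= cutoff J k s <= 1.
Proof.
elim: J => [|a J /andP[IH0 IH1]]; first by rewrite /cutoff big_nil ler01 lexx.
have m0 : 0 <= Num.min 1 (k%:R * `|s - a|) by rewrite le_min ler01 mulr_ge0.
by rewrite cutoff_cons mulr_ge0//= mulr_ile1// ge_min lexx.
Qed.

Lemma cutoff_continuous J k : continuous (cutoff J k).
Proof.
elim: J => [|a J IH] s.
  rewrite (_ : cutoff [::] k = cst 1); first exact: cvg_cst.
  by apply/funext => r; rewrite /cutoff big_nil.
rewrite (_ : cutoff (a :: J) k = fun r => Num.min 1 (k%:R * `|r - a|) * cutoff J k r); last first.
  by apply/funext => r; rewrite cutoff_cons.
apply: cvgM; last exact: IH.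
apply: (@continuous_min _ _ (cst 1) (fun r : R => k%:R * `|r - a|)); first exact: cvg_cst.
apply: cvgM; first exact: cvg_cst.
by apply: cvg_norm; apply: cvgB; [exact: cvg_id|exact: cvg_cst].
Qed.

Lemma cutoff_mem J k s : s \in J -> cutoff J k s = 0.
Proof.
elim: J => // a J IH; rewrite inE cutoff_cons => /orP[/eqP->|/IH->]; last by rewrite mulr0.
by rewrite subrr normr0 mulr0 min_r// mul0r.
Qed.

Lemma cutoff_near J s : s \notin J -> \forall k \near \oo, cutoff J k s = 1.
Proof.
elim: J => [_|a J IH]; first by apply: nearW => k; rewrite /cutoff big_nil.
rewrite inE negb_or => /andP[sa /IH h].
have sa0 : 0 < `|s - a| by rewrite normr_gt0 subr_eq0.
have [N _ hN] := near_infty_natSinv_lt (PosNum sa0).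
near=> k; rewrite cutoff_cons; have -> : cutoff J k s = 1 by near: k.
rewrite mulr1 min_l// mulrC -ler_pdivrMr ?mul1r; last first.
  by rewrite ltr0n; near: k; exists 1%N.
have kN : (N < k)%N by near: k; exists N.+1.
by have := hN k.-1; rewrite /= prednK ?(leq_ltn_trans _ kN)// => h'; apply/ltW/h'; rewrite -ltnS prednK// (leq_ltn_trans _ kN).
Unshelve. all: by end_near. Qed.

Lemma seq_set_null (J : seq R) : (@lebesgue_measure R) [set` J] = 0%E.
Proof. exact/countable_lebesgue_measure0/finite_set_countable/finite_seq. Qed.

Lemma borel_measurable_off_seq {V : normedModType R} (G : R -> V) (J : seq R) :
  (forall s, s \notin J -> {for s, continuous G}) -> borel_measurable G.
Proof.
move=> cG O oO.
rewrite (_ : G @^-1` O = (G @^-1` O `\` [set` J]) `|` (G @^-1` O `&` [set` J])); last first.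
  by rewrite -[LHS](setIT) -(setUCl [set` J]) setIUr -setDE.
apply: measurableU.
  apply: open_measurable; rewrite openE => s [Os /negP sJ].
  have n1 : nbhs s (G @^-1` O) by apply: (cG s sJ); exact: open_nbhs_nbhs.
  have n2 : nbhs s (~` [set` J]).
    apply: open_nbhs_nbhs; split; last by apply/negP.
    apply: closed_openC; apply: (accessible_finite_set_closed.1 _ _ (finite_seq J)).
    exact/hausdorff_accessible/Rhausdorff.
  by apply: filterS2 n1 n2 => r.
apply: countable_measurable => //; apply: sub_countable (finite_set_countable (finite_seq J)).
by apply: subset_card_le => x [].
Qed.

End Cutoff.

Section WeakBochner.
Context {d : measure_display} {Omega : measurableType d} {R : realType}.
Variable P : probability Omega R.
Context {V : completeNormedModType R} (ip : V -> V -> R).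
Variables (T : R) (Y : R -> Omega -> V).
Notation mu := (@lebesgue_measure R).
Hypothesis ipP : is_inner_product ip.
Hypothesis sepV : exists D : set V, countable D /\ dense D.

(** Extension by 0 outside [[0, T]] yields one map on [R * Omega] that can be jointly measurable as
    a whole, so Fubini and time shifts apply without domain conditions. *)
Definition time_restrict (p : R * Omega) : V :=
  if (0 <= p.1 <= T)%R then Y p.1 p.2 else 0.

Lemma time_restrict_measurable (F : R -> set (set Omega)) : filtration F -> 0 <= T ->
  prog_measurable F T Y -> borel_measurable time_restrict.
Proof.
move=> [_ Fm _] T0 pY O oO.
have mO : borel_sets O by exact: sub_sigma_algebra.
have := pY T _ O mO; rewrite T0 lexx => /(_ isT) h1.
have {}h1 : measurable [set p : R * Omega | 0 <= p.1 <= T /\ O (Y p.1 p.2)].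
  move: h1; apply: smallest_sub; first exact: sigma_algebra_measurable.
  by move=> _ [A [B [mA FB ->]]]; apply: measurableX => //; exact: Fm FB.
have h2 : measurable ([set p : R * Omega | 0 <= p.1 <= T]).
  rewrite (_ : [set p : R * Omega | _] = (`[0, T]%classic : set R) `*` [set: Omega]).
    exact: measurableX.
  by apply/seteqP; split => p /=; rewrite in_itv/=; [split|case].
rewrite (_ : _ @^-1` _ = [set p : R * Omega | 0 <= p.1 <= T /\ O (Y p.1 p.2)] `|`
    (~` [set p : R * Omega | 0 <= p.1 <= T] `&` (if pselect (O 0) then setT else set0))).
  apply: measurableU => //; apply: measurableI; first exact: measurableC.
  by case: (pselect (O 0)) => /= _; [exact: measurableT|exact: measurable0].
apply/seteqP; split => p; rewrite /time_restrict/=.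
  case: ifP => h Op; first by left.
  by right; split => //; case: (pselect (O 0)).
move=> [[-> //]|[/negP/negbTE ->]].
by case: (pselect (O 0)).
Qed.

Hypothesis mY : borel_measurable time_restrict.

Lemma measurable_ip_pair {d' : measure_display} {T' : measurableType d'} (f g : T' -> V) :
  borel_measurable f -> borel_measurable g -> measurable_fun setT (fun t => ip (f t) (g t)).
Proof.
move=> mf mg; have [D [cD dD]] := sepV.
exact: (borel_measurable_pair f g (fun p => ip p.1 p.2) D cD dD mf mg (continuous_ip ip ipP)).
Qed.

Lemma borel_measurable_cst {d' : measure_display} {T' : measurableType d'} (x : V) :
  borel_measurable (fun _ : T' => x).
Proof.
move=> O _; have [Ox|Ox] := pselect (O x).
  by rewrite (_ : _ @^-1` _ = setT)//; apply/seteqP; split.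
by rewrite (_ : _ @^-1` _ = set0)//; apply/seteqP; split.
Qed.

Lemma borel_measurable_time t : 0 <= t <= T -> borel_measurable (Y t).
Proof.
move=> tT O oO.
have := measurable_xsection t (mY O oO); rewrite (_ : xsection _ _ = Y t @^-1` O)//.
by apply/seteqP; split => om; rewrite /xsection/= inE/= /time_restrict/= tT.
Qed.

Lemma measurable_ip_time (G : R -> V) : borel_measurable G ->
  measurable_fun setT (fun p : R * Omega => ip (time_restrict p) (G p.1)).
Proof.
move=> mG; apply: measurable_ip_pair => // O oO.
rewrite (_ : _ @^-1` _ = (G @^-1` O) `*` setT); last first.
  by apply/seteqP; split => p /=; [split|case].
by apply: measurableX => //; exact: mG.
Qed.

Lemma measurable_weak_integral (G : R -> V) : borel_measurable G ->
  measurable_fun setT (fun om => \int[mu]_(s in `[0, T]) ip (Y s om) (G s)).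
Proof.
move=> mG; have m01 : measurable (`[0, T]%classic : set R) by [].
have := measurable_Rintegral_param _ _ m01 (measurable_ip_time G mG).
apply: eq_measurable_fun => om _; apply: eq_Rintegral => s; rewrite inE/= in_itv/= => sT.
by rewrite /time_restrict/= sT.
Qed.

Lemma measurable_gt_norm (X : Omega -> R) (e : R) : measurable_fun setT X ->
  measurable [set om | e < `|X om|].
Proof.
move=> mX; rewrite -[X in measurable X]setTI.
by apply: measurable_fun_ltr => //; exact: measurableT_comp.
Qed.

Hypothesis wbr : weakly_bochner_regular P ip T Y.

Definition weak_integral_gt (e : R) (G : R -> V) : set Omega :=
  [set om | e < `|\int[mu]_(s in `[0, T]) ip (Y s om) (G s)|].

(** The test functions to come vary with the grid and its shift, so the sequential property is
    turned into a bound uniform over all small [g]; a failure at every level [1/(k+1)] would produce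
    a sequence contradicting it. *)
Lemma wbr_small (e c : R) : 0 < e -> 0 < c -> exists2 eta, 0 < eta &
  forall g : R -> V, {within `[0, T], continuous g} ->
    (forall s, 0 <= s <= T -> `|g s| <= eta) ->
    (P (weak_integral_gt e g) <= c%:E)%E.
Proof.
move=> e0 c0; apply: contrapT => H.
have seqE (k : nat) : exists g : R -> V, [/\ {within `[0, T], continuous g},
    (forall s, 0 <= s <= T -> `|g s| <= k.+1%:R^-1) &
    ~ (P (weak_integral_gt e g) <= c%:E)%E].
  apply: contrapT => H'; apply: H; exists k.+1%:R^-1; first by rewrite invr_gt0.
  by move=> g cg gk; apply: contrapT => hP; apply: H'; exists g.
have [g hg] := choice seqE.
have g1 k : {within `[0, T], continuous (g k)} by case: (hg k).
have g2 (r : R) : 0 < r -> \forall k \near \oo, forall s, 0 <= s <= T -> `|g k s| <= r.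
  move=> r0; have := near_infty_natSinv_lt (PosNum r0); apply: filterS => k /= kr s sT.
  by case: (hg k) => _ /(_ s sT) h _; rewrite (le_trans h)// ltW.
have /(_ e e0)/cvge0_near_le := wbr.2 g g1 g2.
move=> /(_ (fun=> measure_ge0 _ _) c c0)[k _ /(_ k (leqnn k))] hk.
case: (hg k) => _ _; apply.
by move: hk; under eq_set do rewrite subr0.
Qed.

(** Multiplication by [cutoff] makes [G] continuous without increasing its norm, and dominated
    convergence recovers [G] since [J] is null. Integrability of the pairing is a hypothesis because
    regularity grants it only for continuous test functions. *)
Lemma wbr_piecewise (e c : R) : 0 < e -> 0 < c -> exists2 eta, 0 < eta &
  forall (G : R -> V) (J : seq R), (forall s, s \notin J -> {for s, continuous G}) ->
    (forall s, `|G s| <= eta) ->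
    {ae P, forall om, mu.-integrable `[0, T] (fun s => (ip (Y s om) (G s))%:E)} ->
    (P (weak_integral_gt e G) <= c%:E)%E.
Proof.
move=> e0 c0; have e2 : 0 < e / 2 by rewrite divr_gt0.
have c2 : 0 < c / 2 by rewrite divr_gt0.
have [eta eta0 heta] := wbr_small _ _ e2 c2.
exists eta => // G J cG Geta aeint.
pose Gk k s := cutoff J k s *: G s.
have nG k s : `|Gk k s| <= cutoff J k s * eta.
  have /andP[c0' _] := cutoff_bounds J k s.
  by rewrite normrZ ger0_norm// ler_wpM2l.
have cGk k : continuous (Gk k).
  move=> s; have [sJ|sJ] := boolP (s \in J); last first.
    by apply: cvgZ; [exact: cutoff_continuous|exact: cG].
  (* At a point of [J] the product tends to 0 because [G] is bounded and the cutoff vanishes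
     there. *)
  have G0 : Gk k s = 0 by rewrite /Gk cutoff_mem// scale0r.
  rewrite /continuous_at G0; apply/cvgr0Pnorm_le => r r0.
  have re : 0 < r / eta by rewrite divr_gt0.
  have : cutoff J k x @[x --> s] --> 0.
    by rewrite -(cutoff_mem J k s sJ); exact: cutoff_continuous.
  move/cvgr0_norm_le => /(_ _ re); apply: filterS => x.
  have /andP[c0' _] := cutoff_bounds J k x.
  by rewrite ger0_norm// ler_pdivlMr//; exact/le_trans/nG.
have mG : borel_measurable G by exact: borel_measurable_off_seq cG.
have mGk k : borel_measurable (Gk k).
  by apply: (borel_measurable_off_seq _ [::]) => s _; exact: cGk.
pose X om := \int[mu]_(s in `[0, T]) ip (Y s om) (G s).
pose Xk k om := \int[mu]_(s in `[0, T]) ip (Y s om) (Gk k s).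
have mX : measurable_fun setT X by exact: measurable_weak_integral.
have mXk k : measurable_fun setT (Xk k) by exact: measurable_weak_integral.
have aecvg : {ae P, forall om, Xk k om @[k --> \oo] --> X om}.
  apply: filterS aeint => om iG.
  have mf : measurable_fun `[0, T] (fun s => ip (Y s om) (G s)).
    by case/integrableP : iG => /measurable_EFinP.
  have mc k : measurable_fun `[0, T] (cutoff J k).
    by apply: measurable_funTS; apply: continuous_measurable_fun; exact: cutoff_continuous.
  pose I : set R := `[0, T]%classic.
  have [i1 _ H] : [/\ mu.-integrable I (fun s => (ip (Y s om) (G s))%:E),
     [sequence \int[mu]_(s in I) `|(ip (Y s om) (Gk k s))%:E - (ip (Y s om) (G s))%:E|]_k @ \oo --> 0 &
     [sequence \int[mu]_(s in I) (ip (Y s om) (Gk k s))%:E]_k @ \oo -->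
       \int[mu]_(s in I) (ip (Y s om) (G s))%:E]%E.
    apply: (@dominated_convergence _ _ _ mu _ _ (fun k s => (ip (Y s om) (Gk k s))%:E)
      (fun s => (ip (Y s om) (G s))%:E) (fun s => `|ip (Y s om) (G s)|%:E)) => //.
    - exact: measurable_itv.
    - move=> k; apply/measurable_EFinP.
      rewrite (_ : (fun s => _) = (fun s => cutoff J k s * ip (Y s om) (G s))).
        by apply: measurable_funM; [exact: mc|exact: mf].
      by apply/funext => s; rewrite (ipZr _ ipP).
    - by apply/measurable_EFinP.
    - exists [set` J]; split; [exact/countable_measurable/finite_set_countable/finite_seq|exact: seq_set_null|].
      move=> s /= hs; apply: contrapT => sJ; apply: hs => _.
      apply: cvg_near_cst; have := @cutoff_near _ J s (introN idP sJ).
      by apply: filterS => k; rewrite /Gk => ->; rewrite scale1r.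
    - by move: (integrable_abse iG); apply: eq_integrable => // s _.
    - apply: aeW => s k _; rewrite lee_fin /Gk (ipZr _ ipP) normrM.
      have /andP[c0' c1'] := cutoff_bounds J k s.
      by rewrite ger0_norm// ler_piMl.
  have hfin : (\int[mu]_(s in I) (ip (Y s om) (G s))%:E)%E \is a fin_num.
    by apply: integrable_fin_num => //; exact: measurable_itv.
  by move: H; rewrite -[X in _ --> X](fineK hfin) => /fine_cvg.
have : P (setT `&` [set om | e / 2 < `|X om - Xk k om|]) @[k --> \oo] --> 0%E.
  apply: measure_setI_cvg0 => //.
  - by rewrite (le_lt_trans (probability_le1 _ _))// ltry.
  - by move=> k; apply: measurable_gt_norm; exact: measurable_funB.
  - apply: filterS aecvg => om /cvgrPdist_le/(_ _ e2) + _; apply: filterS => k hk.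
    by apply/negP; rewrite -leNgt.
move=> /cvge0_near_le => /(_ (fun=> measure_ge0 _ _) _ c2)[k _ /(_ k (leqnn k))].
rewrite setTI => hk.
have hk2 := heta (Gk k) (continuous_subspaceT (cGk k)).
have {}hk2 : (P (weak_integral_gt (e / 2) (Gk k)) <= (c / 2)%:E)%E.
  apply: hk2 => s _; rewrite (le_trans (nG _ _))//.
  have /andP[c0' c1'] := cutoff_bounds J k s.
  by rewrite ler_piMl// ltW.
rewrite (splitr c) EFinD; apply: le_trans (leeD hk hk2).
have m1 : measurable [set om | e / 2 < `|X om - Xk k om|].
  by apply: measurable_gt_norm; exact: measurable_funB.
have m2 : measurable (weak_integral_gt (e / 2) (Gk k)).
  exact: (measurable_gt_norm (Xk k)).
apply: le_trans (measureU2 P m1 m2).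
apply: le_measure; rewrite ?inE.
- exact: (measurable_gt_norm X).
- exact: measurableU.
move=> om /= he; have [h1|h1] := ltP (e / 2) `|X om - Xk k om|; [by left|right].
have : `|X om| <= `|X om - Xk k om| + `|Xk k om|.
  by rewrite -{1}(subrK (Xk k om) (X om)) ler_normD.
have he' : e < `|X om| := he.
rewrite /weak_integral_gt/= -/(Xk k om); lra.
Qed.

End WeakBochner.

(** * Testing the weak equation on a grid *)

Lemma ae_conj {d : measure_display} {Omega : measurableType d} {R : realType}
  (mu : {measure set Omega -> \bar R}) (Q1 Q2 : Omega -> Prop) :
  {ae mu, forall om, Q1 om} -> {ae mu, forall om, Q2 om} ->
  {ae mu, forall om, Q1 om /\ Q2 om}.
Proof. exact: filterI. Qed.

Section Solution.
Context {d : measure_display} {Omega : measurableType d} {R : realType}.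
Variable P : probability Omega R.
Context {U : normedModType R} {V : completeNormedModType R} (ip : V -> V -> R).
Variables (S : R -> V -> V) (DA : set V) (A : V -> V) (Bs : V -> U) (y0 : V)
  (L : R -> U -> Omega -> R) (T : R) (Y : R -> Omega -> V).
Notation mu := (@lebesgue_measure R).
Notation adjS := (adj_sgroup ip S).
Hypothesis ipP : is_inner_product ip.
Hypothesis sepV : exists D : set V, countable D /\ dense D.
Hypothesis SP : C0_semigroup S.
Hypothesis genA : generates DA A S.
Hypothesis mL : forall t u, measurable_fun setT (L t u).
Hypothesis mY : borel_measurable (time_restrict T Y).
Hypothesis wbr : weakly_bochner_regular P ip T Y.
Hypothesis weq : forall v w : V, (forall u, DA u -> ip (A u) v = ip u w) ->
  forall t, 0 <= t <= T -> {ae P, forall om,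
    (ip (Y t om) v)%:E = ((ip y0 v)%:E + \int[mu]_(s in `[0%R, t]) (ip (Y s om) w)%:E
      + (L t (Bs v) om)%:E)%E}.

Definition wintegrable (om : Omega) (g : R -> V) : Prop :=
  mu.-integrable `[0, T] (fun s => (ip (Y s om) (g s))%:E).

Definition wint (om : Omega) (g : R -> V) : R :=
  \int[mu]_(s in `[0, T]) ip (Y s om) (g s).

Lemma wintegrableD om f g : wintegrable om f -> wintegrable om g ->
  wintegrable om (fun s => f s + g s).
Proof.
move=> hf hg; have m : measurable (`[0, T]%classic : set (measurableTypeR R)) by [].
move: (integrableD m hf hg); apply: eq_integrable => // s _.
by rewrite /= (ipDr _ ipP) EFinD.
Qed.

Lemma wintegrableZ om k f : wintegrable om f -> wintegrable om (fun s => k *: f s).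
Proof.
move=> hf; have m : measurable (`[0, T]%classic : set (measurableTypeR R)) by [].
move: (integrableZl m k hf); apply: eq_integrable => // s _.
by rewrite /= (ipZr _ ipP) EFinM.
Qed.

Lemma wintegrableN om f : wintegrable om f -> wintegrable om (fun s => - f s).
Proof. by move/(wintegrableZ om (-1)); under eq_fun do rewrite scaleN1r. Qed.

Lemma wintegrable_sum om (f : nat -> R -> V) n : (forall j, (j < n)%N -> wintegrable om (f j)) ->
  wintegrable om (fun s => \sum_(j < n) f j s).
Proof.
elim: n => [_|n IH h].
  have m : measurable (`[0, T]%classic : set (measurableTypeR R)) by [].
  have := integrable0 mu (`[0, T]%classic : set (measurableTypeR R)).
  by apply: eq_integrable => // s _; rewrite /= big_ord0 (ip0r _ ipP).
rewrite (_ : (fun s => _) = fun s => \sum_(j < n) f j s + f n s); last first.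
  by apply/funext => s; rewrite big_ord_recr.
apply: wintegrableD; [|exact: h].
by apply: IH => j jn; apply: h; exact: ltnW.
Qed.

Lemma wintD om f g : wintegrable om f -> wintegrable om g ->
  wint om (fun s => f s + g s) = wint om f + wint om g.
Proof.
move=> hf hg; rewrite -RintegralD//; apply: eq_Rintegral => s _.
by rewrite (ipDr _ ipP).
Qed.

Lemma wintZ om k f : wintegrable om f -> wint om (fun s => k *: f s) = k * wint om f.
Proof.
move=> hf; rewrite -RintegralZl//; apply: eq_Rintegral => s _.
by rewrite (ipZr _ ipP).
Qed.

Lemma wintN om f : wintegrable om f -> wint om (fun s => - f s) = - wint om f.
Proof.
by move=> hf; rewrite -mulN1r -wintZ//; under [in RHS]eq_fun do rewrite scaleN1r.
Qed.

Lemma wint_sum om (f : nat -> R -> V) n : (forall j, (j < n)%N -> wintegrable om (f j)) ->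
  wint om (fun s => \sum_(j < n) f j s) = \sum_(j < n) wint om (f j).
Proof.
elim: n => [_|n IH h].
  rewrite big_ord0 /wint; under eq_Rintegral do rewrite big_ord0 (ip0r _ ipP).
  by rewrite Rintegral_cst// mul0r.
rewrite (_ : (fun s => _) = fun s => \sum_(j < n) f j s + f n s); last first.
  by apply/funext => s; rewrite big_ord_recr.
have h' j : (j < n)%N -> wintegrable om (f j) by move=> jn; apply: h; exact: ltnW.
rewrite wintD; [|exact: wintegrable_sum|exact: h].
by rewrite IH// big_ord_recr.
Qed.

Definition window (a b : R) (g : R -> V) (r : R) : V := if a <= r <= b then g r else 0.

Lemma ip_window a b (g : R -> V) r y :
  ip y (window a b g r) = ((fun r => ip y (g r)) \_ (`[a, b]%classic : set R)) r.
Proof.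
rewrite patchE /window; have -> : (r \in (`[a, b]%classic : set R)) = (a <= r <= b).
  by apply/idP/idP; rewrite inE/= in_itv.
by case: ifP => _ //; rewrite (ip0r _ ipP).
Qed.

Lemma wintegrable_window om a b g : wintegrable om g -> wintegrable om (window a b g).
Proof.
move=> hg; have m : measurable (`[0, T]%classic : set (measurableTypeR R)) by [].
have hm : measurable_fun (`[0, T]%classic : set (measurableTypeR R)) (fun s => ip (Y s om) (g s)).
  by case/integrableP : hg => /measurable_EFinP.
apply: (le_integrable m _ _ hg).
  apply/measurable_EFinP.
  rewrite (_ : (fun s => _) = (fun r => ip (Y r om) (g r)) \_ (`[a, b]%classic : set R)).
    apply/measurable_restrict => //; by apply: measurable_funS hm => // s [].
  by apply/funext => s; rewrite ip_window !patchE.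
move=> s _; rewrite lee_fin /window; case: ifP => // _.
by rewrite (ip0r _ ipP) normr0.
Qed.

Lemma wint_window om a b g : 0 <= a -> b <= T ->
  wint om (window a b g) = \int[mu]_(s in `[a, b]) ip (Y s om) (g s).
Proof.
move=> a0 bT; rewrite /wint.
transitivity (\int[mu]_(s in `[0, T]) ((fun s => ip (Y s om) (g s)) \_ (`[a, b]%classic : set R)) s).
  by apply: eq_Rintegral => s _; rewrite ip_window !patchE.
rewrite -Rintegral_mkcondr; congr (Rintegral _ _ _).
rewrite setIC; apply/setIidl => s /=; rewrite !in_itv/= => /andP[sa sb].
by rewrite (le_trans a0)// (le_trans sb).
Qed.

Lemma wintegrable_continuous g : continuous g -> {ae P, forall om, wintegrable om g}.
Proof. by move=> cg; apply: wbr.1; exact: continuous_subspaceT. Qed.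

(** Difference of the equations at [b] and [a]. A constant test function in weak Bochner regularity
    makes the drift integrals finite, so the extended-real identities may be subtracted. *)
Lemma weak_increment v w a b : adj_gen ip S v w -> 0 <= a -> a <= b -> b <= T ->
  {ae P, forall om, wintegrable om (fun=> w) /\
    ip (Y b om) v - ip (Y a om) v =
    wint om (window a b (fun=> w)) + (L b (Bs v) om - L a (Bs v) om)}.
Proof.
move=> vw a0 ab bT.
have adj := adj_gen_adjoint ip S ipP SP DA A v w genA vw.
have ha := weq v w adj a; have hb := weq v w adj b.
have {}ha := ha (ltac:(by rewrite a0 (le_trans ab))).
have {}hb := hb (ltac:(by rewrite (le_trans a0))).
have hi : {ae P, forall om, wintegrable om (fun=> w)}.
  by apply: wintegrable_continuous => s; exact: cvg_cst.
apply: filterS (ae_conj _ _ _ ha (ae_conj _ _ _ hb hi)) => om {ha hb hi} [ha [hb hi]].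
split => //.
have int (c : R) : c <= T -> mu.-integrable `[0, c] (EFin \o (fun s => ip (Y s om) w)).
  move=> cT; apply: (integrableS _ _ _ hi) => //.
  by move=> s /=; rewrite !in_itv/= => /andP[-> sc]; rewrite (le_trans sc).
have fin (c : R) : c <= T -> (\int[mu]_(s in `[0%R, c]) (ip (Y s om) w)%:E)%E =
    (\int[mu]_(s in `[0, c]) ip (Y s om) w)%:E.
  move=> cT; rewrite fineK//; apply: integrable_fin_num => //; exact: int.
move: ha hb; rewrite !fin// ?(le_trans ab)// -!EFinD => -[->] [->].
rewrite wint_window//.
have E : \int[mu]_(s in `[0, b]) ip (Y s om) w - \int[mu]_(s in `[0, a]) ip (Y s om) w =
    \int[mu]_(s in `[a, b]) ip (Y s om) w.
  rewrite (@Rintegral_itvB _ _ (BLeft 0) (BRight b) a)//; last exact: int.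
  rewrite Rintegral_itv_obnd_cbnd//.
  apply: (integrableS _ _ _ (int b bT)) => //.
  by move=> s /=; rewrite !in_itv/= => /andP[sa ->]; rewrite (le_trans a0 (ltW sa)).
rewrite -E; ring.
Qed.

Definition node (h : R) (n : nat) (theta : R) (j : nat) : R := h / n.+1%:R * (j%:R + theta).

(** Clamping on both sides extends the adjoint orbit, run backwards over [[0, h]], to a path on all
    of [R]; it is continuous when [w] has a generator image, and then admissible as a test
    function. *)
Definition test_path (h : R) (w : V) (r : R) : V := adjS (Num.max 0 (Num.min h (h - r))) w.

(* Summing the weak equation tested with v at time a + h and, with weights h / n.+1, with
   S*(h - q) w1 at the times a + q, q a node, where w1 = A* v and w2 = A* w1, writes
   <Y(a+h) - S(h) Y(a), v> as levy_sum, plus <Y(a), boundary>, plus the integral of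
   <Y, error_path>, plus the error of a Riemann sum. *)
Definition levy_sum (h : R) (n : nat) (theta : R) (v w1 : V) (a : R) (om : Omega) : R :=
  (L (a + h) (Bs v) om - L a (Bs v) om) +
  \sum_(j < n.+1) h / n.+1%:R *
    (L (a + node h n theta j) (Bs (adjS (h - node h n theta j) w1)) om
     - L a (Bs (adjS (h - node h n theta j) w1)) om).

Definition boundary (h : R) (n : nat) (theta : R) (v w1 : V) : V :=
  v - adjS h v + \sum_(j < n.+1) h / n.+1%:R *: adjS (h - node h n theta j) w1.

Definition error_path (h : R) (n : nat) (theta : R) (w1 w2 : V) (a : R) : R -> V :=
  window a (a + h) (fun s => w1 + \sum_(j < n.+1) h / n.+1%:R *:
    (if s - a <= node h n theta j then adjS (h - node h n theta j) w2 else 0)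
    - adjS (h - (s - a)) w1).

(** Time is counted from [a], and [time_restrict] makes the function measurable on the whole
    product, as the choice of a grid by Fubini requires. *)
Definition shifted_ip (h : R) (w : V) (a : R) (p : R * Omega) : R :=
  ip (time_restrict T Y (a + p.1, p.2)) (test_path h w p.1).

Lemma test_pathE h w r : 0 <= r <= h -> test_path h w r = adjS (h - r) w.
Proof.
move=> /andP[r0 rh]; rewrite /test_path min_r; last by rewrite gerBl.
by rewrite max_r// subr_ge0.
Qed.

Lemma test_path_continuous h w w' : 0 <= h -> adj_gen ip S w w' -> continuous (test_path h w).
Proof.
move=> h0 ww'; have [M M1 hM] := sgroup_bounded _ SP h.
have M0 : 0 <= M by rewrite (le_trans ler01).
pose cl (r : R) := Num.max 0 (Num.min h (h - r)).
have clh r : 0 <= cl r <= h.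
  by rewrite /cl le_max lexx/= ge_max h0 ge_min lexx.
have cl1 r x : `|cl r - cl x| <= `|r - x|.
  wlog rx : r x / r <= x.
    by move=> H; have [|/ltW] := leP r x; [exact: H|rewrite distrC (distrC r); exact: H].
  rewrite [leRHS]distrC (ger0_norm (_ : 0 <= x - r)) ?subr_ge0//.
  rewrite ler_norml /cl; move: h0 rx; rewrite /Num.max /Num.min.
  by repeat case: ifPn; rewrite -?leNgt => *; apply/andP; split; lra.
move=> x; apply/cvgrPdist_le => e e0.
have K0 : 0 < M * `|w'| + 1 by rewrite ltr_wpDl// mulr_ge0.
near=> r.
rewrite (le_trans (adj_gen_lipschitz _ _ ipP SP h M w w' (cl r) (cl x) hM M0 ww' (clh _) (clh _)))//.
rewrite (@le_trans _ _ ((M * `|w'| + 1) * `|x - r|))//.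
  by rewrite ler_pM ?mulr_ge0// lerDl.
rewrite -ler_pdivlMl// mulrC; near: r; apply: cvgr_dist_le; [exact: cvg_id|exact: divr_gt0].
Unshelve. all: by end_near. Qed.

Lemma shifted_ip_measurable h w w' a : 0 <= h -> adj_gen ip S w w' ->
  measurable_fun setT (shifted_ip h w a).
Proof.
move=> h0 ww'; apply: (measurable_ip_pair ip ipP sepV).
- move=> O oO; pose sh (p : R * Omega) := (a + p.1, p.2).
  have msh : measurable_fun setT sh.
    by apply: measurable_fun_pair => //; apply: measurable_funD.
  rewrite -[X in measurable X]setTI.
  exact: (msh measurableT _ (mY O oO)).
- move=> O oO; rewrite (_ : _ @^-1` _ = (test_path h w @^-1` O) `*` setT); last first.
    by apply/seteqP; split => p /=; [split|case].
  apply: measurableX => //.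
  apply: (borel_measurable_off_seq (test_path h w) [::]) => // s _.
  exact: (test_path_continuous _ _ _ h0 ww').
Qed.

Lemma node_bounds h n theta (j : nat) : 0 < h -> 0 <= theta < 1 -> (j < n.+1)%N ->
  0 <= node h n theta j <= h.
Proof.
move=> h0 /andP[t0 t1] jn; rewrite /node mulr_ge0 ?divr_ge0 ?addr_ge0 ?(ltW h0)//=.
rewrite mulrAC ler_pdivrMr// ler_pM2l//.
have : (j.+1%:R : R) <= n.+1%:R by rewrite ler_nat.
rewrite -natr1; lra.
Qed.

(** As a sum of windows the path is integrable against [Y] and continuous off the window ends, term
    by term; the defining form is the one that shows the cancellation behind its small norm. *)
Lemma error_pathE h n theta w1 w2 a : 0 < h -> 0 <= theta < 1 ->
  error_path h n theta w1 w2 a = fun s => window a (a + h) (fun=> w1) s +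
    \sum_(j < n.+1) h / n.+1%:R *:
      window a (a + node h n theta j) (fun=> adjS (h - node h n theta j) w2) s
    + - window a (a + h) (fun s => test_path h w1 (s - a)) s.
Proof.
move=> h0 th; apply/funext => s; rewrite /error_path /window.
case: ifPn => [/andP[as_ sh]|sah].
  rewrite test_pathE; last by rewrite subr_ge0 as_/= lerBlDl.
  congr (_ + _ - _); apply: eq_bigr => j _; congr (_ *: _).
  by rewrite lerBlDl as_.
rewrite subr0 add0r big1// => j _.
case: ifPn => [/andP[as_ sj]|]; last by rewrite scaler0.
have /andP[_ nh] := node_bounds h n theta j h0 th (ltn_ord j).
by move: sah; rewrite as_ (le_trans sj)// lerD2l.
Qed.

Lemma wint_shift om h w w' a : 0 <= h -> adj_gen ip S w w' -> 0 <= a -> a + h <= T ->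
  wintegrable om (fun s => test_path h w (s - a)) ->
  mu.-integrable `[0, h] (fun r => (shifted_ip h w a (r, om))%:E) /\
  wint om (window a (a + h) (fun s => test_path h w (s - a))) =
    \int[mu]_(r in `[0, h]) shifted_ip h w a (r, om).
Proof.
move=> h0 ww' a0 ahT hi.
have m : measurable (`[a, a + h]%classic : set (measurableTypeR R)) by [].
have pre : (fun z => (z + a)%R) @^-1` `[a, a + h] = `[0, h]%classic :> set R.
  by apply/seteqP; split => z /=; rewrite !in_itv/= lerDr addrC lerD2l.
pose f s := ip (Y s om) (test_path h w (s - a)).
have fi : mu.-integrable `[a, a + h] (EFin \o f).
  apply: (integrableS _ _ _ hi) => // s /=; rewrite !in_itv/= => /andP[sa sb].
  by rewrite (le_trans a0)// (le_trans sb).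
have mf : measurable_fun (`[a, a + h]%classic : set (measurableTypeR R)) (EFin \o f).
  by case/integrableP : fi.
have fE r : r \in (`[0, h]%classic : set R) -> f (r + a) = shifted_ip h w a (r, om).
  rewrite inE/= in_itv/= => /andP[r0 rh].
  by rewrite /f /shifted_ip /time_restrict/= addrK addr_ge0//= (le_trans _ ahT) ?lerD2l// addrC.
split; last first.
  rewrite wint_window// /Rintegral; congr fine.
  rewrite (integral_shift a (EFin \o f))// pre; apply: eq_integral => r r0.
  by rewrite /= fE.
apply/integrableP; split.
  apply/measurable_EFinP; apply: measurable_funTS.
  apply: (measurableT_comp (shifted_ip_measurable _ _ _ a h0 ww')).
  exact: measurable_fun_pair.
have /integrableP[_] := fi.
rewrite (@ge0_integral_affine _ 1 a)//; last exact: measurableT_comp.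
rewrite mul1e; apply: le_lt_trans; rewrite le_eqVlt; apply/orP; left; apply/eqP.
under [in RHS]eq_fun do rewrite mul1r.
rewrite pre; apply: eq_integral => r r0.
by rewrite mul1r [(EFin \o f) _]/= fE.
Qed.

(** A discrete Duhamel formula. Adding and subtracting the integral of [shifted_ip] separates the
    drift mismatch, whose test path is small in norm, from the replacement of that integral by its
    Riemann sum, which depends on the pathwise behaviour of [Y]. *)
Lemma weak_equation_decomposition h n theta v w1 w2 w3 a : 0 < h -> 0 <= theta < 1 -> 0 <= a -> a + h <= T ->
  adj_gen3 ip S v w1 w2 w3 ->
  {ae P, forall om, wintegrable om (error_path h n theta w1 w2 a) /\
    (mu.-integrable `[0, h] (fun r => (shifted_ip h w1 a (r, om))%:E) /\
    ip (Y (a + h) om - S h (Y a om)) v - levy_sum h n theta v w1 a om =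
    ip (Y a om) (boundary h n theta v w1) + wint om (error_path h n theta w1 w2 a)
    + (\int[mu]_(r in `[0, h]) shifted_ip h w1 a (r, om)
       - Riemann_sum (fun r => shifted_ip h w1 a (r, om)) h n theta))}.
Proof.
move=> h0 th a0 ahT [vw1 w12 w23].
have nb j := node_bounds h n theta j h0 th.
pose x j := adjS (h - node h n theta j) w1.
pose x' j := adjS (h - node h n theta j) w2.
have xx' j : (j < n.+1)%N -> adj_gen ip S (x j) (x' j).
  move=> jn; apply: (adj_gen_adj_sgroup _ _ ipP SP) => //.
  by rewrite subr_ge0; case/andP: (nb j jn).
have H1 := weak_increment v w1 a (a + h) vw1 a0 (ltac:(by rewrite lerDl ltW)) ahT.
have H2 : {ae P, forall om, forall j, (j < n.+1)%N -> wintegrable om (fun=> x' j) /\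
    ip (Y (a + node h n theta j) om) (x j) - ip (Y a om) (x j) =
    wint om (window a (a + node h n theta j) (fun=> x' j)) +
    (L (a + node h n theta j) (Bs (x j)) om - L a (Bs (x j)) om)}.
  have E (j : nat) : {ae P, forall om, (j < n.+1)%N -> wintegrable om (fun=> x' j) /\
    ip (Y (a + node h n theta j) om) (x j) - ip (Y a om) (x j) =
    wint om (window a (a + node h n theta j) (fun=> x' j)) +
    (L (a + node h n theta j) (Bs (x j)) om - L a (Bs (x j)) om)}.
    have [jn|jn] := ltnP j n.+1; last by apply: aeW => om.
    have /andP[n0 nh] := nb j jn.
    have := weak_increment (x j) (x' j) a (a + node h n theta j) (xx' j jn) a0.
    move=> /(_ (ltac:(by rewrite lerDl)) (ltac:(by rewrite (le_trans _ ahT)// lerD2l))).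
    by apply: filterS => om.
  (* Used with the almost-everywhere filter, [near_all_lt] merges the null sets of the [n.+1]
     nodes. *)
  by apply: filterS (near_all_lt _ _ n.+1 E) => om h2 j jn; exact: h2.
have H3 : {ae P, forall om, wintegrable om (fun s => test_path h w1 (s - a))}.
  apply: wintegrable_continuous => s.
  apply: (@continuous_comp _ _ _ (fun s => s - a) (test_path h w1)).
    by apply: cvgB; [exact: cvg_id|exact: cvg_cst].
  exact: (test_path_continuous _ _ _ (ltW h0) w12).
apply: filterS (ae_conj _ _ _ H1 (ae_conj _ _ _ H2 H3)) => om {H1 H2 H3} [[i1 H1] [H2 i3]].
have [i4 E3] := wint_shift om h w1 w2 a (ltW h0) w12 a0 ahT i3.
have W1 := wintegrable_window om a (a + h) _ i1.
pose ff (j : nat) s := h / n.+1%:R *: window a (a + node h n theta j) (fun=> x' j) s.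
have W2 j : (j < n.+1)%N -> wintegrable om (ff j).
  by move=> /H2[i2 _]; apply: wintegrableZ; exact: wintegrable_window.
have W3 := wintegrable_window om a (a + h) _ i3.
have WS := wintegrable_sum om ff n.+1 W2.
have W1S := wintegrableD _ _ _ W1 WS.
have EP := error_pathE h n theta w1 w2 a h0 th; split.
  by rewrite EP; exact: (wintegrableD _ _ _ W1S (wintegrableN _ _ W3)).
split => //.
have -> : wint om (error_path h n theta w1 w2 a) = wint om (window a (a + h) (fun=> w1)) +
    \sum_(j < n.+1) wint om (ff j) - \int[mu]_(r in `[0, h]) shifted_ip h w1 a (r, om).
  rewrite EP -E3 -(wint_sum om ff n.+1 W2) -(wintD _ _ _ W1 WS) -(wintN _ _ W3).
  exact: (wintD _ _ _ W1S (wintegrableN _ _ W3)).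
have -> : \sum_(j < n.+1) wint om (ff j) =
  \sum_(j < n.+1) h / n.+1%:R * (ip (Y (a + node h n theta j) om) (x j) - ip (Y a om) (x j)
   - (L (a + node h n theta j) (Bs (x j)) om - L a (Bs (x j)) om)).
  apply: eq_bigr => j _; have [i2 ->] := H2 j (ltn_ord j).
  rewrite wintZ; last exact: wintegrable_window.
  by congr (_ * _); rewrite addrK.
have -> : wint om (window a (a + h) (fun=> w1)) =
  ip (Y (a + h) om) v - ip (Y a om) v - (L (a + h) (Bs v) om - L a (Bs v) om).
  by rewrite H1 addrK.
have -> : Riemann_sum (fun r => shifted_ip h w1 a (r, om)) h n theta =
    \sum_(j < n.+1) h / n.+1%:R * ip (Y (a + node h n theta j) om) (x j).
  rewrite /Riemann_sum mulr_sumr; apply: eq_bigr => j _; congr (_ * _).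
  have /andP[n0 nh] := nb j (ltn_ord j).
  rewrite /shifted_ip/= -/(node h n theta j) test_pathE ?n0//.
  by rewrite /time_restrict/= addr_ge0//= (le_trans _ ahT)// lerD2l.
rewrite /levy_sum /boundary (ipBl _ ipP) !(ipDr _ ipP) (ipNr _ ipP) (ip_sumr _ ipP).
rewrite (adj_sgroupE _ _ ipP SP) ?(ltW h0)//.
have -> : \sum_(j < n.+1) ip (Y a om) (h / n.+1%:R *: adjS (h - node h n theta j) w1) =
   \sum_(j < n.+1) h / n.+1%:R * ip (Y a om) (x j).
  by apply: eq_bigr => j _; rewrite (ipZr _ ipP).
have -> : \sum_(j < n.+1) h / n.+1%:R * (ip (Y (a + node h n theta j) om) (x j) -
   ip (Y a om) (x j) - (L (a + node h n theta j) (Bs (x j)) om - L a (Bs (x j)) om)) =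
  \sum_(j < n.+1) h / n.+1%:R * ip (Y (a + node h n theta j) om) (x j) -
  \sum_(j < n.+1) h / n.+1%:R * ip (Y a om) (x j) -
  \sum_(j < n.+1) h / n.+1%:R * (L (a + node h n theta j) (Bs (x j)) om - L a (Bs (x j)) om).
  by rewrite -!sumrB; apply: eq_bigr => j _; ring.
rewrite -/(x _).
set s1 := \sum_(j < _) _; set s2 := \sum_(j < _) _; set s3 := \sum_(j < _) _.
ring.
Qed.

Lemma measurable_levy_sum h n theta v w1 a : measurable_fun setT (levy_sum h n theta v w1 a).
Proof.
apply: measurable_funD; first by apply: measurable_funB; exact: mL.
apply: measurable_sum => j; apply: measurable_funM => //.
by apply: measurable_funB; exact: mL.
Qed.

Lemma boundary_norm h n theta v w1 w2 w3 M : 0 < h -> 0 <= theta < 1 -> 0 <= M ->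
  (forall q x, 0 <= q <= h -> `|S q x| <= M * `|x|) -> adj_gen3 ip S v w1 w2 w3 ->
  `|boundary h n theta v w1| <= M * `|w2| * h * (h / n.+1%:R).
Proof.
move=> h0 th M0 hM [vw1 w12 _].
exact: (adj_grid_endpoint _ _ ipP SP h M n theta h0 M0 hM th v w1 w2 vw1 w12).
Qed.

Lemma error_path_norm h n theta v w1 w2 w3 M a s : 0 < h -> 0 <= theta < 1 -> 0 <= M ->
  (forall q x, 0 <= q <= h -> `|S q x| <= M * `|x|) -> adj_gen3 ip S v w1 w2 w3 ->
  `|error_path h n theta w1 w2 a s| <= (M * `|w3| * h + 2 * M * `|w2|) * (h / n.+1%:R).
Proof.
move=> h0 th M0 hM [_ w12 w23]; rewrite /error_path /window.
case: ifPn => [/andP[as_ sh]|_]; last first.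
  by rewrite normr0 !(mulr_ge0, addr_ge0, divr_ge0)// ltW.
apply: (adj_grid_step _ _ ipP SP h M n theta h0 M0 hM th w1 w2 w3 (s - a) w12 w23).
by rewrite subr_ge0 as_ lerBlDl.
Qed.

Lemma window_continuous a b (g : R -> V) s : {for s, continuous g} -> s != a -> s != b ->
  {for s, continuous (window a b g)}.
Proof.
move=> cg sa sb.
have [/andP[as_ sb']|out] := boolP (a <= s <= b).
  have lt1 : a < s by rewrite lt_neqAle eq_sym sa.
  have lt2 : s < b by rewrite lt_neqAle sb.
  rewrite /prop_for /continuous_at {2}/window as_ sb'/=.
  apply: cvg_trans cg; apply: near_eq_cvg; near=> r; rewrite /window.
  have -> : a <= r by apply: ltW; near: r; exact: lt_nbhsr.
  by have -> : r <= b by apply: ltW; near: r; exact: lt_nbhsl.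
rewrite /prop_for /continuous_at {2}/window (negbTE out).
apply: cvg_near_cst; move: out; rewrite negb_and -!ltNge => /orP[sa'|bs].
  near=> r; rewrite /window; have -> // : (a <= r) = false.
  by apply/negbTE; rewrite -ltNge; near: r; exact: lt_nbhsl.
near=> r; rewrite /window andbC; have -> // : (r <= b) = false.
by apply/negbTE; rewrite -ltNge; near: r; exact: lt_nbhsr.
Unshelve. all: by end_near. Qed.

Lemma error_path_continuous h n theta w1 w2 a s : 0 < h -> 0 <= theta < 1 ->
  adj_gen ip S w1 w2 ->
  s \notin [:: a, a + h & [seq a + node h n theta j | j <- iota 0 n.+1]] ->
  {for s, continuous (error_path h n theta w1 w2 a)}.
Proof.
move=> h0 th w12; rewrite in_cons negb_or => /andP[sa].
rewrite in_cons negb_or => /andP[sh sn].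
rewrite (error_pathE _ _ _ _ _ _ h0 th).
have c1 : {for s, continuous (window a (a + h) (fun=> w1))}.
  by apply: window_continuous => //; exact: cvg_cst.
have c3 : {for s, continuous (window a (a + h) (fun s => test_path h w1 (s - a)))}.
  apply: window_continuous => //.
  apply: (@continuous_comp _ _ _ (fun s => s - a) (test_path h w1)).
    by apply: cvgB; [exact: cvg_id|exact: cvg_cst].
  exact: (test_path_continuous _ _ _ (ltW h0) w12).
apply: cvgB => //; apply: cvgD => //.
pose ff (j : nat) s := h / n.+1%:R *:
  window a (a + node h n theta j) (fun=> adjS (h - node h n theta j) w2) s.
have cff (j : nat) : (j < n.+1)%N -> ff j x @[x --> s] --> ff j s.
  move=> jn; apply: cvgZr; apply: window_continuous => //; first exact: cvg_cst.
  apply/negP => /eqP se; move/negP: sn; apply; rewrite se.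
  apply: (map_f (fun j : nat => a + node h n theta j)).
  by rewrite mem_iota add0n.
pose g (m : nat) x := \sum_(j < m) ff j x.
suff : forall m, (m <= n.+1)%N -> {for s, continuous (g m)} by move=> /(_ n.+1 (leqnn _)).
elim => [_|m IH mn].
  have -> : g 0%N = fun=> 0 by apply/funext => x; rewrite /g big_ord0.
  exact: cvg_cst.
have -> : g m.+1 = fun x => g m x + ff m x by apply/funext => x; rewrite /g big_ord_recr.
by apply: cvgD; [exact: IH (ltnW mn)|exact: cff].
Qed.

Lemma measurable_boundary_error h n theta v w1 w2 w3 a : 0 < h -> 0 <= theta < 1 ->
  0 <= a <= T -> adj_gen3 ip S v w1 w2 w3 ->
  measurable_fun setT (fun om => ip (Y a om) (boundary h n theta v w1)) /\
  measurable_fun setT (fun om => wint om (error_path h n theta w1 w2 a)).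
Proof.
move=> h0 th aT vw; split.
  apply: (measurable_ip_pair ip ipP sepV); first exact: (borel_measurable_time T Y mY).
  exact: borel_measurable_cst.
have mE : borel_measurable (error_path h n theta w1 w2 a).
  apply: borel_measurable_off_seq => s.
  by apply: error_path_continuous => //; case: vw.
exact: (measurable_weak_integral ip T Y ipP sepV mY).
Qed.

(** Both norm bounds are of order [1/n] and free of [theta]; this uniformity matters because [theta]
    is chosen after [n]. The boundary term is dominated by a fixed random norm times a null
    sequence, and the path term falls under [wbr_piecewise]. *)
Lemma boundary_error_small h v w1 w2 w3 a e c : 0 < h -> 0 <= a -> a + h <= T ->
  adj_gen3 ip S v w1 w2 w3 -> 0 < e -> 0 < c ->
  \forall n \near \oo, forall theta, 0 <= theta < 1 ->
    (P [set om | (e < `|ip (Y a om) (boundary h n theta v w1) +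
                   wint om (error_path h n theta w1 w2 a)|)%R] <= c%:E)%E.
Proof.
move=> h0 a0 ahT vw e0 c0.
have aT : 0 <= a <= T by rewrite a0 (le_trans _ ahT)// lerDl ltW.
have e2 : 0 < e / 2 by rewrite divr_gt0.
have c2 : 0 < c / 2 by rewrite divr_gt0.
have [M M1 hM] := sgroup_bounded _ SP h.
have M0 : 0 <= M by rewrite (le_trans ler01).
have [eta eta0 heta] := wbr_piecewise P ip T Y ipP sepV mY wbr _ _ e2 c2.
pose C1 := M * `|w2| * h * h.
pose C2 := (M * `|w3| * h + 2 * M * `|w2|) * h.
have C10 : 0 <= C1 by rewrite !mulr_ge0// ltW.
have h0w : 0 <= h := ltW h0.
have [D [cD dD]] := sepV.
have mYa : measurable_fun setT (fun om => `|Y a om|).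
  have c3 : continuous (fun p : V * V => `|p.1|).
    by move=> p; apply: cvg_norm; exact: cvg_fst.
  have := borel_measurable_time T Y mY a aT => mya.
  exact: (borel_measurable_pair (Y a) (Y a) _ D cD dD mya mya c3).
have step1 : \forall n \near \oo, (P [set om | (e / 2 < `| `|Y a om| * (C1 / n.+1%:R)|)%R] <= (c / 2)%:E)%E.
  have : (P (setT `&` [set om | (e / 2 < `| `|Y a om| * (C1 / n.+1%:R)|)%R]) @[n --> \oo] --> 0%E).
    apply: measure_setI_cvg0 => //.
    - by rewrite (le_lt_trans (probability_le1 _ _))// ltry.
    - by move=> n; apply: measurable_gt_norm; exact: measurable_funM.
    - apply: aeW => om _.
      have K0 : 0 < `|Y a om| * C1 + 1 by rewrite ltr_wpDl// mulr_ge0.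
      have := near_infty_natSinv_lt (PosNum (divr_gt0 e2 K0)).
      apply: filterS => n /= hn; apply/negP; rewrite -leNgt.
      rewrite ger0_norm ?mulr_ge0 ?invr_ge0//.
      move: (ltW hn); rewrite ler_pdivlMr// => hn'.
      rewrite mulrA mulrC (le_trans _ hn')// ler_wpM2l ?invr_ge0// lerDl//.
  move=> /cvge0_near_le => /(_ (fun=> measure_ge0 _ _) _ c2).
  by apply: filterS => n; rewrite setTI.
have step2 : \forall n \near \oo, C2 / n.+1%:R <= eta.
  have K0 : 0 < `|C2| + 1 by rewrite ltr_wpDl.
  have := near_infty_natSinv_lt (PosNum (divr_gt0 eta0 K0)).
  apply: filterS => n /= hn; move: (ltW hn); rewrite ler_pdivlMr// => hn'.
  rewrite mulrC (le_trans _ hn')// ler_wpM2l ?invr_ge0//.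
  by rewrite (le_trans (ler_norm _))// lerDl.
apply: filterS2 step1 step2 => n s1 s2 theta th.
have key := weak_equation_decomposition h n theta v w1 w2 w3 a h0 th a0 ahT vw.
have s3 := heta (error_path h n theta w1 w2 a) _
  (fun s => error_path_continuous h n theta w1 w2 a s h0 th (ltac:(by case: vw))) _ _.
have {}s2 : (P (weak_integral_gt ip T Y (e / 2) (error_path h n theta w1 w2 a)) <= (c / 2)%:E)%E.
  apply: s3.
    move=> s; rewrite (le_trans (error_path_norm _ _ _ _ _ _ _ _ _ _ h0 th M0 hM vw))//.
    by move: s2; rewrite /C2 mulrA.
  by apply: filterS key => om [].
have [mB mW] := measurable_boundary_error h n theta v w1 w2 w3 a h0 th aT vw.
have m1 : measurable [set om | e / 2 < `| `|Y a om| * (C1 / n.+1%:R)|].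
  by apply: measurable_gt_norm; exact: measurable_funM.
have m2 : measurable (weak_integral_gt ip T Y (e / 2) (error_path h n theta w1 w2 a)).
  exact: (measurable_gt_norm (fun om => wint om (error_path h n theta w1 w2 a))).
rewrite (splitr c) EFinD; apply: le_trans (leeD s1 s2).
apply: le_trans (measureU2 P m1 m2).
apply: le_measure; rewrite ?inE.
- by apply: measurable_gt_norm; exact: measurable_funD.
- exact: measurableU.
move=> om /= he.
have [h1|h1] := ltP (e / 2) `|wint om (error_path h n theta w1 w2 a)|; [by right|left].
have b1 : `|ip (Y a om) (boundary h n theta v w1)| <= `|Y a om| * (C1 / n.+1%:R).
  rewrite (le_trans (cauchy_schwarz _ ipP _ _))// ler_wpM2l//.
  rewrite (le_trans (boundary_norm _ _ _ _ _ _ _ _ h0 th M0 hM vw))//.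
  by rewrite /C1 mulrA.
have b0 : 0 <= `|Y a om| * (C1 / n.+1%:R) by rewrite mulr_ge0// divr_ge0.
rewrite (ger0_norm b0).
rewrite ltNge; apply/negP => b2; move: he; rewrite ltNge => /negP; apply.
by rewrite (le_trans (ler_normD _ _))// (splitr e) lerD// (le_trans b1).
Qed.

End Solution.

(** * Choice of a deterministic grid and invariance of the law *)

Lemma measurable_Riemann_error {d : measure_display} {Omega : measurableType d} {R : realType}
  (f : R * Omega -> R) (h : R) (n : nat) : measurable_fun setT f ->
  measurable_fun setT (fun p : R * Omega =>
    \int[@lebesgue_measure R]_(r in `[0, h]) f (r, p.2)
    - Riemann_sum (fun r => f (r, p.2)) h n p.1).
Proof.
move=> mf; have m0h : measurable (`[0, h]%classic : set R) by [].
apply: measurable_funB.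
  exact: (measurableT_comp (measurable_Rintegral_param _ _ m0h mf) measurable_snd).
apply: measurable_funM => //; apply: measurable_sum => j.
apply: (measurableT_comp mf); apply: measurable_fun_pair => //.
by apply: measurable_funM => //; exact: measurable_funD.
Qed.

(** For each path most shifts are good, but independence and stationarity concern deterministic
    times: Fubini exchanges the two and yields one [theta] for all [i < k], the union of the bad
    sets being treated as a single set. *)
Lemma exists_good_grid {d : measure_display} {Omega : measurableType d} {R : realType}
  (P : probability Omega R) (f : nat -> R * Omega -> R) (k : nat) (h e c : R) :
  (forall i, measurable_fun setT (f i)) ->
  (forall i, {ae P, forall om,
     (@lebesgue_measure R).-integrable `[0, h] (fun r => (f i (r, om))%:E)}) ->
  0 < h -> 0 < e -> 0 < c ->
  \forall n \near \oo, exists2 theta, 0 <= theta < 1 & forall i, (i < k)%N ->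
    (P [set om | (e < `|\int[@lebesgue_measure R]_(r in `[0, h]) f i (r, om)
       - Riemann_sum (fun r => f i (r, om)) h n theta|)%R] <= c%:E)%E.
Proof.
move=> mf fi h0 e0 c0.
pose mu := @lebesgue_measure R.
pose err i n (p : R * Omega) := \int[mu]_(r in `[0, h]) f i (r, p.2)
       - Riemann_sum (fun r => f i (r, p.2)) h n p.1.
have merr i n : measurable_fun setT (err i n) by exact: measurable_Riemann_error.
pose B i n := [set p : R * Omega | e < `|err i n p|].
have mB i n : measurable (B i n).
  rewrite -[B i n]setTI; apply: measurable_fun_ltr => //; exact: measurableT_comp.
pose A n := \big[setU/set0]_(i < k) B i n.
have mA n : measurable (A n) by apply: bigsetU_measurable.
pose D : set R := `[0, 1[%classic.
have mD : measurable D by exact: measurable_itv.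
have muD : mu D = 1%:E by rewrite /mu lebesgue_measure_itv/= lte_fin ltr01 oppr0 adde0.
have D0 : (0 < mu D)%E by rewrite muD lte_fin.
have D1 : (mu D < +oo)%E by rewrite muD ltry.
have path : {ae P, forall om, mu (D `&` ysection (A n) om) @[n --> \oo] --> 0%E}.
  apply: filterS (near_all_lt _ _ k fi) => om fio; apply: cvge0_le => // b b0.
  have bk : 0 < b / k.+1%:R by rewrite divr_gt0.
  have : \forall n \near \oo, forall i, (i < k)%N ->
      (mu (D `&` [set theta | (e < `|err i n (theta, om)|)%R]) <= (b / k.+1%:R)%:E)%E.
    have H i : \forall n \near \oo, (i < k)%N ->
        (mu (D `&` [set theta | (e < `|err i n (theta, om)|)%R]) <= (b / k.+1%:R)%:E)%E.
      have [ik|ik] := ltnP i k; last exact: nearW.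
      have mfi : measurable_fun setT (fun r => f i (r, om)).
        by apply: (measurableT_comp (mf i)); exact: measurable_fun_pair.
      have := Riemann_sum_cvg _ h e mfi h0 e0 (fio i ik).
      move=> /cvge0_near_le => /(_ (fun=> measure_ge0 _ _) _ bk).
      by apply: filterS => n.
    by apply: filterS (near_all_lt _ _ k H) => n hn i ik; exact: hn.
  apply: filterS => n hn.
  rewrite (_ : D `&` _ = \big[setU/set0]_(i < k) (D `&` [set theta | e < `|err i n (theta, om)|])).
    apply: le_trans (measure_bigsetU_le mu _ (b / k.+1%:R) k _ hn) _.
      move=> i; apply: measurableI => //.
      rewrite (_ : [set _ | _] = ysection (B i n) om); first by apply: measurable_ysection; exact: mB.
      by apply/seteqP; split => t; rewrite /ysection/= inE.
    rewrite lee_fin mulrCA ler_piMr ?(ltW b0)// ler_pdivrMr// mul1r ler_nat//.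
  rewrite -(bigcup_mkord k (fun i => D `&` [set theta | e < `|err i n (theta, om)|])).
  rewrite /A -(bigcup_mkord k (fun i => B i n)).
  apply/seteqP; split => t; rewrite /ysection/= inE.
    by move=> [Dt [i ik Bt]]; exists i.
  by move=> [i ik [Dt Bt]]; split => //; exists i.
have := exists_small_section P D A c mD D0 D1 mA path c0.
apply: filterS => n [theta Dt Pt]; exists theta => // i ik.
apply: le_trans Pt; apply: le_measure; rewrite ?inE.
- rewrite (_ : [set _ | _] = xsection (B i n) theta); first by apply: measurable_xsection; exact: mB.
  by apply/seteqP; split => om; rewrite /xsection/= inE.
- by apply: measurable_xsection; exact: mA.
move=> om he; rewrite /xsection/= inE /A -(bigcup_mkord k (fun i => B i n)).
by exists i.
Qed.

(** A cylindrical process need not have a law on [U], so the vectors [u i j] are gathered into one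
    finite family, whose images under [L] form a finite-dimensional Levy process. The event is then
    cylinder-measurable in its consecutive increments. *)
Lemma cylindrical_increments_law {d : measure_display} {Omega : measurableType d} {R : realType}
  (P : probability Omega R) {U : normedModType R} (L : R -> U -> Omega -> R)
  (m N : nat) (o wt : nat -> R) (u : nat -> nat -> U) (c a a' : R) :
  cylindrical_levy P L -> o 0%N = 0 -> (forall k, o k <= o k.+1) -> 0 <= a -> 0 <= a' ->
  P [set om | exists2 i : nat, (i < m)%N & c <
    \sum_(j < N) wt j * (L (a + o j.+1) (u i j) om - L a (u i j) om)] =
  P [set om | exists2 i : nat, (i < m)%N & c <
    \sum_(j < N) wt j * (L (a' + o j.+1) (u i j) om - L a' (u i j) om)].
Proof.
move=> [mL _ _ levyL] o0 olt a0 a'0.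
pose I : finType := ('I_m * 'I_N)%type.
pose ux (l : 'I_#|I|) := let q := enum_val l in u q.1 q.2.
(* The increment from [a] to [a + o j.+1] is the sum of the consecutive increments up to index
   [j]. *)
pose G (i : 'I_m) (z : 'I_N -> 'I_#|I| -> R) :=
  \sum_(j < N) wt j * \sum_(k < N | (k < j.+1)%N) z k (enum_rank (i, j)).
pose C := \bigcup_(i in [set: 'I_m]) [set z | c < G i z].
have mC : <<s @cylinders R N #|I| >> C.
  suff : @measurable _ (g_sigma_algebraType (@cylinders R N #|I|)) C by [].
  apply: fin_bigcup_measurable; first exact: finite_finset.
  move=> i _; rewrite -[X in measurable X]setTI; apply: measurable_fun_ltr => //.
  apply: measurable_sum => j; apply: measurable_funM => //.
  rewrite (_ : (fun z => _) = (fun z : g_sigma_algebraType (@cylinders R N #|I|) =>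
    \sum_(k < N) if (k < j.+1)%N then z k (enum_rank (i, j)) else 0)); last first.
    by apply/funext => z; rewrite big_mkcond.
  apply: measurable_sum => k; case: (k < j.+1)%N; last exact: measurable_cst.
  exact: cylinders_coord.
have CE b : [set om | exists2 i : nat, (i < m)%N & c <
    \sum_(j < N) wt j * (L (b + o j.+1) (u i j) om - L b (u i j) om)] =
    [set om | C (fun k l => L (b + o k.+1) (ux l) om - L (b + o k) (ux l) om)].
  have GE (i : 'I_m) om : G i (fun k l => L (b + o k.+1) (ux l) om - L (b + o k) (ux l) om) =
      \sum_(j < N) wt j * (L (b + o j.+1) (u i j) om - L b (u i j) om).
    apply: eq_bigr => j _; congr (_ * _).
    rewrite /ux enum_rankK/=.
    rewrite -(big_ord_widen N (fun k => L (b + o k.+1) (u i j) om - L (b + o k) (u i j) om))//.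
    rewrite -(big_mkord xpredT (fun k => L (b + o k.+1) (u i j) om - L (b + o k) (u i j) om)).
    by rewrite (telescope_sumr (fun k => L (b + o k) (u i j) om))// o0 addr0.
  apply/seteqP; split => om /=.
    by move=> [i im h]; exists (Ordinal im) => //=; rewrite GE.
  by move=> [i _ /=]; rewrite GE => h; exists i.
rewrite !CE; apply: (levy_increments_law P _ (fun t w l => L t (ux l) w)) => //.
by rewrite o0.
Qed.

Lemma levy_sum_law {d : measure_display} {Omega : measurableType d} {R : realType}
  (P : probability Omega R) {U : normedModType R} {V : completeNormedModType R}
  (ip : V -> V -> R) (S : R -> V -> V) (Bs : V -> U) (L : R -> U -> Omega -> R)
  (h theta c a a' : R) (n m : nat) (v w : nat -> V) :
  cylindrical_levy P L -> 0 < h -> 0 <= theta < 1 -> 0 <= a -> 0 <= a' ->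
  P [set om | exists2 i : nat, (i < m)%N & c < levy_sum ip S Bs L h n theta (v i) (w i) a om] =
  P [set om | exists2 i : nat, (i < m)%N & c < levy_sum ip S Bs L h n theta (v i) (w i) a' om].
Proof.
move=> cL h0 th a0 a'0.
(* The offsets are 0, the nodes and finally [h]; the last term has weight 1 and vector [v i], the
   others the weight of the Riemann sum. *)
pose o k := if k is j.+1 then if (j < n.+1)%N then node h n theta j else h else 0.
pose wt (j : nat) : R := if (j < n.+1)%N then h / n.+1%:R else 1.
pose u i j := Bs (if (j < n.+1)%N then adj_sgroup ip S (h - node h n theta j) (w i) else v i).
have nb j := node_bounds h n theta j h0 th.
have E b i om : levy_sum ip S Bs L h n theta (v i) (w i) b om =
    \sum_(j < n.+2) wt j * (L (b + o j.+1) (u i j) om - L b (u i j) om).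
  rewrite big_ord_recr/= /wt /u ltnn mul1r addrC; congr (_ + _).
  by apply: eq_bigr => j _; rewrite ltn_ord.
have EE b : [set om | exists2 i : nat, (i < m)%N &
      c < levy_sum ip S Bs L h n theta (v i) (w i) b om] =
    [set om | exists2 i : nat, (i < m)%N & c <
      \sum_(j < n.+2) wt j * (L (b + o j.+1) (u i j) om - L b (u i j) om)].
  by apply/seteqP; split => om [i im hi]; exists i => //; [rewrite -E|rewrite E].
rewrite !EE.
apply: cylindrical_increments_law => //.
move=> [|k] /=; first by have /andP[] := nb 0%N (ltn0Sn n).
have [kn|kn] := ltnP k.+1 n.+1.
  rewrite (ltnW kn) /node ler_wpM2l ?divr_ge0 ?(ltW h0)// lerD2r ler_nat//.
by case: ifP => // kn'; have /andP[] := nb k kn'.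
Qed.

(** * Comparison of the increments at different times *)

Section IncrementTransfer.
Context {d : measure_display} {Omega : measurableType d} {R : realType}.
Variable P : probability Omega R.
Context {U : normedModType R} {V : completeNormedModType R} (ip : V -> V -> R).
Variables (S : R -> V -> V) (DA : set V) (A : V -> V) (Bs : V -> U) (y0 : V)
  (L : R -> U -> Omega -> R) (T : R) (Y : R -> Omega -> V).
Notation mu := (@lebesgue_measure R).
Hypothesis ipP : is_inner_product ip.
Hypothesis sepV : exists D : set V, countable D /\ dense D.
Hypothesis SP : C0_semigroup S.
Hypothesis genA : generates DA A S.
Hypothesis cL : cylindrical_levy P L.
Hypothesis mY : borel_measurable (time_restrict T Y).
Hypothesis wbr : weakly_bochner_regular P ip T Y.
Hypothesis weq : forall v w : V, (forall u, DA u -> ip (A u) v = ip u w) ->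
  forall t, 0 <= t <= T -> {ae P, forall om,
    (ip (Y t om) v)%:E = ((ip y0 v)%:E + \int[mu]_(s in `[0%R, t]) (ip (Y s om) w)%:E
      + (L t (Bs v) om)%:E)%E}.

Let mL : forall t u, measurable_fun setT (L t u).
Proof. by case: cL. Qed.

Definition semigroup_increment (a h : R) (om : Omega) : V := Y (a + h) om - S h (Y a om).

Let Z := semigroup_increment.

Lemma measurable_norm_increment a h : 0 <= a -> 0 <= h -> a + h <= T ->
  measurable_fun setT (fun om => `|Z a h om|).
Proof.
move=> a0 h0 ahT; have [D [cD dD]] := sepV; have [_ cS _ _ _] := SP.
have mYa : borel_measurable (Y a).
  by apply: (borel_measurable_time T Y mY); rewrite a0 (le_trans _ ahT)// lerDl.
have mYh : borel_measurable (Y (a + h)).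
  by apply: (borel_measurable_time T Y mY); rewrite addr_ge0.
apply: (borel_measurable_pair (Y (a + h)) (Y a) (fun p => `|p.1 - S h p.2|) D) => //.
move=> p; apply: cvg_norm; apply: cvgB; first exact: cvg_fst.
by apply: continuous_comp; [exact: cvg_snd|exact: cS].
Qed.

Lemma measurable_ip_increment a h v : 0 <= a -> 0 <= h -> a + h <= T ->
  measurable_fun setT (fun om => ip (Z a h om) v).
Proof.
move=> a0 h0 ahT; have [D [cD dD]] := sepV; have [_ cS _ _ _] := SP.
have mYa : borel_measurable (Y a).
  by apply: (borel_measurable_time T Y mY); rewrite a0 (le_trans _ ahT)// lerDl.
have mYh : borel_measurable (Y (a + h)).
  by apply: (borel_measurable_time T Y mY); rewrite addr_ge0.
apply: (borel_measurable_pair (Y (a + h)) (Y a) (fun p => ip (p.1 - S h p.2) v) D) => //.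
move=> p; apply: (ip_cvg _ ipP); last exact: cvg_cst.
apply: cvgB; first exact: cvg_fst.
by apply: continuous_comp; [exact: cvg_snd|exact: cS].
Qed.

Section Chain.
Variables (v w1 w2 w3 : nat -> V) (h : R).
Hypothesis chain : forall i, adj_gen3 ip S (v i) (w1 i) (w2 i) (w3 i).
Hypothesis h0 : 0 < h.

(** One [e] pays for the boundary and path errors, small for every shift; the other pays for the
    Riemann error, which stays on the right because it is small only for a shift still to be
    chosen. *)
Lemma increment_approx a e c m : 0 <= a -> a + h <= T -> 0 < e -> 0 < c ->
  \forall n \near \oo, forall theta, 0 <= theta < 1 -> forall i, (i < m)%N ->
    (P [set om | (e + e < `|ip (Z a h om) (v i)
                            - levy_sum ip S Bs L h n theta (v i) (w1 i) a om|)%R]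
     <= c%:E + P [set om | (e < `|\int[mu]_(r in `[0, h]) shifted_ip ip S T Y h (w1 i) a (r, om)
       - Riemann_sum (fun r => shifted_ip ip S T Y h (w1 i) a (r, om)) h n theta|)%R])%E.
Proof.
move=> a0 ahT e0 c0.
have h0w := ltW h0.
have st i := boundary_error_small P ip S DA A Bs y0 L T Y ipP sepV SP genA mY wbr weq h _ _ _ _ a e c
  h0 a0 ahT (chain i) e0 c0.
apply: filterS (near_all_lt _ _ m st) => n hn theta th i im.
have key := weak_equation_decomposition P ip S DA A Bs y0 L T Y ipP sepV SP genA mY wbr weq h n theta
  _ _ _ _ a h0 th a0 ahT (chain i).
have /(_ theta th) b1 := hn i im.
have aT : 0 <= a <= T by rewrite a0 (le_trans _ ahT)// lerDl.
pose f := shifted_ip ip S T Y h (w1 i) a.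
have mf : measurable_fun setT f.
  have ch : adj_gen ip S (w1 i) (w2 i) by case: (chain i).
  exact: (shifted_ip_measurable ip S T Y ipP sepV SP mY h _ _ a h0w ch).
have [mB mW] := measurable_boundary_error ip S T Y ipP sepV SP mY h n theta _ _ _ _ a h0 th aT (chain i).
pose B1 := [set om | e < `|ip (Y a om) (boundary ip S h n theta (v i) (w1 i)) +
    wint ip T Y om (error_path ip S h n theta (w1 i) (w2 i) a)|].
pose B2 := [set om | e < `|\int[mu]_(r in `[0, h]) f (r, om)
       - Riemann_sum (fun r => f (r, om)) h n theta|].
have m1 : measurable B1 by apply: measurable_gt_norm; exact: measurable_funD.
have m2 : measurable B2.
  apply: measurable_gt_norm.
  have mp : measurable_fun setT (fun om : Omega => (theta, om)) by exact: measurable_fun_pair.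
  exact: (measurableT_comp (measurable_Riemann_error f h n mf) mp).
pose Q om := ip (Z a h om) (v i) - levy_sum ip S Bs L h n theta (v i) (w1 i) a om =
  ip (Y a om) (boundary ip S h n theta (v i) (w1 i)) +
    wint ip T Y om (error_path ip S h n theta (w1 i) (w2 i) a) +
  (\int[mu]_(r in `[0, h]) f (r, om) - Riemann_sum (fun r => f (r, om)) h n theta).
have {}key : {ae P, forall om, Q om} by apply: filterS key => om [_ []].
have [N [mN N0 sN]] := key.
apply: le_trans (leeD b1 (lexx (P B2))); apply: le_trans (measureU2 P m1 m2).
apply: (@le_trans _ _ (P (B1 `|` B2 `|` N))); last first.
  apply: le_trans (measureU2 P (measurableU _ _ m1 m2) mN) _.
  by rewrite [X in (_ + X)%E]N0 adde0.
apply: le_measure; rewrite ?inE.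
- apply: measurable_gt_norm; apply: measurable_funB; last exact: (measurable_levy_sum ip S Bs L mL).
  exact: measurable_ip_increment.
- by apply: measurableU => //; exact: measurableU.
move=> om he; have [oN|nN] := pselect (N om); [by right|left].
have E : Q om := @contrapT (Q om) (fun nk => nN (sN om nk)).
move: he; rewrite /= E.
have [hB|hB] := pselect (B1 om); first by left.
have [hB'|hB'] := pselect (B2 om); first by right.
move/negP : hB; rewrite -leNgt => hB; move/negP : hB'; rewrite -leNgt => hB'.
by rewrite ltNge (le_trans (ler_normD _ _))// lerD.
Qed.

(** Equality in law relates the same functional of the increments, so [a] and [a'] must share [n]
    and [theta]. The integrands at [a] and at [a'] are listed as one family of size [m + m]. *)
Lemma common_grid a a' e c m : 0 <= a -> a + h <= T -> 0 <= a' -> a' + h <= T ->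
  0 < e -> 0 < c -> exists n theta, [/\ 0 <= theta < 1,
  (forall i, (i < m)%N -> (P [set om | (e < `|ip (Z a h om) (v i)
                            - levy_sum ip S Bs L h n theta (v i) (w1 i) a om|)%R] <= c%:E)%E) &
  (forall i, (i < m)%N -> (P [set om | (e < `|ip (Z a' h om) (v i)
                            - levy_sum ip S Bs L h n theta (v i) (w1 i) a' om|)%R] <= c%:E)%E)].
Proof.
move=> a0 ahT a'0 a'hT e0 c0.
have e2 : 0 < e / 2 by rewrite divr_gt0.
have c2 : 0 < c / 2 by rewrite divr_gt0.
pose f i := if (i < m)%N then shifted_ip ip S T Y h (w1 i) a
            else shifted_ip ip S T Y h (w1 (i - m)%N) a'.
have ch i : adj_gen ip S (w1 i) (w2 i) by case: (chain i).
have mf i : measurable_fun setT (f i).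
  by rewrite /f; case: ifP => _; apply: (shifted_ip_measurable ip S T Y ipP sepV SP mY) (ltW h0) (ch _).
have int b i : 0 <= b -> b + h <= T -> {ae P, forall om,
     mu.-integrable `[0, h] (fun r => (shifted_ip ip S T Y h (w1 i) b (r, om))%:E)}.
  move=> b0 bhT.
  have th : 0 <= (0 : R) < 1 by rewrite lexx ltr01.
  have := weak_equation_decomposition P ip S DA A Bs y0 L T Y ipP sepV SP genA mY wbr weq h 0 0
    _ _ _ _ b h0 th b0 bhT (chain i).
  by apply: filterS => om [_ []].
have fi i : {ae P, forall om, mu.-integrable `[0, h] (fun r => (f i (r, om))%:E)}.
  by rewrite /f; case: ifP => _; exact: int.
have G := exists_good_grid P f (m + m) h (e / 2) (c / 2) mf fi h0 e2 c2.
have A1 := increment_approx a (e / 2) (c / 2) m a0 ahT e2 c2.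
have A2 := increment_approx a' (e / 2) (c / 2) m a'0 a'hT e2 c2.
have /(_ _)[n [[theta th g] [b1 b2]]] := filter_ex (filterI G (filterI A1 A2)).
exists n, theta; split => // i im.
- have := b1 theta th i im; rewrite -splitr => /le_trans; apply.
  rewrite [in leRHS](splitr c) EFinD leeD2l//.
  have := g i (ltn_addr _ im); rewrite /f im; exact.
- have := b2 theta th i im; rewrite -splitr => /le_trans; apply.
  rewrite [in leRHS](splitr c) EFinD leeD2l//.
  have := g (m + i)%N; rewrite ltn_add2l => /(_ im).
  by rewrite /f ltnNge leq_addr/= addKn.
Qed.

(** The chain passes from [Z] to [levy_sum] at [a], by equality in law to [a'], and back to [Z].
    Each replacement lowers the level by [dl], half the gap, and costs [eta / 2]; as [eta] is
    arbitrary, the grid disappears from the inequality. *)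
Lemma finite_increment_transfer a a' e e' m : 0 <= a -> a + h <= T -> 0 <= a' -> a' + h <= T ->
  e' < e ->
  (P [set om | exists2 i, (i < m)%N & (e < ip (Z a h om) (v i))%R] <=
   P [set om | exists2 i, (i < m)%N & (e' < ip (Z a' h om) (v i))%R])%E.
Proof.
move=> a0 ahT a'0 a'hT ee'.
have h0w := ltW h0.
apply/lee_addgt0Pr => eta eta0.
pose dl := (e - e') / 2.
have dl0 : 0 < dl by rewrite divr_gt0// subr_gt0.
(* A union of [m] bad events of probability at most [c] stays within [eta / 2]; [m.+1] avoids
   dividing by 0. *)
pose c := eta / 2 / m.+1%:R.
have c0 : 0 < c by rewrite !divr_gt0.
have mc : m%:R * c <= eta / 2.
  by rewrite /c mulrCA ler_piMr ?divr_ge0 ?(ltW eta0)// ler_pdivrMr// mul1r ler_nat.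
have [n [theta [th b1 b2]]] := common_grid a a' dl c m a0 ahT a'0 a'hT dl0 c0.
pose X b i om := ip (Z b h om) (v i).
pose Ls b i := levy_sum ip S Bs L h n theta (v i) (w1 i) b.
pose Bd b i := [set om | dl < `|X b i om - Ls b i om|].
have mX b i : 0 <= b -> b + h <= T -> measurable_fun setT (X b i).
  by move=> *; exact: measurable_ip_increment.
have mLs b i : measurable_fun setT (Ls b i) by exact: (measurable_levy_sum ip S Bs L mL).
have mBd b i : 0 <= b -> b + h <= T -> measurable (Bd b i).
  by move=> *; apply: measurable_gt_norm; apply: measurable_funB => //; exact: mX.
have mE (F : nat -> Omega -> R) r : (forall i, measurable_fun setT (F i)) ->
    measurable [set om | exists2 i, (i < m)%N & r < F i om].
  move=> mF; rewrite (_ : [set _ | _] = \bigcup_(i in `I_m) [set om | r < F i om]).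
    apply: bigcup_measurable => i _; rewrite -[X in measurable X]setTI.
    exact: measurable_fun_ltr.
  by apply/seteqP; split => om [i im hi]; exists i.
have mBig b : 0 <= b -> b + h <= T -> measurable (\big[setU/set0]_(i < m) Bd b i).
  by move=> b0 bhT; apply: bigsetU_measurable => i _; exact: mBd.
have big b : 0 <= b -> b + h <= T -> (forall i, (i < m)%N -> (P (Bd b i) <= c%:E)%E) ->
    (P (\big[setU/set0]_(i < m) Bd b i) <= (eta / 2)%:E)%E.
  move=> b0 bhT bb; apply: le_trans (measure_bigsetU_le P (Bd b) c m _ bb) _; last by rewrite lee_fin.
  by move=> i; exact: mBd.
have comp (F G : nat -> Omega -> R) r r' b : 0 <= b -> b + h <= T ->
    (forall i, measurable_fun setT (F i)) -> (forall i, measurable_fun setT (G i)) ->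
    (forall i, (i < m)%N -> (P (Bd b i) <= c%:E)%E) ->
    (forall i om, r < F i om -> ~ Bd b i om -> r' < G i om) ->
    (P [set om | exists2 i, (i < m)%N & (r < F i om)%R] <=
     P [set om | exists2 i, (i < m)%N & (r' < G i om)%R] + (eta / 2)%:E)%E.
  move=> b0 bhT mF mG bb FG.
  apply: le_trans (leeD (lexx _) (big b b0 bhT bb)).
  apply: le_trans (measureU2 P (mE G r' mG) (mBig b b0 bhT)).
  apply: le_measure; rewrite ?inE.
  - exact: mE.
  - by apply: measurableU; [exact: mE|exact: mBig].
  move=> om [i im hi]; have [hB|hB] := pselect (Bd b i om).
    by right; rewrite -(bigcup_mkord m (Bd b)); exists i.
  by left; exists i => //; exact: FG hi hB.
have s1 := comp (X a) (Ls a) e (e - dl) a a0 ahT (fun i => mX a i a0 ahT) (mLs a) b1.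
have s2 := comp (Ls a') (X a') (e - dl) e' a' a'0 a'hT (mLs a') (fun i => mX a' i a'0 a'hT) b2.
have lm := levy_sum_law P ip S Bs L h theta (e - dl) a a' n m v w1 cL h0 th a0 a'0.
apply: le_trans (s1 _) _.
  by move=> i om hi /negP; rewrite -leNgt ler_norml => /andP[? ?]; lra.
rewrite [in leRHS](splitr eta) EFinD addeA leeD2r// lm; apply: s2.
move=> i om hi /negP; rewrite -leNgt ler_norml => /andP[? ?].
have : e' = e - dl - dl by rewrite /dl; field.
lra.
Qed.

End Chain.

(* The increments Y (a + h) - S h (Y a) are approximated by functionals of the increments
   of L whose law does not depend on a. *)
Lemma increment_transfer : exists2 C, 0 < C & forall h a a' e, 0 <= h ->
  0 <= a -> a + h <= T -> 0 <= a' -> a' + h <= T -> 0 < e ->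
  (P [set om | (e < `|Z a h om|)%R] <= P [set om | (C * e < `|Z a' h om|)%R])%E.
Proof.
have [D [cD dD]] := sepV.
have [v [C [C0 ch vC vn]]] := norming_family ip S ipP SP D cD dD.
pose w1 i := projT1 (cid (ch i)).
pose w2 i := projT1 (cid (projT2 (cid (ch i)))).
pose w3 i := projT1 (cid (projT2 (cid (projT2 (cid (ch i)))))).
have chain i : adj_gen3 ip S (v i) (w1 i) (w2 i) (w3 i).
  exact: projT2 (cid (projT2 (cid (projT2 (cid (ch i)))))).
(* The comparison lowers the level from [e] to [e / 2], and [ip z (v n)] is at most [C] times the
   norm of [z]. *)
exists ((2 * C)^-1); first by rewrite invr_gt0 mulr_gt0.
move=> h a a' e h0 a0 ahT a'0 a'hT e0.
(* Grids have positive length; for [h = 0] the increment vanishes identically. *)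
move: (h0); rewrite le_eqVlt => /predU1P[h00|hpos].
  have [_ _ S0 _ _] := SP.
  rewrite (_ : [set om | (e < _)%R] = set0) ?measure0//.
  apply/seteqP; split => om //=.
  by rewrite /Z /semigroup_increment -h00 S0 addr0 subrr normr0 ltNge (ltW e0).
pose E m := [set om | exists2 i, (i < m)%N & e < ip (Z a h om) (v i)].
have mE m : measurable (E m).
  rewrite (_ : E m = \bigcup_(i in `I_m) [set om | e < ip (Z a h om) (v i)]).
    apply: bigcup_measurable => i _; rewrite -[X in measurable X]setTI.
    apply: measurable_fun_ltr => //; exact: measurable_ip_increment.
  by apply/seteqP; split => om [i im hi]; exists i.
have UE : [set om | e < `|Z a h om|] `<=` \bigcup_m E m.
  move=> om /= hom; have [i hi] := vn _ e (ltW e0) hom.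
  by exists i.+1 => //; exists i.
have mUE : measurable (\bigcup_m E m) by exact: bigcup_measurable.
apply: (@le_trans _ _ (P (\bigcup_m E m))).
  apply: le_measure => //; rewrite ?inE//.
  rewrite -[X in measurable X]setTI; apply: measurable_fun_ltr => //.
  exact: measurable_norm_increment.
(* The laws compare only finitely many pairings at a time; continuity from below passes to the whole
   norming family. *)
have ndE : nondecreasing_seq E.
  move=> m m' mm'; apply/subsetPset => om [i im hi]; exists i => //.
  exact: leq_trans im mm'.
have cvE : P (E m) @[m --> \oo] --> P (\bigcup_m E m) by exact: nondecreasing_cvg_mu.
rewrite -(cvg_lim _ cvE)//; apply: lime_le; first by apply/cvg_ex; eexists; exact: cvE.
apply: nearW => m.
have e2 : e / 2 < e by rewrite ltr_pdivrMr// ltr_pMr// ltr1n.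
apply: le_trans (finite_increment_transfer v w1 w2 w3 h chain hpos a a' e (e / 2) m
  a0 ahT a'0 a'hT e2) _.
have mN r : measurable [set om | r < `|Z a' h om|].
  rewrite -[X in measurable X]setTI; apply: measurable_fun_ltr => //.
  exact: measurable_norm_increment.
apply: le_measure; rewrite ?inE//.
  rewrite (_ : [set _ | _] = \bigcup_(i in `I_m) [set om | e / 2 < ip (Z a' h om) (v i)]).
    apply: bigcup_measurable => i _; rewrite -[X in measurable X]setTI.
    apply: measurable_fun_ltr => //; exact: measurable_ip_increment.
  by apply/seteqP; split => om [i im hi]; exists i.
move=> om [i im hi] /=.
rewrite invfM mulrC mulrA ltr_pdivrMr//.
rewrite (lt_le_trans hi)// mulrC (le_trans (ler_norm _))//; exact: vC.
Qed.

End IncrementTransfer.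

(** * Uniform smallness of the increments and stochastic continuity *)

Lemma uniform_increment_small {d : measure_display} {Omega : measurableType d} {R : realType}
  (P : probability Omega R) {V : completeNormedModType R} (S : R -> V -> V) (T : R)
  (Y : R -> Omega -> V) (C e c : R) :
  (exists D : set V, countable D /\ dense D) -> C0_semigroup S ->
  borel_measurable (time_restrict T Y) -> 0 < T -> 0 < C ->
  (forall h a a' e, 0 <= h -> 0 <= a -> a + h <= T -> 0 <= a' -> a' + h <= T -> 0 < e ->
    (P [set om | (e < `|semigroup_increment S Y a h om|)%R] <=
     P [set om | (C * e < `|semigroup_increment S Y a' h om|)%R])%E) ->
  0 < e -> 0 < c -> exists2 h0, 0 < h0 & forall h a, 0 <= h -> h < h0 -> 0 <= a -> a + h <= T ->
    (P [set om | (e < `|semigroup_increment S Y a h om|)%R] <= c%:E)%E.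
Proof.
move=> [D [cD dD]] SP mY T0 C0 tr e0 c0; apply: contrapT => H.
have T2 : 0 < T / 2 by rewrite divr_gt0.
(* Failure gives lengths tending to 0 and starting points at which the probability exceeds [c]; the
   pathwise limit is then taken along this sequence. *)
have bad (n : nat) : exists p : R * R, [/\ 0 <= p.1, p.1 < T / 2 / n.+1%:R, 0 <= p.2,
    p.2 + p.1 <= T & ~ (P [set om | (e < `|semigroup_increment S Y p.2 p.1 om|)%R] <= c%:E)%E].
  apply: contrapT => H'; apply: H; exists (T / 2 / n.+1%:R); first by rewrite !divr_gt0.
  move=> h a h0 hn a0 ahT; apply: contrapT => hP; apply: H'.
  by exists (h, a).
have [q hq] := choice bad.
pose hk n := (q n).1.
have hk0 n : 0 <= hk n by case: (hq n).
have hkT n : 0 <= hk n <= T / 2.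
  rewrite hk0/=; have [_ /ltW h1 _ _ _] := hq n; rewrite (le_trans h1)//.
  by rewrite ler_pdivrMr// ler_peMr ?(ltW T2)// ler1n.
have hkcvg : hk n @[n --> \oo] --> 0.
  apply: (@squeeze_cvgr _ _ _ _ (fun=> 0) (fun n => T / 2 / n.+1%:R)).
  - by apply: nearW => n; rewrite hk0/=; have [_ /ltW] := hq n.
  - exact: cvg_cst.
  - rewrite -(mulr0 (T / 2)); apply: cvgMr; exact: cvg_harmonic.
have [_ cS _ _ _] := SP.
pose y := time_restrict T Y.
pose g n (p : R * Omega) := `|y (p.1 + hk n, p.2) - S (hk n) (y p)|.
have mg n : measurable_fun setT (g n).
  have msh : measurable_fun setT (fun p : R * Omega => (p.1 + hk n, p.2)).
    by apply: measurable_fun_pair => //; exact: measurable_funD.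
  have mysh : borel_measurable (fun p : R * Omega => y (p.1 + hk n, p.2)).
    move=> O oO; rewrite -[X in measurable X]setTI.
    exact: (msh measurableT _ (mY O oO)).
  apply: (borel_measurable_pair (fun p : R * Omega => y (p.1 + hk n, p.2)) y
    (fun p => `|p.1 - S (hk n) p.2|) D) => //.
  move=> p; apply: cvg_norm; apply: cvgB; first exact: cvg_fst.
  by apply: continuous_comp; [exact: cvg_snd|exact: cS].
pose A n := [set p : R * Omega | C * e < g n p].
have mA n : measurable (A n).
  by rewrite -[A n]setTI; apply: measurable_fun_ltr.
pose I : set R := `[0, T / 2]%classic.
have mI : measurable I by exact: measurable_itv.
have muI : @lebesgue_measure R I = (T / 2)%:E.
  by rewrite lebesgue_measure_itv/= lte_fin T2 oppr0 adde0.
have I0 : (0 < @lebesgue_measure R I)%E by rewrite muI lte_fin.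
have I1 : (@lebesgue_measure R I < +oo)%E by rewrite muI ltry.
have path : {ae P, forall om, @lebesgue_measure R (I `&` ysection (A n) om) @[n --> \oo] --> 0%E}.
  apply: aeW => om.
  have sE n : ysection (A n) om = [set s | C * e < `|y (s + hk n, om) - S (hk n) (y (s, om))|].
    by apply/seteqP; split => s; rewrite /ysection/= inE.
  rewrite (_ : (fun n => _) = fun n => @lebesgue_measure R (I `&`
      [set s | (C * e < `|y (s + hk n, om) - S (hk n) (y (s, om))|)%R])); last first.
    by apply/funext => n; rewrite sE.
  apply: (path_translation_cvg S SP (fun s => y (s, om)) D T (C * e) hk cD dD) => //.
  - move=> x; have mp : measurable_fun setT (fun s : R => (s, om)) by exact: measurable_fun_pair.
    have my : measurable_fun setT (fun p => `|y p - x|).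
      apply: (borel_measurable_pair y y (fun p => `|p.1 - x|) D) => // p.
      by apply: cvg_norm; apply: cvgB; [exact: cvg_fst|exact: cvg_cst].
    exact: (measurableT_comp my mp).
  - exact: mulr_gt0.
  - by move=> n; rewrite -sE; apply: measurable_ysection; exact: mA.
(* The good starting point [s] lies in [[0, T / 2]], so [s + hk n <= T], and [tr] carries smallness
   from it to the bad starting point [(q n).2]. *)
have := exists_small_section P I A c mI I0 I1 mA path c0.
move=> /(@filter_ex _ _ _)[n [s Is Ps]].
move: Is; rewrite /I/= in_itv/= => /andP[s0 sT].
have [_ _ a0 ahT] := hq n; apply; have /andP[_ hT] := hkT n.
have shT : s + hk n <= T by rewrite (splitr T) lerD.
apply: le_trans (tr _ _ s _ (hk0 n) a0 ahT s0 shT e0) _; apply: le_trans Ps.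
rewrite (_ : xsection (A n) s = [set om | C * e < `|semigroup_increment S Y s (q n).1 om|])//.
apply/seteqP; split => om; rewrite /xsection/= inE /A /g /y /time_restrict /semigroup_increment/=.
  by rewrite addr_ge0// shT s0 (le_trans _ shT) ?lerDl.
by rewrite addr_ge0// shT s0 (le_trans _ shT) ?lerDl.
Qed.

(** Pathwise continuity of the orbit and dominated convergence, argued along a bad sequence. [r']
    ranges over both sides of [r], as [s] does around [t]. *)
Lemma sgroup_orbit_cvg_prob {d : measure_display} {Omega : measurableType d} {R : realType}
  (P : probability Omega R) {V : completeNormedModType R} (S : R -> V -> V) (X : Omega -> V)
  (r e c : R) :
  (exists D : set V, countable D /\ dense D) -> C0_semigroup S -> borel_measurable X ->
  0 < e -> 0 < c -> exists2 del, 0 < del & forall r', `|r' - r| < del ->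
    (P [set om | (e < `|S (Num.max 0 r) (X om) - S (Num.max 0 r') (X om)|)%R] <= c%:E)%E.
Proof.
move=> [D [cD dD]] SP mX e0 c0; apply: contrapT => H.
have bad (n : nat) : exists q : R, `|q - r| < n.+1%:R^-1 /\
    ~ (P [set om | (e < `|S (Num.max 0 r) (X om) - S (Num.max 0 q) (X om)|)%R] <= c%:E)%E.
  apply: contrapT => H'; apply: H; exists n.+1%:R^-1; first by rewrite invr_gt0.
  by move=> q hq; apply: contrapT => hP; apply: H'; exists q.
have [q hq] := choice bad.
have qcvg : q n @[n --> \oo] --> r.
  apply/cvgrPdist_lt => b b0.
  apply: filterS (near_infty_natSinv_lt (PosNum b0)) => n /= hn.
  by rewrite distrC (lt_trans (hq n).1).
have [_ cS _ _ _] := SP.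
have cSm r' : continuous (S (Num.max 0 r')) by apply: cS; rewrite le_max lexx.
pose A n := [set om | e < `|S (Num.max 0 r) (X om) - S (Num.max 0 (q n)) (X om)|].
have mA n : measurable (A n).
  rewrite -[A n]setTI; apply: measurable_fun_ltr => //.
  apply: (borel_measurable_pair X X (fun p => `|S (Num.max 0 r) p.1 - S (Num.max 0 (q n)) p.2|) D) => //.
  move=> p; apply: cvg_norm; apply: cvgB; apply: continuous_comp.
  - exact: cvg_fst.
  - exact: cSm.
  - exact: cvg_snd.
  - exact: cSm.
have := measure_setI_cvg0 P setT A measurableT _ mA _.
have P1 : (P setT < +oo)%E by rewrite (le_lt_trans (probability_le1 _ _))// ltry.
have ev : {ae P, forall om, [set: Omega] om -> \forall n \near \oo, ~ A n om}.
  apply: aeW => om _.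
  have cq : S (Num.max 0 (q n)) (X om) @[n --> \oo] --> S (Num.max 0 r) (X om).
    apply: (cvg_comp q (fun q => S (Num.max 0 q) (X om)) qcvg).
    exact: (sgroup_continuous _ SP (X om) r).
  move/cvgrPdist_le : cq => /(_ _ e0); apply: filterS => n hn.
  by apply/negP; rewrite -leNgt.
move=> /(_ P1 ev) /cvge0_near_le => /(_ (fun=> measure_ge0 _ _) _ c0).
move=> /(@filter_ex _ _ _)[n]; rewrite setTI.
exact: (hq n).2.
Qed.

Theorem theorem5p2 (R : realType) (d : measure_display) (Omega : measurableType d)
  (P : probability Omega R) (F : R -> set (set Omega))
  (U V : completeNormedModType R) (ipU : U -> U -> R) (ipV : V -> V -> R)
  (S : R -> V -> V) (DA : set V) (A : V -> V)
  (B : {linear U -> V}) (Bs : V -> U) (y0 : V)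
  (L : R -> U -> Omega -> R) (T : R) (Y : R -> Omega -> V) :
  separable_hilbert ipU ->
  separable_hilbert ipV ->
  C0_semigroup S ->
  generates DA A S ->
  continuous B ->
  (forall u v, ipV (B u) v = ipU u (Bs v)) ->
  filtration F ->
  cylindrical_levy P L ->
  weak_solution P F ipV DA A Bs L y0 T Y ->
  forall t, 0 <= t <= T ->
  forall e : R, 0 < e ->
    P [set om | e < `|Y s om - Y t om|] @[s --> within `[0, T] (nbhs t)] --> 0%E.
Proof.
move=> _ [ipP sepV] SP genA _ _ fF cL [pY wbr weq] t tT e e0.
have /andP[t0 tT'] := tT.
have T0 := le_trans t0 tT'.
(* If [T = 0] the time interval is a single point; otherwise it has the positive length on which the
   translation argument rests. *)
move: T0; rewrite le_eqVlt => /predU1P[T0|T0].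
  apply: cvge0_le => // c c0; apply: filterS (withinT _ _) => s /=.
  rewrite in_itv/= => /andP[s0 sT].
  have -> : s = t by apply/eqP; rewrite eq_le (le_trans sT) -?T0// (le_trans tT') -?T0.
  rewrite (_ : [set _ | _] = set0) ?measure0 ?lee_fin ?ltW//.
  by apply/seteqP; split => om //=; rewrite subrr normr0 ltNge (ltW e0).
have mY := time_restrict_measurable T Y F fF (ltW T0) pY.
have [C C0 tr] := increment_transfer P ipV S DA A Bs y0 L T Y ipP sepV SP genA cL mY wbr weq.
apply: cvge0_le => // c c0.
have e3 : 0 < e / 3 by rewrite divr_gt0.
have c3 : 0 < c / 3 by rewrite divr_gt0.
have [h0 h00 small] := uniform_increment_small P S T Y C _ _ sepV SP mY T0 C0 tr e3 c3.
(* The base point does not depend on [s], so one random vector [Y a] serves all [s] near [t]. Half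
   of [h0] is spent on [t - a] and half on [s - t]; the clamp covers [t] close to 0. *)
pose a := Num.max 0 (t - h0 / 2).
have h02 : 0 < h0 / 2 by rewrite divr_gt0.
have a0 : 0 <= a by rewrite le_max lexx.
have a_t : a <= t by rewrite ge_max t0 gerBl ltW.
have ta : t - a <= h0 / 2 by rewrite lerBlDl -lerBlDr le_max lexx orbT.
have mYs s : 0 <= s <= T -> borel_measurable (Y s) by exact: (borel_measurable_time T Y mY).
have aT : 0 <= a <= T by rewrite a0 (le_trans a_t).
have [del del0 orb] := sgroup_orbit_cvg_prob P S (Y a) (t - a) _ _ sepV SP (mYs a aT) e3 c3.
have [D [cD dD]] := sepV; have [_ cS _ _ _] := SP.
have near_t : \forall s \near nbhs t, `|s - t| < Num.min (h0 / 2) del.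
  by near=> s; rewrite distrC; near: s; apply: cvgr_dist_lt; [exact: cvg_id|rewrite lt_min h02].
rewrite near_withinE; apply: filterS near_t => s; rewrite lt_min => /andP[sh sd] /=.
rewrite in_itv/= => /andP[s0 sT].
have as_ : a <= s.
  rewrite ge_max s0/=; move: sh; rewrite ltr_norml => /andP[? _]; lra.
have sa_h : s - a < h0.
  move: sh; rewrite ltr_norml => /andP[_ ?]; move: ta; clearbody a; lra.
pose Z := semigroup_increment S Y a.
pose E1 := [set om | e / 3 < `|Z (t - a) om|].
pose E2 := [set om | e / 3 < `|Z (s - a) om|].
pose E3 := [set om | e / 3 < `|S (Num.max 0 (t - a)) (Y a om) - S (Num.max 0 (s - a)) (Y a om)|].
have b1 : (P E1 <= (c / 3)%:E)%E.
  apply: small => //; rewrite ?subr_ge0// ?(addrC a) ?subrK//.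
  by rewrite (le_lt_trans ta)// ltr_pdivrMr// ltr_pMr// ltr1n.
have b2 : (P E2 <= (c / 3)%:E)%E.
  by apply: small => //; rewrite ?subr_ge0// ?(addrC a) ?subrK.
have b3 : (P E3 <= (c / 3)%:E)%E.
  by apply: orb; rewrite (_ : s - a - (t - a) = s - t)//; ring.
have mlt (f : Omega -> R) r : measurable_fun setT f -> measurable [set om | r < f om].
  by move=> mf; rewrite -[X in measurable X]setTI; exact: measurable_fun_ltr.
have m1 : measurable E1.
  apply: mlt; apply: (measurable_norm_increment S T Y sepV SP mY) => //.
    by rewrite subr_ge0.
  by rewrite addrC subrK.
have m2 : measurable E2.
  apply: mlt; apply: (measurable_norm_increment S T Y sepV SP mY) => //.
    by rewrite subr_ge0.
  by rewrite addrC subrK.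
have m3 : measurable E3.
  apply: mlt; apply: (borel_measurable_pair (Y a) (Y a)
    (fun p => `|S (Num.max 0 (t - a)) p.1 - S (Num.max 0 (s - a)) p.2|) D cD dD
    (mYs a aT) (mYs a aT)).
  have cSm q : continuous (S (Num.max 0 q)) by apply: cS; rewrite le_max lexx.
  move=> p; apply: cvg_norm; apply: cvgB; apply: continuous_comp.
  - exact: cvg_fst.
  - exact: cSm.
  - exact: cvg_snd.
  - exact: cSm.
have -> : c = c / 3 + c / 3 + c / 3 by field.
rewrite 2!EFinD; apply: le_trans (leeD (leeD b1 b2) b3).
apply: le_trans (leeD (measureU2 P m1 m2) (lexx (P E3))).
apply: le_trans (measureU2 P (measurableU _ _ m1 m2) m3).
apply: le_measure; rewrite ?inE.
- apply: mlt; apply: (borel_measurable_pair (Y s) (Y t) (fun p => `|p.1 - p.2|) D cD dD).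
  + by apply: mYs; rewrite s0.
  + exact: mYs.
  + by move=> p; apply: cvg_norm; apply: cvgB; [exact: cvg_fst|exact: cvg_snd].
- by apply: measurableU => //; exact: measurableU.
move=> om /= he.
have [h1|h1] := ltP (e / 3) `|Z (t - a) om|; first by left; left.
have [h2|h2] := ltP (e / 3) `|Z (s - a) om|; first by left; right.
right; rewrite /E3/= ltNge; apply/negP => h3.
move: he; rewrite ltNge => /negP; apply.
have -> : Y s om - Y t om = Z (s - a) om - Z (t - a) om
  - (S (Num.max 0 (t - a)) (Y a om) - S (Num.max 0 (s - a)) (Y a om)).
  rewrite /Z /semigroup_increment (max_r (_ : 0 <= t - a)) ?subr_ge0//.
  rewrite (max_r (_ : 0 <= s - a)) ?subr_ge0//.
  rewrite (addrC a) subrK (addrC a) subrK.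
  set p := S _ _; set q := S _ _.
  by rewrite -addrA -opprD subrKA opprB subrKA.
have -> : e = e / 3 + e / 3 + e / 3 by field.
rewrite (le_trans (ler_normB _ _))// lerD//.
by rewrite (le_trans (ler_normB _ _))// lerD.
Unshelve. all: by end_near. Qed.
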